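(* Let $M$ be a 3-minimal hypersurface in the Euclidean space $\mathbb{E}^4$. Then $M$ is a generalized constant ratio (GCR) hypersurface if and only if it is congruent to one of the following 3 types of hypersurfaces: (i) one of the following hypercylinders: a hyperplane $\mathbb{E}^3$; a spherical hypercylinder $\mathbb{S}^2(r^2)\times\mathbb{E}$; a circular hypercylinder $\mathbb{S}^1(r)\times\mathbb{E}^2$; or a hypercylinder over a cone given by $x(s,t,u)=((c_1s+c_2)\cos t,\ (c_1s+c_2)\sin t,\ c_2s,\ u)$ for some non-zero constants $c_1$ and $c_2$; (ii) a hypersurface given by $x(s,v,w)=s\,y(v,w)+c\,n(v,w)$, where $y:\Omega\to\mathbb{E}^4$ ($\Omega\subset\mathbb{R}^2$ open) is an oriented regular surface lying on $\mathbb{S}^3(1)\subset\mathbb{E}^4$, $n$ is its spherical normal, and $c$ is a constant; (iii) a hypersurface given by $$x(s,v,w)=s\,\alpha(w)+c\left(\cos\frac vc\,A(w)+\sin\frac vc\,B(w)\right)$$ for a constant $c>0$, where $\alpha$ is a regular curve, parametrized by unit speed, lying on $\mathbb{S}^3(1)\subset\mathbb{E}^4$ and $A(w),B(w)$ are two orthonormal vector fields spanning the normal space of $\alpha$ in $\mathbb{S}^3(1)$, i.e. $\langle A,B\rangle=\langle A,\alpha\rangle=\langle A,\alpha'\rangle=\langle B,\alpha\rangle=\langle B,\alpha'\rangle=0$ and $\langle A,A\rangle=\langle B,B\rangle=1$.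
   Context: Hypersurfaces are smooth, connected and oriented, with shape operator $S$ along the unit normal $N$; principal directions and principal curvatures $k_1,k_2,k_3$ are the eigenvectors and eigenvalues of $S$. A hypersurface of $\mathbb{E}^4$ is 3-minimal if its Gauss-Kronecker curvature $H_3=k_1k_2k_3$ vanishes identically. The position vector $x$ (with respect to the origin) of a hypersurface $M$ is decomposed as $x=x^T+x^\perp$ into tangential and normal components; $M$ is called a generalized constant ratio (GCR) hypersurface if $x^T$ is one of its principal directions (i.e. $x^T$ is an eigenvector of $S$). $\mathbb{S}^2(r^2)$ and $\mathbb{S}^1(r)$ denote a round 2-sphere and a circle ($r\neq0$ constant), and $\mathbb{S}^3(1)$ is the unit sphere centered at the origin. The spherical normal $n$ of a surface $y$ in $\mathbb{S}^3(1)$ is its unit normal vector field in $\mathbb{S}^3(1)$, i.e. $\langle n,n\rangle=1$ and $\langle n,y\rangle=\langle n,y_v\rangle=\langle n,y_w\rangle=0$.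
   Formalization: ''Congruent to one of'' is read locally and generically: near each point of an open dense subset M is congruent to an open part of some listed type, possibly varying with the point; congruences are the isometries fixing the origin, and GCR is only required where x^T is nonzero. *)

(* Defs.v *)
From HB Require Import structures.
From mathcomp Require Import all_boot all_order all_algebra.
From mathcomp Require Import all_classical all_reals all_analysis.
Set Implicit Arguments.
Unset Strict Implicit.
Unset Printing Implicit Defensive.
Import Order.TTheory GRing.Theory Num.Theory.
Import numFieldNormedType.Exports.
Local Open Scope classical_set_scope.
Local Open Scope ring_scope.

Definition dot (R : realType) (n : nat) (u v : 'rV[R]_n) : R := (u *m v^T) 0 0.

Definition vec2 (R : realType) (a b : R) : 'rV[R]_2 :=
  \row_(i < 2) [:: a; b]`_i.

Definition vec4 (R : realType) (a b c d : R) : 'rV[R]_4 :=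
  \row_(i < 4) [:: a; b; c; d]`_i.

(* C^infinity on an open set: all iterated directional derivatives are
   Frechet differentiable at all points of U. *)
Definition smooth_on (R : realType) (V W : normedModType R)
    (U : set V) (f : V -> W) : Prop :=
  forall (vs : seq V) (p : V), U p ->
    differentiable (foldr (fun v (g : V -> W) => fun q => 'D_v g q) f vs) p.

Section Hypersurface.
Variables (R : realType) (M : topologicalType).
(* [x] is the position vector and [N] the unit normal of the hypersurface. *)
Variables (x N : M -> 'rV[R]_4).

(* [psi] restricts to a homeomorphism of the open set U of R^3 onto an open
   subset of M, and x \o psi is a smooth immersion on U. *)
Definition local_param (U : set 'rV[R]_3) (psi : 'rV[R]_3 -> M) : Prop :=
  [/\ open U,
      {within U, continuous psi},
      set_inj U psi,
      (forall V, V `<=` U -> open V -> open (psi @` V))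
    & smooth_on U (x \o psi) /\
      forall q, U q -> row_free (jacobian (x \o psi) q)].

(* A connected 3-manifold immersed in R^4.  The smooth structure need not be
   given separately: any two local parametrizations are related by a smooth
   change of coordinates, since their composites with x are immersions that
   are locally homeomorphisms onto their images. *)
Definition hypersurface : Prop :=
  [/\ hausdorff_space M, second_countable (T := M), connected [set: M]
    & forall p, exists U psi, local_param U psi /\ (psi @` U) p].

Definition unit_normal_field : Prop :=
  (forall p, dot (N p) (N p) = 1) /\
  (forall U psi, local_param U psi ->
     smooth_on U (N \o psi) /\
     forall q v, U q -> dot (N (psi q)) ('d (x \o psi) q v) = 0).

Definition oriented_hypersurface : Prop := hypersurface /\ unit_normal_field.

(* The graph of the shape operator at p: X is tangent to M at p and
   Y = S X = - D_X N. *)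
Definition shape_operator (p : M) (X Y : 'rV[R]_4) : Prop :=
  exists U psi q v,
    [/\ local_param U psi, U q, psi q = p,
        X = 'd (x \o psi) q v & Y = - 'd (N \o psi) q v].

Definition principal_direction (p : M) (X : 'rV[R]_4) (k : R) : Prop :=
  X != 0 /\ shape_operator p X (k *: X).

(* The eigenvalues of S at p, listed with multiplicity. *)
Definition principal_curvatures (p : M) (k : 'I_3 -> R) : Prop :=
  exists e : 'I_3 -> 'rV[R]_4,
    (forall i j, dot (e i) (e j) = (i == j)%:R) /\
    (forall i, principal_direction p (e i) (k i)).

Definition gauss_kronecker_curvature (p : M) (h : R) : Prop :=
  exists2 k, principal_curvatures p k & h = \prod_(i < 3) k i.

Definition three_minimal : Prop := forall p, gauss_kronecker_curvature p 0.

Definition tangential_part (p : M) : 'rV[R]_4 := x p - dot (x p) (N p) *: N p.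

(* Only points with x^T != 0 are constrained: x^T vanishes at some points of
   hyperplanes, of S^2(r) x E and of S^1(r) x E^2. *)
Definition gcr : Prop :=
  forall p, tangential_part p != 0 ->
    exists k, principal_direction p (tangential_part p) k.

End Hypersurface.

(* The model hypersurfaces are predicates on parametrized pieces f, defined on
   U.  Lying in a hyperplane, or in a round hypercylinder, means being an open
   part of it when f is an immersion. *)
Section Models.
Variable R : realType.
Implicit Types (U : set 'rV[R]_3) (f : 'rV[R]_3 -> 'rV[R]_4).

Definition hyperplane U f : Prop :=
  exists (a : 'rV[R]_4) (b : R), a != 0 /\ forall q, U q -> dot (f q) a = b.

Definition spherical_hypercylinder U f : Prop :=
  exists r : R, r != 0 /\
    forall q, U q -> f q 0 0 ^+ 2 + f q 0 1 ^+ 2 + f q 0 2 ^+ 2 = r ^+ 2.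

Definition circular_hypercylinder U f : Prop :=
  exists r : R, r != 0 /\
    forall q, U q -> f q 0 0 ^+ 2 + f q 0 1 ^+ 2 = r ^+ 2.

Definition conical_hypercylinder U f : Prop :=
  exists c1 c2 : R, [/\ c1 != 0, c2 != 0
    & forall q, U q ->
        let s := q 0 0 in let t := q 0 1 in let u := q 0 2 in
        f q = vec4 ((c1 * s + c2) * cos t) ((c1 * s + c2) * sin t) (c2 * s) u].

Definition hypercylinder U f : Prop :=
  [\/ hyperplane U f, spherical_hypercylinder U f,
      circular_hypercylinder U f | conical_hypercylinder U f].

Definition unit_sphere3 : set 'rV[R]_4 := [set z | dot z z = 1].

Definition spherical_surface (Omega : set 'rV[R]_2) (y n : 'rV[R]_2 -> 'rV[R]_4)
    : Prop :=
  [/\ open Omega,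
      (smooth_on Omega y /\ forall z, Omega z -> row_free (jacobian y z)),
      (forall z, Omega z -> unit_sphere3 (y z)),
      smooth_on Omega n
    & forall z, Omega z ->
        let y_v := 'D_(vec2 1 0) y z in let y_w := 'D_(vec2 0 1) y z in
        [/\ dot (n z) (n z) = 1, dot (n z) (y z) = 0,
            dot (n z) y_v = 0 & dot (n z) y_w = 0]].

Definition surface_type U f : Prop :=
  exists (Omega : set 'rV[R]_2) (y n : 'rV[R]_2 -> 'rV[R]_4) (c : R),
    spherical_surface Omega y n /\
    forall q, U q ->
      let s := q 0 0 in let z := vec2 (q 0 1) (q 0 2) in
      Omega z /\ f q = s *: y z + c *: n z.

Definition framed_spherical_curve (I : set R) (alpha A B : R -> 'rV[R]_4)
    : Prop :=
  [/\ open I /\ is_interval I,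
      [/\ smooth_on I alpha, smooth_on I A & smooth_on I B],
      (forall w, I w ->
         unit_sphere3 (alpha w) /\ dot (derive1 alpha w) (derive1 alpha w) = 1),
      (forall w, I w ->
         [/\ dot (A w) (A w) = 1, dot (B w) (B w) = 1 & dot (A w) (B w) = 0])
    & forall w, I w ->
        [/\ dot (A w) (alpha w) = 0, dot (A w) (derive1 alpha w) = 0,
            dot (B w) (alpha w) = 0 & dot (B w) (derive1 alpha w) = 0]].

Definition curve_type U f : Prop :=
  exists (I : set R) (alpha A B : R -> 'rV[R]_4) (c : R),
    [/\ framed_spherical_curve I alpha A B, 0 < c
      & forall q, U q ->
          let s := q 0 0 in let v := q 0 1 in let w := q 0 2 in
          I w /\
          f q = s *: alpha w + c *: (cos (v / c) *: A w + sin (v / c) *: B w)].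

End Models.

(* Near p, M is congruent to an open part of a hypersurface of the family
   [model].  Being GCR depends on the choice of the origin, so congruences are
   the isometries of E^4 fixing the origin.  The classification is local and
   generic: the rank of the map x^T / |x^T| from M to S^3 decides between the
   families and may jump on a nowhere dense set, where none of them applies. *)
Definition locally_congruent (R : realType) (M : topologicalType)
    (x : M -> 'rV[R]_4) (p : M)
    (model : set 'rV[R]_3 -> ('rV[R]_3 -> 'rV[R]_4) -> Prop) : Prop :=
  exists (Q : 'M[R]_4) (U : set 'rV[R]_3) (psi : 'rV[R]_3 -> M),
    [/\ Q *m Q^T = 1%:M, local_param x U psi, (psi @` U) p
      & model U (fun q => x (psi q) *m Q)].

(* Main.v *)
Require Import Defs.
From HB Require Import structures.
From mathcomp Require Import all_boot all_order all_fingroup all_algebra.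
From mathcomp Require Import all_classical all_reals all_analysis.
From mathcomp Require Import ring lra.
Set Implicit Arguments.
Unset Strict Implicit.
Unset Printing Implicit Defensive.
Import Order.TTheory GRing.Theory Num.Theory.
Import numFieldNormedType.Exports.
Local Open Scope classical_set_scope.
Local Open Scope ring_scope.

(** The key is the support function g = <x, N>: a 3-minimal hypersurface is GCR
    iff g is locally constant.  Since dg = <x, dN>, a locally constant g makes
    x^T a null direction of the shape operator S.  Conversely, where dg <> 0 one
    has S x^T = k x^T with k <> 0; every smooth null field of S then vanishes by
    the Codazzi equation, so S = 0 there, a contradiction.

    When g = c is constant, x = t y + c N with t = |x^T| and y = x^T / t, and
    both y and N are constant along the integral curves of x^T.  The rank of the
    map y is at most 2: rank 2 gives type (ii); rank 1 gives type (iii), where N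
    rotates in the normal plane of the curve traced by y; rank 0 gives
    |x - <x, y> y| = |c| with y constant, a spherical hypercylinder.  One of
    these ranks is locally constant near a dense set of points.

    For the converse each model carries an explicit field m parallel to N with
    <m, m> and <x, m> constant, so that g^2 is locally constant on a dense open
    set, and hence dg = 0 everywhere. *)

(** * Smooth maps *)

(** The charts of M are tied together only through x: smooth transition maps are not part of the
    data, and the shape operator at a point may be computed in any chart. What passes easily from
    one chart to another is the vanishing of a first derivative. An eigenvector equation is
    therefore recast as the statement that a scalar function on M, with the vector or the eigenvalue
    frozen, is critical at the point. Eigenvalues and eigenvectors are given point by point, with no
    regularity, so the Codazzi argument differentiates only null fields that are polynomial in the
    entries of the second fundamental form. The models of types (ii) and (iii) are explicit
    parametrizations and need charts whose coordinates are prescribed functions: t, linear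
    functionals of y and N, an angle, an arc length. This is what the inverse function theorem is
    for. In the converse the field m determines N only up to sign and scale, hence the passage
    through g^2. *)

Lemma diff_eps (R : realType) (V W : normedModType R) (f : V -> W) (p : V)
    (L : {linear V -> W}) :
  continuous L ->
  (forall e, 0 < e -> \forall h \near 0, `|f (h + p) - f p - L h| <= e * `|h|) ->
  differentiable f p /\ 'd f p = L :> (V -> W).
Proof.
move=> cL H.
have E : f \o shift p = cst (f p) + L +o_ 0 id.
  apply/eqaddoP => e e0; near=> h.
  rewrite /= -[_ h]/(f (h + p) - (f p + L h)) opprD addrA.
  by near: h; apply: H.
have dE : 'd f p = L :> (V -> W) by apply: diff_unique.
by split=> //; apply/diff_locallyP; rewrite dE.
Unshelve. all: by end_near. Qed.

Lemma eps_diff (R : realType) (V W : normedModType R) (f : V -> W) (p : V) :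
  differentiable f p ->
  forall e, 0 < e -> \forall h \near 0, `|f (h + p) - f p - 'd f p h| <= e * `|h|.
Proof.
move=> df e e0; have [_ /eqaddoP H] := (diff_locallyP _ _).1 df.
near=> h; have : `|(f \o shift p - (cst (f p) + 'd f p)) h| <= e * `|h|.
  by near: h; apply: H.
by rewrite /= -[_ h]/(f (h + p) - (f p + 'd f p h)) opprD addrA.
Unshelve. all: by end_near. Qed.

Lemma near_eq_differentiable (R : realType) (V W : normedModType R)
    (f g : V -> W) (p : V) :
  {near p, f =1 g} -> differentiable f p -> differentiable g p.
Proof.
move=> fg df; apply: (diff_eps (L := 'd f p) _ _).1.
  exact: diff_continuous.
move=> e e0; near=> h; rewrite -(nbhs_singleton fg).
rewrite -(_ : f (h + p) = g (h + p)); first by near: h; apply: eps_diff.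
near: h; move: fg; rewrite (near_shift 0) subr0; apply: filterS => h /=.
by rewrite addrC.
Unshelve. all: by end_near. Qed.

Section coord.
Context {R : realType} {V : normedModType R}.

Lemma differentiable_rV n (f : V -> 'rV[R]_n) p :
  differentiable f p <-> forall i, differentiable (fun q => f q 0 i) p.
Proof.
split=> [df i|df].
  exact: (differentiable_comp df (@differentiable_coord R 1 n (f p) 0 i)).
have -> : f = (fun q => \sum_(i < n) (f q 0 i *: (delta_mx 0 i : 'rV[R]_n))).
  by apply/funext => q; rewrite -row_sum_delta.
rewrite (_ : (fun _ => _) = \sum_(i < n) (fun q => f q 0 i *: (delta_mx 0 i : 'rV[R]_n))).
  by apply: differentiable_sum => i; exact: differentiableZl.
by apply/funext => q; rewrite fct_sumE.
Qed.

Lemma derive_rV n (f : V -> 'rV[R]_n) p v i :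
  differentiable f p -> ('D_v f p) 0 i = 'D_v (fun q => f q 0 i) p.
Proof. by move=> df; rewrite derive_mx ?mxE//; exact: diff_derivable. Qed.

End coord.

Lemma diff_comp_derive (R : realType) (U V W : normedModType R)
    (f : U -> V) (g : V -> W) p v :
  differentiable f p -> differentiable g (f p) ->
  'D_v (g \o f) p = 'D_('D_v f p) g (f p).
Proof.
move=> df dg; rewrite (deriveE _ df) (deriveE _ dg).
by rewrite (deriveE _ (differentiable_comp df dg)) diff_comp.
Qed.

Lemma derive_sum_basis (R : realType) n (W : normedModType R) (g : 'rV[R]_n -> W) p w :
  differentiable g p ->
  'D_w g p = \sum_(i < n) w 0 i *: 'D_(delta_mx 0 i) g p.
Proof.
move=> dg; rewrite deriveE// {1}(row_sum_delta w) linear_sum.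
by apply: eq_bigr => i _; rewrite linearZ deriveE.
Qed.

(** Finite-order form of [smooth_on], recursive in the order so that closure under products and
    composites is an induction. Order 0 already demands differentiability: [Ck k] says that all
    iterated derivatives of length at most k are differentiable. *)
Fixpoint Ck (R : realType) (V W : normedModType R) (k : nat) (U : set V)
    (f : V -> W) : Prop :=
  (forall p, U p -> differentiable f p) /\
  (if k is k'.+1 then forall v, Ck k' U (fun q => 'D_v f q) else True).

Section Ck_basic.
Context {R : realType} {V W : normedModType R}.
Implicit Types (U : set V) (f g : V -> W).

Lemma Ck_diff k U f : Ck k U f -> forall p, U p -> differentiable f p.
Proof. by case: k => [|k] []. Qed.

Lemma CkW k U f : Ck k.+1 U f -> Ck k U f.
Proof.
elim: k f => [|k IH] f [df H]; split => // v; exact/IH/H.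
Qed.

Lemma smooth_onP U f : smooth_on U f <-> forall k, Ck k U f.
Proof.
split=> [H k|H vs].
  elim: k f H => [|k IH] f H; first by split=> //; exact: (H [::]).
  split=> [|v]; first exact: (H [::]).
  by apply: IH => vs p Up; have := H (rcons vs v) p Up; rewrite foldr_rcons.
elim/last_ind: vs f H => [|vs v IH] f H p Up; first exact: (H 0%N).1.
by rewrite foldr_rcons; apply: IH => // k; have [_] := H k.+1; apply.
Qed.

Lemma CkSub k U U' f : U' `<=` U -> Ck k U f -> Ck k U' f.
Proof.
move=> UU; elim: k f => [|k IH] f [df H]; first by split=> // p /UU/df.
by split => [p /UU/df//|v]; exact/IH/H.
Qed.

Lemma eq_Ck k U f g : open U -> (forall p, U p -> f p = g p) ->
  Ck k U f -> Ck k U g.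
Proof.
move=> oU; elim: k f g => [|k IH] f g fg [df H].
  split=> // p Up; apply: near_eq_differentiable (df _ Up).
  by near=> q; apply: fg; near: q; exact: open_nbhs_nbhs.
have nfg p : U p -> {near p, f =1 g}.
  by move=> Up; near=> q; apply: fg; near: q; exact: open_nbhs_nbhs.
split=> [p Up|v]; first by apply: near_eq_differentiable (df _ Up); exact: nfg.
apply: IH (H v) => p Up; apply: near_eq_derive; exact: nfg.
Unshelve. all: by end_near. Qed.

Lemma Ck_cst k U (a : W) : Ck k U (fun=> a).
Proof.
elim: k a => [|k IH] a; split=> // v.
rewrite (_ : (fun q => _) = (fun=> 0 : W)); first exact: IH.
by apply/funext => q; rewrite derive_cst.
Qed.

End Ck_basic.

Section Ck_calculus.
Context {R : realType} {V : normedModType R}.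
Implicit Types (U : set V).

Lemma Ck_derive (W : normedModType R) k U (f : V -> W) v :
  Ck k.+1 U f -> Ck k U (fun q => 'D_v f q).
Proof. by case=> _; apply. Qed.

Lemma Ck_rV n k U (f : V -> 'rV[R]_n) : open U ->
  Ck k U f <-> forall i, Ck k U (fun q => f q 0 i).
Proof.
move=> oU; elim: k f => [|k IH] f; split.
- by move=> [df _] i; split=> // p /df /differentiable_rV.
- by move=> df; split=> // p Up; apply/differentiable_rV => i; exact: (df i).1.
- move=> [df H] i; split=> [p /df /differentiable_rV//|v].
  have /IH/(_ i) := H v; apply: eq_Ck => // p Up.
  by rewrite derive_rV//; exact: df.
- move=> H.
  have df p : U p -> differentiable f p.
    by move=> Up; apply/differentiable_rV => i; exact: (H i).1.
  split=> // v; apply/IH => i; have [_ /(_ v)] := H i; apply: eq_Ck => // p Up.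
  by rewrite derive_rV//; exact: df.
Qed.

Lemma CkD (W : normedModType R) k U (f g : V -> W) : open U -> Ck k U f -> Ck k U g ->
  Ck k U (fun q => f q + g q).
Proof.
move=> oU; elim: k f g => [|k IH] f g [df Hf] [dg Hg].
  by split=> // p Up; apply: differentiableD; [exact: df|exact: dg].
split=> [p Up|v]; first by apply: differentiableD; [exact: df|exact: dg].
apply: eq_Ck (IH _ _ (Hf v) (Hg v)) => // p Up.
by rewrite (deriveD (diff_derivable (df _ Up)) (diff_derivable (dg _ Up))).
Qed.

Lemma CkM k U (f g : V -> R) : open U -> Ck k U f -> Ck k U g ->
  Ck k U (fun q => f q * g q).
Proof.
move=> oU; elim: k f g => [|k IH] f g [df Hf] [dg Hg].
  by split=> // p Up; apply: differentiableM; [exact: df|exact: dg].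
split=> [p Up|v]; first by apply: differentiableM; [exact: df|exact: dg].
have cf := CkW (conj df Hf : Ck k.+1 U f).
have cg := CkW (conj dg Hg : Ck k.+1 U g).
apply: eq_Ck (CkD oU (IH _ _ cf (Hg v)) (IH _ _ cg (Hf v))) => // p Up.
by rewrite (deriveM (diff_derivable (df _ Up)) (diff_derivable (dg _ Up))).
Qed.

Lemma CkN k U (f : V -> R) : open U -> Ck k U f -> Ck k U (fun q => - f q).
Proof.
move=> oU cf; apply: eq_Ck (CkM oU (Ck_cst k U (-1 : R)) cf) => // p _.
by rewrite mulN1r.
Qed.

Lemma Ck_sum n k U (f : 'I_n -> V -> R) : open U -> (forall i, Ck k U (f i)) ->
  Ck k U (fun q => \sum_(i < n) f i q).
Proof.
move=> oU; elim: n f => [|n IH] f cf.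
  by apply: eq_Ck (Ck_cst k U (0 : R)) => // p _; rewrite big_ord0.
apply: eq_Ck (CkD oU (cf ord0) (IH (fun i => f (lift ord0 i)) _)) => // p _.
by rewrite big_ord_recl.
Qed.

(** The derivative of h o f is D_v f times h' o f, so order k for h' o f gives order k + 1 for h o
    f. For the inverse and the square root, h' is an expression in h itself and this becomes the
    induction step. *)
Lemma Ck_comp1 k U (h h' : R -> R) (f : V -> R) : open U -> Ck k.+1 U f ->
  (forall p, U p -> is_derive (f p) 1 h (h' (f p))) ->
  Ck k U (fun q => h' (f q)) -> Ck k.+1 U (fun q => h (f q)).
Proof.
move=> oU cf dh ch.
have dhp p : U p -> differentiable h (f p).
  by move=> /dh [dp _]; exact/derivable1_diffP.
split=> [p Up|v].
  by apply: differentiable_comp; [exact: (Ck_diff cf)|exact: dhp].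
apply: eq_Ck (CkM oU (Ck_derive v cf) ch) => // p Up.
rewrite (diff_comp_derive _ (Ck_diff cf Up) (dhp _ Up)).
rewrite [RHS]deriveE; last exact: dhp.
rewrite -[in RHS](mulr1 ('D_v f p)) -[_ * 1]/(_ *: (1 : R)) linearZ -deriveE; last exact: dhp.
by have [_ ->] := dh _ Up.
Qed.

Lemma is_derive_sqrt_at (x : R) : 0 < x -> is_derive x 1 Num.sqrt ((2 * Num.sqrt x)^-1).
Proof. exact: is_derive1_sqrt. Qed.

Lemma is_derive_inv_at (x : R) : x != 0 ->
  is_derive x 1 GRing.inv (- (x^-1 * x^-1)).
Proof.
move=> x0; have d : derivable (fun y : R => y) x 1 by exact: derivable_id.
split; first exact: (derivableV x0 d).
by rewrite (deriveV x0 d) derive_id [LHS]mulr1 expr2 invfM.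
Qed.

Lemma CkV k U (f : V -> R) : open U -> (forall p, U p -> f p != 0) ->
  Ck k U f -> Ck k U (fun q => (f q)^-1).
Proof.
move=> oU f0; elim: k => [|k IH] cf.
  by split=> // p Up; apply: differentiableV; [exact: (Ck_diff cf)|exact: f0].
apply: (Ck_comp1 (h' := fun x => - (x^-1 * x^-1)) oU cf) => [p Up|].
  exact/is_derive_inv_at/f0.
have cf' := IH (CkW cf).
exact: CkN (CkM _ cf' cf').
Qed.

Lemma Ck_sqrt k U (f : V -> R) : open U -> (forall p, U p -> 0 < f p) ->
  Ck k U f -> Ck k U (fun q => Num.sqrt (f q)).
Proof.
move=> oU f0; elim: k => [|k IH] cf.
  split=> // p Up; apply: differentiable_comp; first exact: (Ck_diff cf).
  by apply/derivable1_diffP; have [] := is_derive_sqrt_at (f0 _ Up).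
apply: (Ck_comp1 (h' := fun x => (2 * Num.sqrt x)^-1) oU cf) => [p Up|].
  exact/is_derive_sqrt_at/f0.
apply: CkV => // [p Up|]; first by rewrite mulf_neq0// gt_eqF// sqrtr_gt0 f0.
by apply: CkM => //; [exact: Ck_cst|exact: IH (CkW cf)].
Qed.

Lemma Ck_atan k U (f : V -> R) : open U ->
  Ck k U f -> Ck k U (fun q => atan (f q)).
Proof.
move=> oU; case: k => [|k] cf.
  split=> // p Up; apply: differentiable_comp; first exact: (Ck_diff cf).
  by apply/derivable1_diffP; have [] := is_derive1_atan (f p).
apply: (Ck_comp1 (h := atan) (h' := fun x => (1 + x ^+ 2)^-1) oU cf).
apply: CkV => // [p Up|]; first by rewrite gt_eqF// ltr_wpDr// sqr_ge0.
have c := CkW cf.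
by apply: CkD => //; [exact: Ck_cst|exact: CkM].
Qed.

Lemma Ck_const_derive k U (f : V -> R) (c : V -> R) :
  (forall p, differentiable f p) -> (forall p v, 'D_v f p = c v) -> Ck k U f.
Proof.
move=> df dc; case: k => [|k]; split=> // v.
rewrite (_ : (fun q => _) = (fun=> c v)); first exact: Ck_cst.
by apply/funext => q.
Qed.

End Ck_calculus.

Section Ck_comp.
Context {R : realType} {V : normedModType R}.

Lemma Ck_comp n k (U : set V) (f : V -> 'rV[R]_n) (U' : set 'rV[R]_n) (g : 'rV[R]_n -> R) :
  open U -> (forall p, U p -> U' (f p)) -> Ck k U f -> Ck k U' g ->
  Ck k U (fun q => g (f q)).
Proof.
move=> oU UU'; elim: k g => [|k IH] g cf cg.
  by split=> // p Up; apply: differentiable_comp; [exact: cf.1|exact/cg.1/UU'].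
split=> [p Up|v].
  by apply: differentiable_comp; [exact: cf.1|exact/cg.1/UU'].
have cf' := CkW cf.
apply: (@eq_Ck _ _ _ _ _ (fun p => \sum_(i < n) ('D_v f p) 0 i * 'D_(delta_mx 0 i) g (f p))) => //.
  move=> p Up; have dg := Ck_diff cg (UU' _ Up).
  by rewrite (diff_comp_derive _ (Ck_diff cf Up) dg) (derive_sum_basis _ dg).
apply: Ck_sum => // i; apply: CkM => //.
  exact: ((Ck_rV _ _ oU).1 (Ck_derive v cf)).
exact: (IH (fun z => 'D_(delta_mx 0 i) g z) cf' (Ck_derive (delta_mx 0 i) cg)).
Qed.

End Ck_comp.

Section smooth_calculus.
Context {R : realType} {V : normedModType R}.
Implicit Types (U : set V).

Lemma smooth_differentiable (W : normedModType R) U (f : V -> W) p :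
  smooth_on U f -> U p -> differentiable f p.
Proof. by move=> /(_ [::]); apply. Qed.

Lemma smooth_derive (W : normedModType R) U (f : V -> W) v :
  smooth_on U f -> smooth_on U (fun q => 'D_v f q).
Proof. by move/smooth_onP => H; apply/smooth_onP => k; exact/Ck_derive/H. Qed.

Lemma smoothS (W : normedModType R) U U' (f : V -> W) :
  U' `<=` U -> smooth_on U f -> smooth_on U' f.
Proof. by move=> UU sf vs p /UU; exact: sf. Qed.

Lemma eq_smooth (W : normedModType R) U (f g : V -> W) : open U ->
  (forall p, U p -> f p = g p) -> smooth_on U f -> smooth_on U g.
Proof.
move=> oU fg /smooth_onP H; apply/smooth_onP => k; exact: eq_Ck fg (H k).
Qed.

Lemma smooth_cst (W : normedModType R) U (a : W) : smooth_on U (fun=> a).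
Proof. by apply/smooth_onP => k; exact: Ck_cst. Qed.

Lemma smooth_rV n U (f : V -> 'rV[R]_n) : open U ->
  smooth_on U f <-> forall i, smooth_on U (fun q => f q 0 i).
Proof.
move=> oU; split=> [/smooth_onP H i|H]; apply/smooth_onP => k.
  exact: ((Ck_rV k f oU).1 (H k)).
by apply/Ck_rV => // i; have /smooth_onP := H i; exact.
Qed.

Lemma smoothD (W : normedModType R) U (f g : V -> W) : open U ->
  smooth_on U f -> smooth_on U g -> smooth_on U (fun q => f q + g q).
Proof.
by move=> oU /smooth_onP Hf /smooth_onP Hg; apply/smooth_onP => k; exact: CkD.
Qed.

Lemma smoothM U (f g : V -> R) : open U ->
  smooth_on U f -> smooth_on U g -> smooth_on U (fun q => f q * g q).
Proof.
by move=> oU /smooth_onP Hf /smooth_onP Hg; apply/smooth_onP => k; exact: CkM.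
Qed.

Lemma smoothN U (f : V -> R) : open U ->
  smooth_on U f -> smooth_on U (fun q => - f q).
Proof. by move=> oU /smooth_onP Hf; apply/smooth_onP => k; exact: CkN. Qed.

Lemma smoothV U (f : V -> R) : open U -> (forall p, U p -> f p != 0) ->
  smooth_on U f -> smooth_on U (fun q => (f q)^-1).
Proof. by move=> oU f0 /smooth_onP Hf; apply/smooth_onP => k; exact: CkV. Qed.

Lemma smooth_sqrt U (f : V -> R) : open U -> (forall p, U p -> 0 < f p) ->
  smooth_on U f -> smooth_on U (fun q => Num.sqrt (f q)).
Proof. by move=> oU f0 /smooth_onP Hf; apply/smooth_onP => k; exact: Ck_sqrt. Qed.

Lemma smooth_atan U (f : V -> R) : open U ->
  smooth_on U f -> smooth_on U (fun q => atan (f q)).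
Proof. by move=> oU /smooth_onP Hf; apply/smooth_onP => k; exact: Ck_atan. Qed.

Lemma smooth_comp1 U (h h' : R -> R) (f : V -> R) : open U -> smooth_on U f ->
  (forall p, U p -> is_derive (f p) 1 h (h' (f p))) ->
  smooth_on U (fun q => h' (f q)) -> smooth_on U (fun q => h (f q)).
Proof.
move=> oU /smooth_onP Hf Hd /smooth_onP Hh; apply/smooth_onP => k.
by apply: CkW; apply: Ck_comp1 Hd _.
Qed.

Lemma smooth_sum n U (f : 'I_n -> V -> R) : open U ->
  (forall i, smooth_on U (f i)) -> smooth_on U (fun q => \sum_(i < n) f i q).
Proof.
move=> oU Hf; apply/smooth_onP => k; apply: Ck_sum => // i.
by have /smooth_onP := Hf i; exact.
Qed.

Lemma smooth_dot n U (f g : V -> 'rV[R]_n) : open U ->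
  smooth_on U f -> smooth_on U g -> smooth_on U (fun q => dot (f q) (g q)).
Proof.
move=> oU /(smooth_rV f oU) sf /(smooth_rV g oU) sg.
rewrite (_ : (fun q => _) = fun q => \sum_(i < n) f q 0 i * g q 0 i).
  by apply: smooth_sum => // i; exact: smoothM.
by apply/funext => q; rewrite /dot mxE; apply: eq_bigr => i _; rewrite mxE.
Qed.

Lemma smooth_scale n U (f : V -> R) (g : V -> 'rV[R]_n) : open U ->
  smooth_on U f -> smooth_on U g -> smooth_on U (fun q => f q *: g q).
Proof.
move=> oU sf /(smooth_rV g oU) sg; apply/smooth_rV => // i.
rewrite (_ : (fun q => _) = fun q => f q * g q 0 i); first exact: smoothM.
by apply/funext => q; rewrite mxE.
Qed.

Lemma smoothB n U (f g : V -> 'rV[R]_n) : open U ->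
  smooth_on U f -> smooth_on U g -> smooth_on U (fun q => f q - g q).
Proof.
move=> oU sf sg; apply: smoothD => //.
rewrite (_ : (fun q => _) = fun q => -1 *: g q); last first.
  by apply/funext => q; rewrite scaleN1r.
by apply: smooth_scale => //; exact: smooth_cst.
Qed.

End smooth_calculus.

Lemma smooth_comp (R : realType) (V : normedModType R) n m (U : set V) (f : V -> 'rV[R]_n) (U' : set 'rV[R]_n)
    (g : 'rV[R]_n -> 'rV[R]_m) :
  open U -> open U' -> (forall p, U p -> U' (f p)) -> smooth_on U f ->
  smooth_on U' g -> smooth_on U (fun q => g (f q)).
Proof.
move=> oU oU' UU' /smooth_onP sf /(smooth_rV g oU') sg; apply/smooth_rV => // i.
have /smooth_onP sgi := sg i.
apply/smooth_onP => k; exact: (Ck_comp oU UU' (sf k) (sgi k)).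
Qed.

Lemma smooth_coord (R : realType) n (U : set 'rV[R]_n) i :
  smooth_on U (fun q : 'rV[R]_n => q 0 i).
Proof.
apply/smooth_onP => k; apply: (@Ck_const_derive _ _ _ _ _ (fun v : 'rV[R]_n => v 0 i)) => [p|p v].
  exact: differentiable_coord.
rewrite -(derive_rV (f := id)) ?derive_id//.
Qed.

Lemma smooth_id (R : realType) n (U : set 'rV[R]_n) : open U ->
  smooth_on U (fun q : 'rV[R]_n => q).
Proof. by move=> oU; apply/smooth_rV => // i; exact: smooth_coord. Qed.

Lemma smooth_idR (R : realType) (U : set R) : smooth_on U (fun q : R => q).
Proof.
apply/smooth_onP => k; apply: (@Ck_const_derive _ _ _ _ _ id) => [p|p v] //.
by rewrite derive_id.
Qed.

(** * Vector calculus *)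

Lemma deriveZv (R : realType) (V W : normedModType R) (f : V -> W) p (a : R) v :
  differentiable f p -> 'D_(a *: v) f p = a *: 'D_v f p.
Proof. by move=> df; rewrite !deriveE// linearZ. Qed.

Lemma deriveDv (R : realType) (V W : normedModType R) (f : V -> W) p u v :
  differentiable f p -> 'D_(u + v) f p = 'D_u f p + 'D_v f p.
Proof. by move=> df; rewrite !deriveE// linearD. Qed.

Section line.
Context {R : realType} {V W : normedModType R}.

Lemma is_diff_line (h p : V) (r : R) :
  is_diff r (fun r : R => r *: h + p) ( *:%R^~ h).
Proof.
rewrite (_ : (fun r => _) = ( *:%R^~ h) \+ cst p)//.
apply: is_diff_eq; by rewrite funeqE => x /=; rewrite -[LHS]/(_ + 0) addr0.
Qed.

Lemma is_derive_line (f : V -> W) (h p : V) (r : R) :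
  differentiable f (r *: h + p) ->
  is_derive r 1 (fun r : R => f (r *: h + p)) ('D_h f (r *: h + p)).
Proof.
move=> df; have [dl El] := is_diff_line h p r.
have dc : differentiable (f \o (fun r : R => r *: h + p)) r.
  exact: differentiable_comp.
split; first exact/derivable1_diffP.
rewrite (deriveE (f := f \o (fun r : R => r *: h + p)) 1 dc).
by rewrite diff_comp//= El scale1r deriveE.
Qed.

End line.

Lemma MVT_line (R : realType) (V : normedModType R) (f : V -> R) (h p : V) :
  (forall r : R, 0 <= r <= 1 -> differentiable f (r *: h + p)) ->
  exists2 r : R, 0 < r < 1 & f (h + p) - f p = 'D_h f (r *: h + p).
Proof.
move=> df; have [| |r] := @MVT R (fun r => f (r *: h + p)) (fun r => 'D_h f (r *: h + p)) 0 1 ltr01.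
- move=> x; rewrite in_itv/= => /andP[x0 x1]; apply: is_derive_line.
  by apply: df; rewrite !ltW.
- apply: derivable_within_continuous => x; rewrite in_itv/= => x01.
  by have [] := is_derive_line (df _ x01).
rewrite in_itv/= => r01; rewrite scale1r scale0r add0r subr0 mulr1 => E.
by exists r.
Qed.

Lemma open_ballP (R : realType) (V : normedModType R) (U : set V) p :
  open U -> U p -> exists2 e : R, 0 < e & forall h, `|h| < e -> U (h + p).
Proof.
move=> oU Up; have /nbhs_normP[e e0 eU] : nbhs p U by exact: open_nbhs_nbhs.
exists e => // h he; apply: eU; rewrite /ball_/= opprD addrCA subrr addr0.
by rewrite normrN.
Qed.

Lemma cont_eps (R : realType) (V W : normedModType R) (f : V -> W) p :
  {for p, continuous f} -> forall e : R, 0 < e ->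
  exists2 d : R, 0 < d & forall h, `|h| < d -> `|f (h + p) - f p| < e.
Proof.
move=> /cvgrPdist_lt cf e e0; have /nbhs_normP[d d0 dH] := cf e e0.
exists d => // h hd; rewrite distrC; apply: dH.
by rewrite /ball_/= opprD addrCA subrr addr0 normrN.
Qed.

Section schwarz.
Context {R : realType} {V : normedModType R}.
Variables (U : set V) (f : V -> R).
Hypotheses (oU : open U) (sf : smooth_on U f).

(** The mean value theorem is applied twice: along u to the difference of f between points v apart,
    then along v to D_u f. *)
Let mixed (u v p : V) : (forall r s : R, 0 <= r <= 1 -> 0 <= s <= 1 ->
    U (s *: v + (r *: u + p))) ->
  exists r s : R, [/\ 0 < r < 1, 0 < s < 1 &
   f (u + (v + p)) - f (u + p) - (f (v + p) - f p) =
   'D_v (fun q => 'D_u f q) (s *: v + (r *: u + p))].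
Proof.
move=> H.
have c0 : 0 <= (0 : R) <= 1 by rewrite lexx ler01.
have c1 : 0 <= (1 : R) <= 1 by rewrite lexx ler01.
have df q : U q -> differentiable f q by exact: smooth_differentiable.
have U1 (r : R) : 0 <= r <= 1 -> U (r *: u + (v + p)).
  by move=> r01; rewrite addrCA -{1}(scale1r v); exact: H.
have U0 (r : R) : 0 <= r <= 1 -> U (r *: u + p).
  by move=> r01; have := H r 0 r01 c0; rewrite scale0r add0r.
pose phi (r : R) := f (r *: u + (v + p)) - f (r *: u + p).
pose dphi (r : R) := 'D_u f (r *: u + (v + p)) - 'D_u f (r *: u + p).
have dphiP (r : R) : 0 <= r <= 1 -> is_derive r 1 phi (dphi r).
  move=> r01; apply: is_deriveB; apply: is_derive_line; apply: df.
    exact: U1.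
  exact: U0.
have [| |r r01] := @MVT R phi dphi 0 1 ltr01.
- by move=> x; rewrite in_itv/= => /andP[x0 x1]; apply: dphiP; rewrite !ltW.
- apply: derivable_within_continuous => x; rewrite in_itv/= => x01.
  by have [] := dphiP _ x01.
move: r01; rewrite in_itv/= => r01; rewrite subr0 mulr1 {1 2}/phi !scale1r !scale0r !add0r => E.
have r01' : 0 <= r <= 1 by case/andP: r01 => a b; rewrite !ltW.
have [|s s01 E2] := @MVT_line R V (fun q => 'D_u f q) v (r *: u + p).
  by move=> s s01; apply: (smooth_differentiable (smooth_derive u sf)); exact: H.
by exists r, s; split=> //; rewrite -E2 E /dphi addrCA.
Qed.

(** The second difference of f over a small parallelogram is t^2 times a mixed derivative at some
    nearby point, in either order of differentiation; continuity of both mixed derivatives at p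
    concludes. *)
Lemma schwarz p u v : U p ->
  'D_v (fun q => 'D_u f q) p = 'D_u (fun q => 'D_v f q) p.
Proof.
move=> Up; apply/eqP; rewrite -subr_eq0 -normr_le0; apply/ler_addgt0Pr => e e0.
rewrite add0r.
have sU w := smooth_derive w sf.
have cont w z : {for p, continuous (fun q => 'D_z (fun q => 'D_w f q) q)}.
  apply: differentiable_continuous.
  exact: (smooth_differentiable (smooth_derive z (sU w)) Up).
have e2 : 0 < e / 2 by rewrite divr_gt0.
have [d1 d10 H1] := cont_eps (cont u v) e2.
have [d2 d20 H2] := cont_eps (cont v u) e2.
have [d3 d30 H3] := open_ballP oU Up.
pose d : R := Num.min d1 (Num.min d2 d3).
have d0 : 0 < d by rewrite !lt_min d10 d20.
(* t is so small that the parallelogram spanned by t u and t v stays in the ball where f is smooth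
   and both mixed derivatives are within e / 2 of their values at p. *)
have [t t0 tM] : exists2 t : R, 0 < t & t * (`|u| + `|v|) < d.
  have M0 : 0 < `|u| + `|v| + 1 by rewrite ltr_wpDl// addr_ge0.
  exists (d / (`|u| + `|v| + 1)); first by rewrite divr_gt0.
  by rewrite mulrAC ltr_pdivrMr// ltr_pM2l// ltrDl.
have small (r s : R) : 0 <= r <= 1 -> 0 <= s <= 1 ->
    `|r *: (t *: u) + s *: (t *: v)| < d.
  move=> /andP[r0 r1] /andP[s0 s1]; apply: le_lt_trans (ler_normD _ _) _.
  rewrite 4!normrZ (ger0_norm r0) (ger0_norm s0) (gtr0_norm t0).
  apply: le_lt_trans tM; rewrite mulrDr.
  by apply: lerD; rewrite ler_piMl// mulr_ge0// ltW.
have dU h : `|h| < d -> U (h + p).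
  by rewrite !lt_min => /and3P[_ _]; exact: H3.
have [r s r01 s01|r1 [s1 [/andP[r10 r11] /andP[s10 s11] E1]]] := @mixed (t *: u) (t *: v) p.
  by rewrite addrA; apply: dU; rewrite addrC small.
have [r s r01 s01|r2 [s2 [/andP[r20 r21] /andP[s20 s21] E2]]] := @mixed (t *: v) (t *: u) p.
  by rewrite addrA; apply: dU; rewrite small.
(* The second difference is symmetric in u and v, which links the two applications of [mixed]. *)
have {E2} : f (t *: u + (t *: v + p)) - f (t *: u + p) - (f (t *: v + p) - f p) =
   'D_(t *: u) ('D_(t *: v) f) (s2 *: (t *: u) + (r2 *: (t *: v) + p)).
  by rewrite -E2 [t *: v + (t *: u + p)]addrCA; ring.
rewrite {}E1 !addrA [s1 *: _ + _]addrC.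
have h1 : `|r1 *: (t *: u) + s1 *: (t *: v)| < d by apply: small; rewrite !ltW.
have h2 : `|s2 *: (t *: u) + r2 *: (t *: v)| < d by apply: small; rewrite !ltW.
set q1 := _ + _ + p; set q2 := _ + _ + p.
have U1 : U q1 by exact: dU.
have U2 : U q2 by exact: dU.
have dz w z q : U q -> 'D_(t *: z) ('D_(t *: w) f) q = t * t * 'D_z ('D_w f) q.
  move=> Uq; rewrite (deriveZv _ _ (smooth_differentiable (sU _) Uq)) -mulrA.
  congr (t * _).
  have -> : 'D_z ('D_(t *: w) f) q = 'D_z (fun x => t *: 'D_w f x) q.
    apply: near_eq_derive; near=> x; apply: deriveZv.
    apply: (smooth_differentiable sf); near: x; exact: open_nbhs_nbhs.
  rewrite deriveZ//; apply: diff_derivable.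
  exact: (smooth_differentiable (sU _) Uq).
rewrite (dz u v q1 U1) (dz v u q2 U2) => /(mulfI (lt0r_neq0 (mulr_gt0 t0 t0))) E.
have n1 := H1 (r1 *: (t *: u) + s1 *: (t *: v)).
have n2 := H2 (s2 *: (t *: u) + r2 *: (t *: v)).
rewrite (splitr e) -[X in `|X - _|](subrK ('D_v ('D_u f) q1)) {2}E -addrA.
apply: le_trans (ler_normD _ _) _; apply: lerD.
  rewrite distrC ltW//; apply: n1; apply: lt_le_trans h1 _.
  by rewrite /d ge_min lexx.
rewrite ltW//; apply: n2; apply: lt_le_trans h2 _.
by rewrite /d !ge_min lexx orbT.
Unshelve. all: by end_near. Qed.
End schwarz.

Lemma schwarz_rV (R : realType) (V : normedModType R) n (U : set V)
    (f : V -> 'rV[R]_n) p u v : open U -> smooth_on U f -> U p ->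
  'D_v (fun q => 'D_u f q) p = 'D_u (fun q => 'D_v f q) p.
Proof.
move=> oU sf Up; apply/rowP => i.
have df w q : U q -> differentiable (fun q => 'D_w f q) q.
  exact/smooth_differentiable/smooth_derive.
transitivity ('D_v (fun q => ('D_u f q) 0 i) p); first exact: (derive_rV v i (df u p Up)).
transitivity ('D_u (fun q => ('D_v f q) 0 i) p); last exact/esym/(derive_rV u i (df v p Up)).
have sfi := (smooth_rV f oU).1 sf i.
transitivity ('D_v (fun q => 'D_u (fun q => f q 0 i) q) p).
  apply: near_eq_derive; near=> q; apply: derive_rV.
  by apply: (smooth_differentiable sf); near: q; exact: open_nbhs_nbhs.
rewrite (schwarz oU sfi _ _ Up).
apply: near_eq_derive; near=> q; apply/esym; apply: derive_rV.
by apply: (smooth_differentiable sf); near: q; exact: open_nbhs_nbhs.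
Unshelve. all: by end_near. Qed.

Section dot.
Context {R : realType} {n : nat}.
Implicit Types (u v w : 'rV[R]_n).

Lemma dotE u v : dot u v = \sum_(i < n) u 0 i * v 0 i.
Proof. by rewrite /dot mxE; apply: eq_bigr => i _; rewrite mxE. Qed.

Lemma dotC u v : dot u v = dot v u.
Proof. by rewrite !dotE; apply: eq_bigr => i _; rewrite mulrC. Qed.

Lemma dotDl u v w : dot (u + v) w = dot u w + dot v w.
Proof. by rewrite /dot mulmxDl mxE. Qed.

Lemma dotZl a u w : dot (a *: u) w = a * dot u w.
Proof. by rewrite /dot -scalemxAl mxE. Qed.

Lemma dotDr u v w : dot w (u + v) = dot w u + dot w v.
Proof. by rewrite dotC dotDl !(dotC w). Qed.

Lemma dotZr a u w : dot w (a *: u) = a * dot w u.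
Proof. by rewrite dotC dotZl dotC. Qed.

Lemma dotNl u w : dot (- u) w = - dot u w.
Proof. by rewrite -scaleN1r dotZl mulN1r. Qed.

Lemma dotNr u w : dot w (- u) = - dot w u.
Proof. by rewrite dotC dotNl dotC. Qed.

Lemma dotBl u v w : dot (u - v) w = dot u w - dot v w.
Proof. by rewrite dotDl dotNl. Qed.

Lemma dotBr u v w : dot w (u - v) = dot w u - dot w v.
Proof. by rewrite dotDr dotNr. Qed.

Lemma dot0l w : dot 0 w = 0.
Proof. by rewrite /dot mul0mx mxE. Qed.

Lemma dot0r w : dot w 0 = 0.
Proof. by rewrite dotC dot0l. Qed.

Lemma dot_ge0 u : 0 <= dot u u.
Proof. by rewrite dotE sumr_ge0// => i _; rewrite -expr2 sqr_ge0. Qed.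

Lemma dot_eq0 u : (dot u u == 0) = (u == 0).
Proof.
apply/eqP/eqP => [|->]; last exact: dot0l.
rewrite dotE => /eqP; rewrite psumr_eq0; last by move=> i _; rewrite -expr2 sqr_ge0.
move=> /allP H; apply/rowP => i; rewrite mxE.
by have := H i (mem_index_enum _); rewrite -expr2 sqrf_eq0 => /eqP.
Qed.

Lemma dot_gt0 u : (0 < dot u u) = (u != 0).
Proof. by rewrite lt_neqAle dot_ge0 andbT eq_sym dot_eq0. Qed.

Lemma dot_suml (I : Type) (r : seq I) P (F : I -> 'rV[R]_n) w :
  dot (\sum_(i <- r | P i) F i) w = \sum_(i <- r | P i) dot (F i) w.
Proof. by elim/big_rec2: _ => [|i x y _ <-]; rewrite ?dot0l ?dotDl. Qed.

Lemma derive_dot (V : normedModType R) (f g : V -> 'rV[R]_n) p (v : V) :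
  differentiable f p -> differentiable g p ->
  'D_v (fun q => dot (f q) (g q)) p = dot ('D_v f p) (g p) + dot (f p) ('D_v g p).
Proof.
move=> df dg.
have -> : (fun q => dot (f q) (g q)) = \sum_(i < n) ((fun q => f q 0 i) * (fun q => g q 0 i)).
  by apply/funext => q; rewrite dotE fct_sumE.
have dfi i : derivable (fun q => f q 0 i) p v.
  exact: diff_derivable ((differentiable_rV f p).1 df i).
have dgi i : derivable (fun q => g q 0 i) p v.
  exact: diff_derivable ((differentiable_rV g p).1 dg i).
rewrite derive_sum => [|i]; last exact: derivableM.
rewrite !dotE -big_split; apply: eq_bigr => i _ /=.
rewrite (deriveM (dfi i) (dgi i)) -(derive_rV v i df) -(derive_rV v i dg) addrC.
by congr (_ + _); rewrite -[LHS]/(_ * _) mulrC.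
Qed.

Lemma differentiable_dot (V : normedModType R) (f g : V -> 'rV[R]_n) p :
  differentiable f p -> differentiable g p ->
  differentiable (fun q => dot (f q) (g q)) p.
Proof.
move=> df dg.
have -> : (fun q => dot (f q) (g q)) = \sum_(i < n) ((fun q => f q 0 i) * (fun q => g q 0 i)).
  by apply/funext => q; rewrite dotE fct_sumE.
apply: differentiable_sum => i; apply: differentiableM.
  exact: ((differentiable_rV f p).1 df i).
exact: ((differentiable_rV g p).1 dg i).
Qed.

End dot.

Lemma derive_eq0_cst (R : realType) (V : normedModType R) (f : V -> R) (p : V) (e : R) :
  (forall q, `|q - p| < e -> differentiable f q) ->
  (forall q v, `|q - p| < e -> 'D_v f q = 0) ->
  forall q, `|q - p| < e -> f q = f p.
Proof.
move=> df Df q qe.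
have H (r : R) : 0 <= r <= 1 -> `|r *: (q - p) + p - p| < e.
  move=> /andP[r0 r1]; rewrite addrK normrZ ger0_norm//.
  by apply: le_lt_trans qe; rewrite ler_piMl.
have [r r01|r /andP[r0 r1]] := @MVT_line R V f (q - p) p; first exact/df/H.
by rewrite subrK Df ?H ?ltW// => /eqP; rewrite subr_eq0 => /eqP.
Qed.

(** * Inverse function theorem *)

Lemma linear_le_continuous (R : realType) (V W : normedModType R)
    (f : {linear V -> W}) (C : R) :
  (forall x, `|f x| <= C * `|x|) -> continuous f.
Proof.
move=> HC; apply: bounded_linear_continuous.
apply/ex_bound; exists `|C|; apply/nbhs_normP; exists 1 => //= x.
rewrite /ball_ /= sub0r normrN => x1; apply: le_trans (HC x) _.
apply: (@le_trans _ _ (`|C| * `|x|)); first by rewrite ler_wpM2r// ler_norm.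
by rewrite ler_piMr// ltW.
Qed.

Section mxnorm.
Context {R : realType}.

Lemma norm_coord_le n (x : 'rV[R]_n) i : `|x 0 i| <= `|x|.
Proof.
rewrite [leRHS]/Num.Def.normr/= mx_normrE.
exact: (le_bigmax _ (fun ij : 'I_1 * 'I_n => `|x ij.1 ij.2|) (0, i)).
Qed.

Lemma norm_rV_le n (x : 'rV[R]_n) (c : R) : 0 <= c -> (forall i, `|x 0 i| <= c) ->
  `|x| <= c.
Proof.
move=> c0 H; rewrite [leLHS]/Num.Def.normr/= mx_normrE.
by apply: bigmax_le => // -[i j] _ /=; rewrite ord1.
Qed.

Lemma mulmx_bound n m (M : 'M[R]_(n, m)) :
  exists2 C : R, 0 < C & forall x : 'rV[R]_n, `|x *m M| <= C * `|x|.
Proof.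
pose C := \sum_(i < n) \sum_(j < m) `|M i j| + 1.
have C0 : 0 < C.
  by rewrite ltr_wpDl// sumr_ge0// => i _; rewrite sumr_ge0.
exists C => // x; apply: norm_rV_le => [|j]; first by rewrite mulr_ge0// ltW.
rewrite mxE; apply: le_trans (ler_norm_sum _ _ _) _.
apply: (@le_trans _ _ (\sum_(i < n) `|M i j| * `|x|)).
  by apply: ler_sum => i _; rewrite normrM mulrC ler_wpM2l// norm_coord_le.
rewrite -mulr_suml ler_wpM2r// ler_wpDr//.
by apply: ler_sum => i _; rewrite (bigD1 j)//= lerDl sumr_ge0.
Qed.

Lemma mulmxr_continuous n m (M : 'M[R]_(n, m)) :
  continuous (mulmxr M : 'rV[R]_n -> 'rV[R]_m).
Proof.
have [C _ HC] := mulmx_bound M; exact: (@linear_le_continuous R 'rV[R]_n 'rV[R]_m (mulmxr M) C HC).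
Qed.

Lemma contraction_fixed (X : completeNormedModType R) (p : X) (r : R) (T : X -> X) :
  0 <= r ->
  (forall q, `|q - p| <= r -> `|T q - p| <= r) ->
  (forall q q', `|q - p| <= r -> `|q' - p| <= r -> `|T q - T q'| <= 2^-1 * `|q - q'|) ->
  exists2 q, `|q - p| <= r & T q = q.
Proof.
move=> r0 H1 H2; pose B := [set q : X | `|q - p| <= r].
have [fT ET] : exists f : {fun B >-> B}, f = T :> (X -> X).
  have funB : isFun _ _ B B T by split=> q; exact: H1.
  by exists (HB.pack_for {fun B >-> B} T funB).
have cT : is_contraction fT.
  exists (2^-1)%:nng; split => /=; first by rewrite invf_lt1 ?ltr1n.
  by move=> [q q'] [/= Bq Bq']; rewrite !ET; exact: H2.
have cB : closed B.
  rewrite (_ : B = (fun q => `|q - p|) @^-1` [set y | y <= r])//.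
  apply: closed_comp => [q _|]; last exact: closed_le.
  by apply: (continuous_comp (f := fun q => q - p)); [apply: cvgB => //; exact: cvg_cst|exact: norm_continuous].
have B0 : B !=set0 by exists p; rewrite /B /= subrr normr0.
have [q Bq Eq] := banach_fixed_point cT cB B0.
by exists q => //; rewrite -ET.
Qed.

Lemma contraction_fixed_rV n (p : 'rV[R]_n) (r : R) (T : 'rV[R]_n -> 'rV[R]_n) :
  0 <= r ->
  (forall q, `|q - p| <= r -> `|T q - p| <= r) ->
  (forall q q', `|q - p| <= r -> `|q' - p| <= r -> `|T q - T q'| <= 2^-1 * `|q - q'|) ->
  exists2 q, `|q - p| <= r & T q = q.
Proof.
exact: (@contraction_fixed (HB.pack_for (completeNormedModType R) 'rV[R]_n)).
Qed.

End mxnorm.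

Lemma Ck_det (R : realType) (V : normedModType R) k (U : set V) n (M : V -> 'M[R]_n) :
  open U -> (forall i j, Ck k U (fun q => M q i j)) -> Ck k U (fun q => \det (M q)).
Proof.
move=> oU H.
have prod m (g : 'I_m -> V -> R) : (forall i, Ck k U (g i)) ->
    Ck k U (fun q => \prod_(i < m) g i q).
  elim: m g => [|m IH] g Hg.
    by apply: eq_Ck (Ck_cst k U (1 : R)) => // p _; rewrite big_ord0.
  apply: eq_Ck (CkM oU (Hg ord0) (IH (fun i => g (lift ord0 i)) _)) => // p _.
  by rewrite big_ord_recl.
have sum (s : seq {perm 'I_n}) : Ck k U (fun q => \sum_(t <- s) (-1) ^+ t * \prod_i M q i (t i)).
  elim: s => [|t s IH].
    by apply: eq_Ck (Ck_cst k U (0 : R)) => // p _; rewrite big_nil.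
  apply: eq_Ck (CkD oU (CkM oU (Ck_cst k U ((-1) ^+ t : R)) (prod _ (fun i q => M q i (t i)) _)) IH) => //.
  by move=> p _; rewrite big_cons.
exact: sum.
Qed.

Lemma Ck_invmx (R : realType) (V : normedModType R) k (U : set V) n (M : V -> 'M[R]_n) :
  open U -> (forall i j, Ck k U (fun q => M q i j)) ->
  (forall q, U q -> M q \in unitmx) ->
  forall i j, Ck k U (fun q => invmx (M q) i j).
Proof.
move=> oU H Hu i j.
have Hd : Ck k U (fun q => (\det (M q))^-1 * cofactor (M q) j i).
  apply: CkM => //.
    apply: CkV => //; last exact: Ck_det.
    by move=> p /Hu; rewrite unitmxE unitfE.
  apply: CkM => //; first exact: Ck_cst.
  apply: Ck_det => // a b.
  by apply: eq_Ck (H (lift j a) (lift i b)) => // p _; rewrite !mxE.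
by apply: eq_Ck Hd => // p /Hu Up; rewrite /invmx Up !mxE.
Qed.

Lemma jacobianE (R : realType) n m (f : 'rV[R]_n -> 'rV[R]_m) p i :
  differentiable f p -> row i (jacobian f p) = 'D_(delta_mx 0 i) f p.
Proof. by move=> df; rewrite deriveEjacobian// rowE. Qed.

Lemma near_small (R : realType) (V : normedModType R) (f : V -> R) p (e : R) :
  {for p, continuous f} -> f p = 0 -> 0 < e -> \forall q \near p, `|f q| < e.
Proof.
move=> /cvgrPdist_lt cf f0 e0; apply: filterS (cf e e0) => q.
by rewrite f0 sub0r normrN.
Qed.

Lemma lipschitz_le_continuous (R : realType) (V W : normedModType R) (f : V -> W) (C : R) :
  (forall x y, `|f x - f y| <= C * `|x - y|) -> continuous f.
Proof.
move=> HC x; apply/cvgrPdist_lt => e e0.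
have C0 : 0 < `|C| + 1 by rewrite ltr_wpDl.
apply/nbhs_normP; exists (e / (`|C| + 1)) => /=; first by rewrite divr_gt0.
move=> y; rewrite /ball_ /= ltr_pdivlMr// => xy; apply: le_lt_trans (HC x y) _.
apply: le_lt_trans xy; rewrite mulrC ler_wpM2l//.
by apply: le_trans (ler_norm C) _; rewrite lerDl.
Qed.

Lemma open_norm_lt (R : realType) (V : normedModType R) (p : V) (r : R) :
  open [set q : V | `|q - p| < r].
Proof.
rewrite (_ : mkset _ = (fun q => `|q - p|) @^-1` [set y | y < r])//.
apply: open_comp => [z _|]; last exact: open_lt.
apply: (@lipschitz_le_continuous R V R _ 1) => x y.
rewrite mul1r; apply: le_trans (ler_dist_dist _ _) _.
by rewrite opprB addrA subrK.
Qed.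

Section inverse_function.
Context {R : realType} {n : nat}.
Variables (U : set 'rV[R]_n) (Phi : 'rV[R]_n -> 'rV[R]_n) (q0 : 'rV[R]_n).
Hypotheses (oU : open U) (Uq0 : U q0) (sPhi : smooth_on U Phi).
Hypothesis inj_dPhi : forall v, 'D_v Phi q0 = 0 -> v = 0.

Let A := jacobian Phi q0.

Let dPhi q : U q -> differentiable Phi q.
Proof. exact: smooth_differentiable. Qed.

Let Aunit : A \in unitmx.
Proof.
rewrite -row_free_unit; apply/row_freeP.
have [//|H] := pselect (exists B, A *m B = 1%:M).
suff : row_free A by move/row_freeP.
rewrite -kermx_eq0; apply/rowV0P => v /sub_kermxP vA.
by apply: inj_dPhi; rewrite deriveEjacobian//; exact: dPhi.
Qed.

(** Solving Phi q = z amounts to finding a fixed point of q |-> H q + z A^-1, and H has zero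
    derivative at q0, so this map contracts near q0. *)
Let H q := q - Phi q *m invmx A.

Let dH q v : U q -> 'D_v H q = v - 'D_v Phi q *m invmx A.
Proof.
move=> Uq; have dP := dPhi Uq.
have dM : is_diff (Phi q) (mulmxr (invmx A)) (mulmxr (invmx A) : 'rV[R]_n -> 'rV[R]_n).
  split; first exact/linear_differentiable/mulmxr_continuous.
  by rewrite diff_lin//; exact: mulmxr_continuous.
have [dMd dMv] := dM.
have dPM : differentiable (mulmxr (invmx A) \o Phi) q by exact: differentiable_comp.
have -> : H = id - (mulmxr (invmx A) \o Phi) by apply/funext.
rewrite deriveB; [|exact: derivable_id|exact: diff_derivable].
rewrite derive_id; congr (_ - _).
by rewrite (diff_comp_derive v dP dMd) deriveE// dMv.
Qed.

Let smooth_H : smooth_on U H.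
Proof.
apply: smoothB => //; first exact: smooth_id.
apply/smooth_rV => // i.
apply: (eq_smooth (f := fun q => \sum_j Phi q 0 j * invmx A j i)) => //.
  by move=> p _; rewrite mxE.
apply: smooth_sum => // j; apply: smoothM => //; last exact: smooth_cst.
exact: ((smooth_rV Phi oU).1 sPhi j).
Qed.

Let lipH : exists2 r : R, 0 < r &
  (forall q, `|q - q0| < r -> U q /\ forall v, `|'D_v H q| <= 2^-1 * `|v|).
Proof.
(* Bounding n partial derivatives by e bounds D_v H by n e |v|, which is at most |v| / 2; n + 1
   keeps e meaningful when n = 0. *)
pose e : R := (2 * n.+1%:R)^-1.
have e0 : 0 < e by rewrite invr_gt0 mulr_gt0.
have cont i j : \forall q \near q0, `|('D_(delta_mx 0 j) H q) 0 i| < e.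
  have sD := (smooth_rV _ oU).1 (smooth_derive (delta_mx 0 j) smooth_H) i.
  apply: near_small (differentiable_continuous (smooth_differentiable sD Uq0)) _ e0.
  by rewrite (dH _ Uq0) (deriveEjacobian _ (dPhi Uq0)) (mulmxK Aunit) subrr mxE.
have : \forall q \near q0, U q /\ forall ij : 'I_n * 'I_n, `|('D_(delta_mx 0 ij.2) H q) 0 ij.1| < e.
  apply: filterI; first exact: open_nbhs_nbhs.
  apply: (@filter_forall 'rV[R]_n ('I_n * 'I_n)%type (fun (ij : 'I_n * 'I_n) q => `|('D_(delta_mx 0 ij.2) H q) 0 ij.1| < e) (nbhs q0)).
  by move=> -[i j]; exact: cont.
move=> /nbhs_ballP[r /= r0 Hr]; exists r => // q qr.
have [|Uq Hq] := Hr q; first by rewrite -ball_normE /= distrC.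
split=> // v; apply: norm_rV_le => [|i]; first by rewrite mulr_ge0// invr_ge0.
rewrite derive_sum_basis; last exact: (smooth_differentiable smooth_H).
rewrite summxE; apply: le_trans (ler_norm_sum _ _ _) _.
apply: (@le_trans _ _ (\sum_(j < n) e * `|v|)).
  apply: ler_sum => j _; rewrite mxE normrM mulrC ler_pM//; first exact: ltW (Hq (i, j)).
  exact: norm_coord_le.
rewrite sumr_const card_ord -mulrnAl ler_wpM2r// /e invfM -mulrnAr ler_piMr ?invr_ge0//.
by rewrite -mulr_natl ler_pdivrMr// mul1r ler_nat.
Qed.

Let seg (r : R) q q' (t : R) : 0 <= t <= 1 -> `|q - q0| < r -> `|q' - q0| < r ->
  `|t *: (q - q') + q' - q0| < r.
Proof.
move=> /andP[t0 t1] qr q'r.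
have -> : t *: (q - q') + q' - q0 = t *: (q - q0) + (1 - t) *: (q' - q0).
  by apply/rowP => i; rewrite !mxE; ring.
have [t00|t00] := eqVneq t 0; first by rewrite t00 scale0r add0r subr0 scale1r.
apply: le_lt_trans (ler_normD _ _) _; rewrite !normrZ (ger0_norm t0) ger0_norm ?subr_ge0//.
have -> : r = t * r + (1 - t) * r by ring.
by apply: ltr_leD; [rewrite ltr_pM2l// lt_neqAle eq_sym t00|rewrite ler_wpM2l ?subr_ge0// ltW].
Qed.

Let lip (r : R) : (forall q, `|q - q0| < r -> U q /\ forall v, `|'D_v H q| <= 2^-1 * `|v|) ->
  forall q q', `|q - q0| < r -> `|q' - q0| < r -> `|H q - H q'| <= 2^-1 * `|q - q'|.
Proof.
move=> Hr q q' qr q'r; apply: norm_rV_le => [|i]; first by rewrite mulr_ge0// invr_ge0.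
have [t t01|t /andP[t0 t1]] := @MVT_line R 'rV[R]_n (fun z => H z 0 i) (q - q') q'.
  apply: (smooth_differentiable ((smooth_rV H oU).1 smooth_H i)).
  by have [] := Hr _ (seg t01 qr q'r).
rewrite subrK => E.
have BE (a b : 'rV[R]_n) : (a - b) 0 i = a 0 i - b 0 i by rewrite !mxE.
rewrite BE E.
have t01 : 0 <= t <= 1 by rewrite !ltW.
have [Ut Dt] := Hr _ (seg t01 qr q'r).
rewrite -(derive_rV _ i (smooth_differentiable smooth_H Ut)).
exact: le_trans (norm_coord_le _ _) (Dt _).
Qed.

(** Besides a smooth local inverse, the conclusion asserts that phi is an open map: a chart
    precomposed with phi must again be a homeomorphism onto an open subset of M. *)
Lemma inverse_function : exists (V : set 'rV[R]_n) (phi : 'rV[R]_n -> 'rV[R]_n),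
  [/\ open V /\ V (Phi q0), phi (Phi q0) = q0,
      (forall z, V z -> U (phi z) /\ Phi (phi z) = z),
      smooth_on V phi &
      (forall W, W `<=` V -> open W -> open (phi @` W))].
Proof.
have [r r0 Hr] := lipH.
have lipr := lip Hr.
have Aq q q' : H q - H q' = (q - q') - (Phi q - Phi q') *m invmx A.
  rewrite /H mulmxBl; move: (Phi q *m _) (Phi q' *m _) => a b.
  by apply/rowP => k; rewrite !mxE; ring.
have inj q q' : `|q - q0| < r -> `|q' - q0| < r -> `|q - q'| <= 2 * `|(Phi q - Phi q') *m invmx A|.
  move=> qr q'r; have := lipr _ _ qr q'r; rewrite Aq => L.
  have : `|q - q'| <= 2^-1 * `|q - q'| + `|(Phi q - Phi q') *m invmx A|.
    rewrite -{1}(subrK ((Phi q - Phi q') *m invmx A) (q - q')).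
    by apply: le_trans (ler_normD _ _) _; rewrite lerD2r.
  by move: (`|q - q'|) (`|_ *m _|) => a b; lra.
pose w z := (z - Phi q0) *m invmx A.
have [C1 C10 HC1] := mulmx_bound (invmx A).
have cw : continuous w.
  apply: (@lipschitz_le_continuous R 'rV[R]_n 'rV[R]_n w C1) => x y.
  by rewrite /w -mulmxBl opprB addrA subrK; exact: HC1.
(* For z in V the contraction maps the closed ball of radius r / 2 into itself: its Lipschitz part
   contributes r / 4 and w z less than r / 4. *)
pose V := [set z | `|w z| < r / 4].
have oV : open V.
  rewrite (_ : V = (fun z => `|w z|) @^-1` [set y | y < r / 4])//.
  apply: open_comp => [z _|]; last exact: open_lt.
  by apply: (continuous_comp (f := w)); [exact: cw|exact: norm_continuous].
have ex z : V z -> exists q, `|q - q0| < r /\ Phi q = z.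
  move=> Vz.
  have lt_r q : `|q - q0| <= r / 2 -> `|q - q0| < r by move: (`|q - q0|) => a; lra.
  have [|q qr|q q' qr q'r|q qr Eq] := @contraction_fixed_rV R n q0 (r / 2) (fun q => H q + z *m invmx A).
  - by rewrite divr_ge0// ltW.
  - have -> : H q + z *m invmx A - q0 = (H q - H q0) + w z.
      rewrite /w /H mulmxBl; move: (Phi q *m _) (Phi q0 *m _) (z *m _) => a b c.
      by apply/rowP => k; rewrite !mxE; ring.
    apply: le_trans (ler_normD _ _) _.
    have := lipr q q0 (lt_r _ qr) _; rewrite subrr normr0 => /(_ r0) L.
    by move: Vz qr L; rewrite /V/=; move: (`|w z|) (`|q - q0|) (`|H q - H q0|) => a b c; lra.
  - have -> : H q + z *m invmx A - (H q' + z *m invmx A) = H q - H q'.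
      by rewrite opprD addrACA subrr addr0.
    by apply: lipr; exact: lt_r.
  exists q; split; first exact: lt_r.
  have : Phi q *m invmx A = z *m invmx A.
    move: Eq; rewrite /H; move: (Phi q *m _) (z *m _) => a b E.
    by apply/rowP => k; have := congr1 (fun x : 'rV[R]_n => x 0 k) E; rewrite !mxE; lra.
  by move=> /(congr1 (mulmx^~ A)); rewrite !mulmxKV.
(* q0 is the default value where no preimage in the ball exists. *)
pose phi z := xget q0 [set q | `|q - q0| < r /\ Phi q = z].
have phiP z : V z -> `|phi z - q0| < r /\ Phi (phi z) = z.
  by move=> Vz; rewrite /phi; case: xgetP => [q _ //|H0]; have [q /H0] := ex z Vz.
have inj0 q q' : `|q - q0| < r -> `|q' - q0| < r -> Phi q = Phi q' -> q = q'.
  move=> qr q'r E; have := inj _ _ qr q'r; rewrite E subrr mul0mx normr0 mulr0.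
  by rewrite normr_le0 subr_eq0 => /eqP.
have V0 : V (Phi q0) by rewrite /V/= /w subrr mul0mx normr0 divr_gt0.
have q0r : `|q0 - q0| < r by rewrite subrr normr0.
have lipphi z z' : V z -> V z' -> `|phi z - phi z'| <= 2 * C1 * `|z - z'|.
  move=> /phiP[p1 p2] /phiP[p1' p2']; apply: le_trans (inj _ _ p1 p1') _.
  by rewrite p2 p2' -mulrA ler_pM2l// HC1.
(* A vector v killed by dPhi satisfies D_v H = v, and the bound |D_v H| <= |v| / 2 leaves only v =
   0. *)
have Junit q : `|q - q0| < r -> jacobian Phi q \in unitmx.
  move=> qr; have [Uq Dq] := Hr _ qr.
  rewrite -row_free_unit -kermx_eq0; apply/rowV0P => v /sub_kermxP vA.
  have := Dq v; rewrite (dH _ Uq) (deriveEjacobian _ (dPhi Uq)) vA mul0mx subr0.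
  have := normr_ge0 v; rewrite -[v = 0]/(v = 0) => n0 n1; apply/eqP; rewrite -normr_le0.
  by move: n0 n1; move: (`|v|) => a; lra.
have dphi z : V z -> differentiable phi z /\
    'd phi z = mulmxr (invmx (jacobian Phi (phi z))) :> ('rV[R]_n -> 'rV[R]_n).
  move=> Vz; have [p1 p2] := phiP _ Vz; set q := phi z in p1 p2 *.
  have [Uq _] := Hr _ p1.
  set B := jacobian Phi q.
  have [C2 C20 HC2] := mulmx_bound (invmx B).
  apply: diff_eps; first exact: mulmxr_continuous.
  move=> e e0.
  (* 2 C1 is a Lipschitz constant of phi and C2 bounds the inverse Jacobian; their product turns the
     error of Phi into that of phi. *)
  have e'0 : 0 < e / (2 * C1 * C2) by rewrite divr_gt0// !mulr_gt0.
  have /nbhs_normP[d /= d0 Hd] := eps_diff (dPhi Uq) e'0.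
  have [d' d'0 Hd'] := open_ballP oV Vz.
  apply/nbhs_normP; exists (Num.min d' (d / (2 * C1))).
    by rewrite /= lt_min d'0 divr_gt0// mulr_gt0.
  move=> k; rewrite /ball_ /= sub0r normrN lt_min => /andP[kd' kd].
  have Vk := Hd' _ kd'; have [k1 k2] := phiP _ Vk.
  set h := phi (k + z) - q.
  have hk : `|h| <= 2 * C1 * `|k|.
    by have := lipphi _ _ Vk Vz; rewrite addrK.
  have hd : `|h| < d.
    apply: le_lt_trans hk _; rewrite mulrC -ltr_pdivlMr//.
    by rewrite mulr_gt0.
  have := Hd h; rewrite /ball_ /= sub0r normrN => /(_ hd).
  rewrite subrK k2 p2 addrK -(deriveE h (dPhi Uq)) (deriveEjacobian _ (dPhi Uq)) -/B.
  move=> L.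
  have -> : h - k *m invmx B = - ((k - h *m B) *m invmx B).
    by rewrite mulmxBl (mulmxK (Junit _ p1)) opprB.
  rewrite normrN; apply: le_trans (HC2 _) _.
  apply: (@le_trans _ _ (C2 * (e / (2 * C1 * C2) * (2 * C1 * `|k|)))).
    rewrite ler_pM2l//; apply: le_trans L _.
    by rewrite ler_pM2l.
  by rewrite le_eqVlt; apply/orP; left; apply/eqP; field; rewrite !gt_eqF.
pose O := [set q : 'rV[R]_n | `|q - q0| < r].
have oO : open O by exact: open_norm_lt.
exists V, phi; split => //.
- by apply: inj0 => //; [exact: (phiP _ V0).1|exact: (phiP _ V0).2].
- by move=> z /phiP[p1 p2]; split=> //; have [] := Hr _ p1.
(* Bootstrap: the derivative of phi is the inverse Jacobian of Phi evaluated along phi, so it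
   inherits the order already known for phi. *)
- apply/smooth_onP => k; elim: k => [|k IH]; first by split=> // z /dphi[].
  split=> [z /dphi[]//|v]; apply/Ck_rV => // i.
  apply: (eq_Ck (f := fun z => \sum_j v 0 j * invmx (jacobian Phi (phi z)) j i)) => //.
    by move=> z Vz; have [d1 d2] := dphi _ Vz; rewrite deriveE// d2 /= mxE.
  apply: Ck_sum => // j; apply: CkM => //; first exact: Ck_cst.
  apply: (Ck_comp (U' := O) (g := fun q => invmx (jacobian Phi q) j i)) => //.
    by move=> z /phiP[].
  apply: Ck_invmx => // a b.
  have /smooth_onP sab := (smooth_rV _ oU).1 (smooth_derive (delta_mx 0 a) sPhi) b.
  apply: (eq_Ck (f := fun q => ('D_(delta_mx 0 a) Phi q) 0 b)) => //.
    by move=> q qr; rewrite -jacobianE ?mxE//; apply: dPhi; have [] := Hr _ qr.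
  by apply: CkSub (sab k) => q qr; have [] := Hr _ qr.
- move=> W WV oW.
  (* Injectivity of Phi on the ball O identifies the image under phi with a preimage under Phi,
     which is open by continuity. *)
  have -> : phi @` W = [set q | O q /\ W (Phi q)].
    apply/seteqP; split=> [q [z Wz <-]|q [Oq Wq]].
      by have [p1 p2] := phiP _ (WV _ Wz); split=> //; rewrite p2.
    exists (Phi q) => //; have [p1 p2] := phiP _ (WV _ Wq).
    exact: inj0.
  rewrite openE => q [Oq Wq]; apply: filterI; first exact: open_nbhs_nbhs.
  have [Uq _] := Hr _ Oq.
  by apply: (differentiable_continuous (dPhi Uq)); exact: open_nbhs_nbhs.
Qed.

End inverse_function.

(** * The support function of a hypersurface patch *)

Lemma dot_mulmx (R : realType) n m (a : 'rV[R]_n) (b : 'rV[R]_m) (Q : 'M[R]_(n, m)) :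
  dot (a *m Q) b = dot a (b *m Q^T).
Proof. by rewrite /dot trmx_mul trmxK mulmxA. Qed.

Local Opaque dot derive.

Lemma near_neq0 (R : realType) (V : normedModType R) (f : V -> R) p :
  {for p, continuous f} -> f p != 0 -> \forall q \near p, f q != 0.
Proof.
move=> /cvgrPdist_lt cf f0; have e0 : 0 < `|f p| by rewrite normr_gt0.
apply: filterS (cf _ e0) => q; apply: contraTneq => ->.
by rewrite subr0 ltxx.
Qed.

Lemma ord3P (i : 'I_3) : [\/ i = 0, i = 1 | i = 2].
Proof.
by case: i => [[|[|[|//]]] i3]; [apply: Or31|apply: Or32|apply: Or33]; exact: val_inj.
Qed.

(** Used to recognize every 2 x 2 minor of two rows as zero or, up to sign, a component of their
    cross product. *)
Lemma ord3_pair (a b : 'I_3) :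
  [\/ a = b, exists l, a = l + 1 /\ b = l + 2 | exists l, a = l + 2 /\ b = l + 1].
Proof.
have Z : (0 + 1 = 1 :> 'I_3) * (0 + 2 = 2 :> 'I_3) * (1 + 1 = 2 :> 'I_3) *
  (1 + 2 = 0 :> 'I_3) * (2 + 1 = 0 :> 'I_3) * (2 + 2 = 1 :> 'I_3).
  by split; [split; [split; [split; [split|]|]|]|]; apply: val_inj.
case: (ord3P a) (ord3P b) => -> [] ->.
- exact: Or31.
- by apply: Or32; exists 2; rewrite !Z.
- by apply: Or33; exists 1; rewrite !Z.
- by apply: Or33; exists 2; rewrite !Z.
- exact: Or31.
- by apply: Or32; exists 0; rewrite !Z.
- by apply: Or32; exists 1; rewrite !Z.
- by apply: Or33; exists 0; rewrite !Z.
- exact: Or31.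
Qed.

Lemma dot3 (R : realType) (a b : 'rV[R]_3) :
  dot a b = a 0 0 * b 0 0 + a 0 1 * b 0 1 + a 0 2 * b 0 2.
Proof.
rewrite dotE !big_ord_recl big_ord0 addr0 addrA.
by congr (_ + _ * _ + _ * _); congr (_ 0 _); apply: val_inj.
Qed.

Lemma dot_delta (R : realType) n i (a : 'rV[R]_n) : dot (delta_mx 0 i) a = a 0 i.
Proof.
rewrite dotE (bigD1 i)//= big1 => [|j ji]; first by rewrite mxE !eqxx mul1r addr0.
by rewrite mxE (negPf ji) andbF mul0r.
Qed.

(** Indices are added modulo 3 in ['I_3], so one formula gives all three components with the usual
    signs. *)
Definition cross3 (R : realType) (a b : 'rV[R]_3) : 'rV[R]_3 :=
  \row_(i < 3) (a 0 (i + 1) * b 0 (i + 2) - a 0 (i + 2) * b 0 (i + 1)).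

Lemma cross3E (R : realType) (a b : 'rV[R]_3) l :
  cross3 a b 0 l = a 0 (l + 1) * b 0 (l + 2) - a 0 (l + 2) * b 0 (l + 1).
Proof. exact: mxE. Qed.

Lemma row_entry (R : realType) n (F : 'I_n -> R) l : (\row_j F j) 0 l = F l.
Proof. exact: mxE. Qed.

Lemma cross3_row (R : realType) (F G : 'I_3 -> R) l :
  cross3 (\row_j F j) (\row_j G j) 0 l = F (l + 1) * G (l + 2) - F (l + 2) * G (l + 1).
Proof. by rewrite cross3E !row_entry. Qed.

Lemma dot_delta_row (R : realType) n (F : 'I_n -> R) l : dot (delta_mx 0 l) (\row_j F j) = F l.
Proof. by rewrite dot_delta row_entry. Qed.

(** A nonzero vector orthogonal to a, b and c forces their determinant to vanish; [key] is Cramer's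
    rule, one component of v at a time. *)
Lemma cross3_triple (R : realType) (v a b c : 'rV[R]_3) : v != 0 ->
  dot v a = 0 -> dot v b = 0 -> dot v c = 0 -> dot (cross3 a b) c = 0.
Proof.
move=> v0 va vb vc.
have key i : v 0 i * dot (cross3 a b) c = dot v a * cross3 b c 0 i +
    dot v b * cross3 c a 0 i + dot v c * cross3 a b 0 i.
  rewrite !dot3 !mxE.
  have E1 : (0 + 1 : 'I_3) = 1 by apply: val_inj.
  have E2 : (0 + 2 : 'I_3) = 2 by apply: val_inj.
  have E3 : (1 + 1 : 'I_3) = 2 by apply: val_inj.
  have E4 : (1 + 2 : 'I_3) = 0 by apply: val_inj.
  have E5 : (2 + 1 : 'I_3) = 0 by apply: val_inj.
  have E6 : (2 + 2 : 'I_3) = 1 by apply: val_inj.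
  by case: (ord3P i) => ->; rewrite ?(E1, E2, E3, E4, E5, E6); ring.
apply/eqP; apply: contraNT v0 => d0; apply/eqP/rowP => i; rewrite mxE.
by apply: (mulIf d0); rewrite key va vb vc !mul0r !addr0.
Qed.

(** What remains of an oriented hypersurface in one chart, with f = x o psi and n = N o psi; the
    local analysis is carried out without M. *)
Definition hypersurface_patch (R : realType) (U : set 'rV[R]_3)
    (f n : 'rV[R]_3 -> 'rV[R]_4) : Prop :=
  [/\ open U, smooth_on U f /\ smooth_on U n,
      forall q, U q -> row_free (jacobian f q),
      forall q, U q -> dot (n q) (n q) = 1 &
      forall q v, U q -> dot (n q) ('D_v f q) = 0].

(** Adding the unit normal n as a last row to J gives an invertible square matrix; a vector
    orthogonal to n has no component on that row. *)
Lemma hyperplane_sub_row (R : realType) m (J : 'M[R]_(m, m + 1)) (n w : 'rV[R]_(m + 1)) :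
  row_free J -> dot n n = 1 -> (forall v, dot n (v *m J) = 0) -> dot w n = 0 ->
  exists v, w = v *m J.
Proof.
move=> Jf nn nJ wn; pose B := col_mx J n.
have Bu : B \in unitmx.
  rewrite -row_free_unit -kermx_eq0; apply/rowV0P => v /sub_kermxP.
  rewrite -(hsubmxK v) mul_row_col (mx11_scalar (rsubmx v)) mul_scalar_mx => E.
  have b0 : rsubmx v 0 0 = 0.
    have := congr1 (dot n) E.
    by rewrite dotDr dotZr nJ nn mulr1 add0r dot0r.
  have l0 : lsubmx v = 0.
    by apply: (row_free_inj Jf); rewrite mul0mx -E b0 scale0r addr0.
  by rewrite l0 b0 raddf0 row_mx0.
pose z := w *m invmx B.
have : w = z *m B by rewrite /z mulmxKV.
rewrite -{1}(hsubmxK z) mul_row_col (mx11_scalar (rsubmx z)) mul_scalar_mx => E.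
have b0 : rsubmx z 0 0 = 0.
  by have := congr1 (dot n) E; rewrite dotDr dotZr nJ nn mulr1 add0r dotC wn.
by exists (lsubmx z); rewrite E b0 scale0r addr0.
Qed.

Lemma smooth_sum_rV (R : realType) (V : normedModType R) n m (U : set V)
    (f : 'I_n -> V -> 'rV[R]_m) : open U -> (forall i, smooth_on U (f i)) ->
  smooth_on U (fun q => \sum_(i < n) f i q).
Proof.
move=> oU Hf; apply/smooth_rV => // j.
apply: (eq_smooth (f := fun q => \sum_(i < n) f i q 0 j)) => //.
  by move=> p _; rewrite summxE.
by apply: smooth_sum => // i; exact: ((smooth_rV (f i) oU).1 (Hf i) j).
Qed.

Section patch.
Context {R : realType} {U : set 'rV[R]_3} {f n : 'rV[R]_3 -> 'rV[R]_4}.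
Hypothesis P : hypersurface_patch U f n.

Let oU : open U. Proof. by case: P. Qed.
Let sf : smooth_on U f. Proof. by case: P => _ []. Qed.
Let sn : smooth_on U n. Proof. by case: P => _ []. Qed.
Let df q : U q -> differentiable f q. Proof. exact: smooth_differentiable. Qed.
Let dn q : U q -> differentiable n q. Proof. exact: smooth_differentiable. Qed.
Let dDf v q : U q -> differentiable (fun q => 'D_v f q) q.
Proof. by apply: smooth_differentiable; exact: smooth_derive. Qed.
Let dDn v q : U q -> differentiable (fun q => 'D_v n q) q.
Proof. by apply: smooth_differentiable; exact: smooth_derive. Qed.
Let nn q : U q -> dot (n q) (n q) = 1. Proof. by case: P => _ _ _ + _; apply. Qed.

Let eq_derive0 (h : 'rV[R]_3 -> R) (c : R) (O : set 'rV[R]_3) q v :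
  open O -> O q -> (forall z, O z -> h z = c) -> 'D_v h q = 0.
Proof.
move=> oO Oq H; rewrite -(derive_cst c q v); apply: near_eq_derive.
by near=> z; apply: H; near: z; exact: open_nbhs_nbhs.
Unshelve. all: by end_near. Qed.

Lemma patch_ortho q v : U q -> dot (n q) ('D_v f q) = 0.
Proof. by case: P => _ _ _ _; apply. Qed.

Lemma patch_orthon q v : U q -> dot ('D_v n q) (n q) = 0.
Proof.
move=> Uq; have := eq_derive0 v oU Uq nn.
rewrite (derive_dot v (dn Uq) (dn Uq)) dotC => /eqP.
by rewrite -mulr2n mulrn_eq0 => /eqP <-; rewrite dotC.
Qed.

(** Symmetry of the second fundamental form: differentiating <n, D_b f> = 0 turns both sides into
    minus <n, second derivative of f>, and Schwarz applies. *)
Lemma patch_sym q u v : U q -> dot ('D_u n q) ('D_v f q) = dot ('D_v n q) ('D_u f q).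
Proof.
move=> Uq.
have E a b : dot ('D_a n q) ('D_b f q) = - dot (n q) ('D_a (fun z => 'D_b f z) q).
  have := eq_derive0 a oU Uq (fun z Uz => patch_ortho b Uz).
  rewrite (derive_dot a (dn Uq) (dDf b Uq)) => /eqP.
  by rewrite addr_eq0 => /eqP.
apply: (etrans (E u v)); apply: (etrans _ (esym (E v u))).
exact: (congr1 (fun w => - dot (n q) w) (schwarz_rV v u oU sf Uq)).
Qed.

Lemma patch_inj q v : U q -> 'D_v f q = 0 -> v = 0.
Proof.
move=> Uq; rewrite (deriveEjacobian _ (df Uq)) => vJ.
have Jf : row_free (jacobian f q) by case: P => _ _ + _ _; apply.
by apply: (row_free_inj Jf); rewrite vJ mul0mx.
Qed.

Lemma patch_tangent q w : U q -> dot w (n q) = 0 -> exists v, 'D_v f q = w.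
Proof.
move=> Uq wn.
have Jf : row_free (jacobian f q) by case: P => _ _ + _ _; apply.
have [v|v ->] := hyperplane_sub_row Jf (nn Uq) _ wn.
  by rewrite -(deriveEjacobian v (df Uq)) patch_ortho.
by exists v; rewrite (deriveEjacobian v (df Uq)).
Qed.

Lemma patch_eq0 q w : U q -> dot w (n q) = 0 -> (forall v, dot w ('D_v f q) = 0) ->
  w = 0.
Proof.
move=> Uq wn wf; have [v E] := patch_tangent Uq wn.
by apply/eqP; rewrite -dot_eq0 -{2}E wf.
Qed.

Let g q := dot (f q) (n q).

Lemma patch_support q v : U q -> 'D_v (fun q => dot (f q) (n q)) q = dot (f q) ('D_v n q).
Proof.
move=> Uq; rewrite (derive_dot v (df Uq) (dn Uq)) dotC patch_ortho// add0r//.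
Qed.

Lemma tangential_ortho q : U q -> dot (f q - dot (f q) (n q) *: n q) (n q) = 0.
Proof. by move=> Uq; rewrite dotBl dotZl nn// mulr1 subrr. Qed.

Lemma dot_tangential q w : dot w (n q) = 0 ->
  dot (f q - dot (f q) (n q) *: n q) w = dot (f q) w.
Proof. by move=> wn; rewrite dotBl dotZl (dotC (n q)) wn mulr0 subr0. Qed.

Lemma patch_kernel q v : U q ->
  (forall u, 'D_u (fun q => dot (f q) (n q)) q = 0) ->
  'D_v f q = f q - dot (f q) (n q) *: n q -> 'D_v n q = 0.
Proof.
move=> Uq g0 vT; apply: (patch_eq0 Uq (patch_orthon v Uq)) => u.
rewrite (patch_sym _ _ Uq) vT dotC dot_tangential ?patch_orthon//.
by rewrite -patch_support.
Qed.

Section principal_line.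
Variables (O : set 'rV[R]_3).
Hypotheses (oO : open O) (OU : O `<=` U).
Hypothesis gcr : forall q, O q -> exists2 k, k != 0 &
  forall u, dot (f q) ('D_u n q) = k * dot (f q) ('D_u f q).

(* A null field E of S is orthogonal to x^T, as k <> 0.  By Codazzi D_E E is
   orthogonal to the range of dn, hence to x^T, so differentiating <f, E> = 0
   along E leaves |E|^2 = 0. *)
Lemma null_field_eq0 (X : 'rV[R]_3 -> 'rV[R]_3) : smooth_on O X ->
  (forall q, O q -> 'D_(X q) n q = 0) -> forall q, O q -> X q = 0.
Proof.
move=> sX X0 p Op; have Up := OU Op.
have dX : differentiable X p by exact: smooth_differentiable sX Op.
pose E q := 'D_(X q) f q.
have expand (h : 'rV[R]_3 -> 'rV[R]_4) q : differentiable h q -> 'D_(X q) h q = \sum_(i < 3) X q 0 i *: 'D_(delta_mx 0 i) h q.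
  by move=> dh; exact: derive_sum_basis.
have sE : smooth_on O E.
  apply: (eq_smooth (f := fun q => \sum_(i < 3) X q 0 i *: 'D_(delta_mx 0 i) f q)) => //.
    by move=> q /OU Uq; rewrite -expand//; exact: df.
  apply: smooth_sum_rV => // i; apply: smooth_scale => //.
    exact: ((smooth_rV X oO).1 sX i).
  by apply: smoothS OU _; exact: smooth_derive.
have dE := smooth_differentiable sE Op.
set v := X p.
have fE q : O q -> dot (f q) (E q) = 0.
  move=> Oq; have [k k0 Hk] := gcr Oq.
  by apply: (mulfI k0); rewrite -Hk X0// dot0r mulr0.
have nE q : O q -> dot (n q) (E q) = 0 by move=> /OU Uq; exact: patch_ortho.
have wE w q : O q -> dot ('D_w n q) (E q) = 0.
  by move=> Oq; rewrite (patch_sym _ _ (OU Oq)) X0// dot0l.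
have E1 : dot (E p) (E p) + dot (f p) ('D_v E p) = 0.
  by rewrite -(eq_derive0 v oO Op fE) (derive_dot v (df Up) dE).
have E2 : dot (n p) ('D_v E p) = 0.
  have := eq_derive0 v oO Op nE.
  by rewrite (derive_dot v (dn Up) dE) X0// dot0l add0r.
(* Here the Codazzi equation enters: after differentiating <D_w n, E> = 0 along v, it remains to
   kill <D_v D_w n, E>, where the two derivatives may be exchanged. *)
have E3 w : dot ('D_w n p) ('D_v E p) = 0.
  have := eq_derive0 v oO Op (wE w).
  rewrite (derive_dot v (dDn w Up) dE) => /eqP; rewrite addr_eq0 => /eqP.
  suff -> : dot ('D_v (fun z => 'D_w n z) p) (E p) = 0.
    by move=> /eqP; rewrite eq_sym oppr_eq0 => /eqP.
  rewrite (schwarz_rV w v oU sn Up).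
  (* With v = X p and E p frozen, <D_v n, E p> is minus the product of X - v and Y, because D_X n =
     0. Both factors vanish at p, so the first derivative of the product does too. *)
  pose Y q : 'rV[R]_3 := \row_i dot ('D_(delta_mx 0 i) n q) (E p).
  have dY : differentiable Y p.
    apply/differentiable_rV => i.
    rewrite (_ : (fun _ => _) = (fun q => dot ('D_(delta_mx 0 i) n q) (E p))); last first.
      by apply/funext => q; rewrite mxE.
    by apply: differentiable_dot; [exact: dDn|exact: differentiable_cst].
  have dXv : differentiable (fun q => X q - v) p.
    by apply: differentiableB => //; exact: differentiable_cst.
  have Y0 : Y p = 0 by apply/rowP => i; rewrite !mxE wE.
  have : 'D_w (fun q => dot (X q - v) (Y q)) p = 0.
    by rewrite (derive_dot w dXv dY) Y0 dot0r subrr dot0l addr0.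
  have -> : 'D_w (fun q => dot (X q - v) (Y q)) p =
      'D_w (fun q => - dot ('D_v n q) (E p)) p.
    apply: near_eq_derive; near=> q.
    have Oq : O q by near: q; exact: open_nbhs_nbhs.
    have -> : dot (X q - v) (Y q) = dot ('D_(X q - v) n q) (E p).
      rewrite (derive_sum_basis _ (dn (OU Oq))) dot_suml dotE.
      by apply: eq_bigr => i _; rewrite dotZl; congr (_ * _); rewrite mxE.
    rewrite -[X q - v]/(X q + - v) (deriveDv _ _ (dn (OU Oq))) X0// add0r.
    by rewrite -scaleN1r (deriveZv _ _ (dn (OU Oq))) dotZl mulN1r.
  have dvE : differentiable (fun q => dot ('D_v n q) (E p)) p.
    by apply: differentiable_dot; [exact: dDn|exact: differentiable_cst].
  rewrite (deriveN (diff_derivable dvE)).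
  rewrite (derive_dot w (dDn v Up) (differentiable_cst _ _)) derive_cst dot0r addr0.
  by move=> /eqP; rewrite oppr_eq0 => /eqP.
have [k k0 Hk] := gcr Op.
have [u uT] := patch_tangent Up (tangential_ortho Up).
(* Symmetry turns [Hk] back into an eigenvector equation: dn = k df on the vector u that df sends to
   x^T. *)
have nT : 'D_u n p = k *: (f p - dot (f p) (n p) *: n p).
  apply/eqP; rewrite -subr_eq0; apply/eqP; apply: (patch_eq0 Up) => [|w].
    by rewrite dotBl dotZl patch_orthon// tangential_ortho// mulr0 subrr.
  rewrite dotBl dotZl (patch_sym _ _ Up) uT dotC !dot_tangential.
  - by rewrite Hk subrr.
  - by rewrite dotC patch_ortho.
  - by rewrite patch_orthon.
have TE : dot (f p - dot (f p) (n p) *: n p) ('D_v E p) = 0.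
  by apply: (mulfI k0); rewrite mulr0 -dotZl -nT E3.
move: E1; rewrite -(subrK (dot (f p) (n p) *: n p) (f p)) dotDl TE dotZl E2 mulr0 !addr0.
by move=> /eqP; rewrite dot_eq0 => /eqP; exact: patch_inj.
Unshelve. all: by end_near. Qed.

(** The second fundamental form with the opposite sign, since S = - dN. *)
Let W (i j : 'I_3) q := dot ('D_(delta_mx 0 i) n q) ('D_(delta_mx 0 j) f q).

Let smooth_W i j : smooth_on O (W i j).
Proof.
by apply: smoothS OU _; apply: smooth_dot => //; exact: smooth_derive.
Qed.

Let W_sym i j q : O q -> W i j q = W j i q.
Proof. by move=> /OU Uq; exact: patch_sym. Qed.

Let W_kernel v q : O q -> (forall i, dot v (\row_j W i j q) = 0) -> 'D_v n q = 0.
Proof.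
move=> Oq H; have Uq := OU Oq; apply: (patch_eq0 Uq (patch_orthon v Uq)) => u.
rewrite (derive_sum_basis _ (df Uq)) dotC dot_suml big1// => i _.
rewrite dotZl dotC (patch_sym _ _ Uq) dotC (derive_sum_basis _ (df Uq)) dot_suml.
transitivity (u 0 i * dot v (\row_j W i j q)); last by rewrite H mulr0.
congr (_ * _); rewrite [RHS]dotE; apply: eq_bigr => j _.
by rewrite dotZl; congr (_ * _); rewrite mxE; exact: dotC.
Qed.

Let kernel_W v q i : O q -> 'D_v n q = 0 -> dot v (\row_j W i j q) = 0.
Proof.
move=> Oq H; have Uq := OU Oq.
transitivity (dot ('D_v n q) ('D_(delta_mx 0 i) f q)); last by rewrite H dot0l.
rewrite (derive_sum_basis _ (dn Uq)) dot_suml dotE.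
by apply: eq_bigr => j _; rewrite dotZl; congr (_ * _); rewrite mxE W_sym.
Qed.

(* The cross products of the rows of the second fundamental form W are null
   fields of S, as det W = 0; their vanishing makes W of rank at most 1, and then
   W_kj e_i - W_ij e_k are null fields too. *)
Lemma no_nonzero_principal :
  (forall q, O q -> exists2 v, v != 0 & 'D_v n q = 0) ->
  (forall q, O q -> exists u, dot (f q) ('D_u n q) != 0) -> O = set0.
Proof.
move=> ker nz.
have cross0 i k q : O q -> cross3 (\row_j W i j q) (\row_j W k j q) = 0.
  apply: (null_field_eq0 (X := fun q => cross3 (\row_j W i j q) (\row_j W k j q))).
    apply/smooth_rV => // l.
    apply: (eq_smooth (f := fun q => W i (l + 1) q * W k (l + 2) q + - (W i (l + 2) q * W k (l + 1) q))) => //.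
      by move=> p _; exact/esym/(cross3_row (fun j => W i j p) (fun j => W k j p)).
    by apply: smoothD => //; [|apply: smoothN => //]; apply: smoothM.
  move=> {}q Oq; apply: W_kernel => // l; have [v v0 vn] := ker q Oq.
  by apply: (cross3_triple v0); exact: kernel_W.
have minors i k q a b : O q -> W i a q * W k b q = W i b q * W k a q.
  move=> Oq.
  have H l : W i (l + 1) q * W k (l + 2) q = W i (l + 2) q * W k (l + 1) q.
    have := congr1 (fun x : 'rV[R]_3 => x 0 l) (cross0 i k q Oq).
    by rewrite (cross3_row (fun j => W i j q) (fun j => W k j q)) [RHS]mxE => /eqP; rewrite subr_eq0 => /eqP.
  have [->|[l [-> ->]]|[l [-> ->]]] := ord3_pair a b; [by []|exact: H|].
  exact: esym (H l).
have alg (a b c d b' d' : R) : b = b' -> d = d' -> b' * a = c * d' -> a * b - c * d = 0.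
  by move=> -> ->; rewrite mulrC => ->; rewrite subrr.
have W0 i j q : O q -> W i j q = 0.
  (* For any k distinct from i, the null field X below has - W_ij as its k-th component, so its
     vanishing gives W_ij = 0. *)
  move=> Oq; have [k ki] : exists k : 'I_3, k != i.
    by exists (i + 1); case: (ord3P i) => ->.
  have dk (a b : R) :
      dot (delta_mx 0 k) (a *: delta_mx 0 i - b *: delta_mx 0 k : 'rV[R]_3) = - b.
    by rewrite dotBr !dotZr !dot_delta !mxE !eqxx (negPf ki) mulr0 mulr1 sub0r.
  pose X q : 'rV[R]_3 := W k j q *: delta_mx 0 i - W i j q *: delta_mx 0 k.
  have : X q = 0.
    apply: null_field_eq0 => [|p Op|//].
      by apply: smoothB => //; apply: smooth_scale => //; exact: smooth_cst.
    apply: W_kernel => // l; rewrite dotBl !dotZl !(dot_delta_row (fun j => W l j p)).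
    exact: alg (W_sym l i Op) (W_sym l k Op) (minors i k p l j Op).
  move=> /(congr1 (dot (delta_mx 0 k))).
  by rewrite dot0r [LHS]dk => /eqP; rewrite oppr_eq0 => /eqP.
apply/seteqP; split=> // q Oq; have [u] := nz q Oq.
suff -> : 'D_u n q = 0 by rewrite dot0r eqxx.
apply: W_kernel => // i; rewrite dotE big1// => j _.
by rewrite row_entry W0// mulr0.
Qed.

End principal_line.

(** If D_u g were nonzero at a point, it would be so on an open set O. There D_u g = <f, D_u n> = k
    <f, D_u f> makes every k nonzero, and [no_nonzero_principal] shows that O is empty. *)
Lemma gcr_support_cst :
  (forall q, U q -> exists k, forall u, dot (f q) ('D_u n q) = k * dot (f q) ('D_u f q)) ->
  (forall q, U q -> exists2 v, v != 0 & 'D_v n q = 0) ->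
  forall q u, U q -> 'D_u (fun q => dot (f q) (n q)) q = 0.
Proof.
move=> gcr ker q u Uq; rewrite patch_support//; apply/eqP; apply/negPn/negP => nz.
pose h z := dot (f z) ('D_u n z).
have sh : smooth_on U h by apply: smooth_dot => //; exact: smooth_derive.
pose O := [set z | U z /\ h z != 0].
have oO : open O.
  rewrite openE => z [Uz hz]; apply: filterI; first exact: open_nbhs_nbhs.
  exact: near_neq0 (differentiable_continuous (smooth_differentiable sh Uz)) hz.
have OU : O `<=` U by move=> z [].
suff : O = set0 by move/seteqP => -[+ _] => /(_ q); apply.
apply: no_nonzero_principal => // [z [Uz hz]|z [Uz _]|z [Uz hz]].
- have [k Hk] := gcr z Uz; exists k => //; apply: contraNneq hz => k0.
  by rewrite /h Hk k0 mul0r.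
- exact: ker.
- by exists u.
Qed.

End patch.

(** * Charts *)

Lemma eq_cst_derive0 (R : realType) (V : normedModType R) (h : V -> R) (c : R)
    (O : set V) q v :
  open O -> O q -> (forall z, O z -> h z = c) -> 'D_v h q = 0.
Proof.
move=> oO Oq H; rewrite -(derive_cst c q v); apply: near_eq_derive.
by near=> z; apply: H; near: z; exact: open_nbhs_nbhs.
Unshelve. all: by end_near. Qed.

(** A right inverse of the Jacobian bounds |h| by C |dF h|; taking the linearization error below |h|
    / (2 C) lets half of |h| absorb it. *)
Lemma immersion_lower_bound (R : realType) m n (F : 'rV[R]_m -> 'rV[R]_n) q :
  differentiable F q -> row_free (jacobian F q) ->
  exists2 C : R, 0 < C & \forall h \near 0, `|h| <= C * `|F (h + q) - F q|.
Proof.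
move=> dF /row_freeP[B JB]; have [C C0 HC] := mulmx_bound B.
have e0 : 0 < (2 * C)^-1 by rewrite invr_gt0 mulr_gt0.
exists (2 * C); first by rewrite mulr_gt0.
apply: filterS (eps_diff dF e0) => h.
rewrite -(deriveE h dF) (deriveEjacobian _ dF) => L.
have hE : `|h| <= C * `|h *m jacobian F q|.
  by rewrite -{1}(mulmx1 h) -JB mulmxA; exact: HC.
have : `|h *m jacobian F q| <= `|F (h + q) - F q| + (2 * C)^-1 * `|h|.
  rewrite -{1}[h *m _](subKr (F (h + q) - F q)).
  by apply: le_trans (ler_normB _ _) _; rewrite lerD2l.
have Ch : C * ((2 * C)^-1 * `|h|) = 2^-1 * `|h| by field; rewrite gt_eqF.
rewrite -(ler_pM2l C0) mulrDr Ch -mulrA; move: hE {L Ch}.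
move: (C * `|F (h + q) - F q|) (C * `|h *m _|) (`|h|) => a b c; lra.
Qed.

Lemma diff_lipschitz_near (R : realType) (V W : normedModType R) (F : V -> W) q :
  differentiable F q ->
  exists2 C : R, 0 < C & \forall h \near 0, `|F (h + q) - F q| <= C * `|h|.
Proof.
move=> dF; have cd := diff_continuous dF.
have [C C0 HC] := linear_lipschitz cd.
exists (C + 1); first by rewrite addr_gt0.
apply: filterS (eps_diff dF ltr01) => h L.
rewrite -(subrK ('d F q h) (F (h + q) - F q)); apply: le_trans (ler_normD _ _) _.
by rewrite addrC mulrDl lerD.
Qed.

(** The left inverse Phi is required to be differentiable only at the points phi z: this makes phi
    injective with injective derivative, hence x o psi o phi an immersion. Openness of phi keeps
    images of open sets open in M. *)
Definition chart_change (R : realType) n (U V : set 'rV[R]_n) (phi : 'rV[R]_n -> 'rV[R]_n) :=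
  [/\ open V,
      exists Phi : 'rV[R]_n -> 'rV[R]_n, forall z, V z ->
        [/\ U (phi z), differentiable Phi (phi z) & Phi (phi z) = z],
      smooth_on V phi &
      forall W, W `<=` V -> open W -> open (phi @` W)].

Lemma chart_change_comp (R : realType) n (U V W : set 'rV[R]_n) phi1 phi2 :
  chart_change U V phi1 -> chart_change V W phi2 -> chart_change U W (phi1 \o phi2).
Proof.
move=> [oV [Phi1 H1] s1 o1] [oW [Phi2 H2] s2 o2]; split=> //.
- exists (Phi2 \o Phi1) => z /H2[Vz d2 E2]; have [Uz d1 E1] := H1 _ Vz.
  split=> //; last by rewrite /= E1 E2.
  by apply: differentiable_comp => //; rewrite E1.
- by apply: smooth_comp oW oV _ s2 s1 => z /H2[].
- move=> O OW oO; rewrite -image_comp; apply: o1; last exact: o2.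
  by move=> _ [z Oz <-]; have [] := H2 z (OW _ Oz).
Qed.

Lemma chart_changeS (R : realType) n (U U' V : set 'rV[R]_n) phi :
  U `<=` U' -> chart_change U V phi -> chart_change U' V phi.
Proof.
move=> UU' [oV [Phi H] s o]; split=> //.
by exists Phi => z /H[/UU'].
Qed.

Section charts.
Context {R : realType} {M : topologicalType} {x : M -> 'rV[R]_4}.

Lemma local_param_continuous (U : set 'rV[R]_3) (psi : 'rV[R]_3 -> M) q :
  local_param x U psi -> U q -> {for q, continuous psi}.
Proof.
case=> oU cpsi _ _ _ Uq; move: cpsi; rewrite continuous_open_subspace//.
by move=> H; apply: H; rewrite inE.
Qed.

Lemma local_paramS (U U' : set 'rV[R]_3) (psi : 'rV[R]_3 -> M) :
  local_param x U psi -> open U' -> U' `<=` U -> local_param x U' psi.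
Proof.
move=> [oU cpsi ipsi opsi [sx rf]] oU' UU'; split=> //.
- exact: continuous_subspaceW cpsi.
- by move=> a b; rewrite !inE => /UU' Ua /UU' Ub; apply: ipsi; rewrite inE.
- by move=> V VU'; apply: opsi; exact: subset_trans VU' UU'.
- by split; [exact: smoothS sx|move=> q /UU'; exact: rf].
Qed.

Lemma local_param_comp (U V : set 'rV[R]_3) (psi : 'rV[R]_3 -> M)
    (phi : 'rV[R]_3 -> 'rV[R]_3) :
  local_param x U psi -> chart_change U V phi -> local_param x V (psi \o phi).
Proof.
move=> H [oV [Phi Vphi3] sphi ophi]; have [oU cpsi ipsi opsi [sx rf]] := H.
have dPhi z : V z -> differentiable Phi (phi z) by case/Vphi3.
have Vphi z : V z -> U (phi z) /\ Phi (phi z) = z by case/Vphi3.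
have VU z : V z -> U (phi z) by case/Vphi.
split=> //.
- rewrite continuous_open_subspace// => z; rewrite inE => Vz.
  apply: continuous_comp.
    exact: differentiable_continuous (smooth_differentiable sphi Vz).
  exact: local_param_continuous H (VU _ Vz).
- move=> a b; rewrite !inE => Va Vb /= E.
  have [Ua <-] := Vphi _ Va; have [Ub <-] := Vphi _ Vb.
  by congr Phi; apply: ipsi => //; rewrite inE.
- move=> W WV oW; rewrite -image_comp; apply: opsi; last exact: ophi.
  by move=> _ [z Wz <-]; exact/VU/WV.
split.
  exact: (smooth_comp oV oU VU sphi sx).
move=> z Vz; have dphi := smooth_differentiable sphi Vz.
have dx := smooth_differentiable sx (VU _ Vz).
rewrite -kermx_eq0; apply/rowV0P => v /sub_kermxP.
have dc : differentiable ((x \o psi) \o phi) z by exact: differentiable_comp.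
rewrite -(deriveEjacobian _ dc) (diff_comp_derive v dphi dx).
rewrite (deriveEjacobian _ dx) -(mul0mx _ (jacobian (x \o psi) (phi z))).
move=> /(row_free_inj (rf _ (VU _ Vz))) D0.
have dP := dPhi _ Vz.
have : 'D_v (Phi \o phi) z = 'D_v id z.
  by apply: near_eq_derive; near=> y; apply: (Vphi y _).2; near: y; exact: open_nbhs_nbhs.
by rewrite derive_id (diff_comp_derive v dphi dP) D0 derive0.
Unshelve. all: by end_near. Qed.

(** Being critical passes between charts with no smoothness of the transition map. Points psi (k +
    q) equal psi' z' with z' near q', and |z' - q'| <= C |x psi' z' - x psi' q'| <= C K |k|, because
    x o psi' is an immersion and x o psi is Lipschitz at q. An error o(|z' - q'|) is thus o(|k|). *)
Lemma zero_derive_transfer (U U' : set 'rV[R]_3) (psi psi' : 'rV[R]_3 -> M)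
    (h : M -> R) q q' :
  local_param x U psi -> local_param x U' psi' -> U q -> U' q' -> psi q = psi' q' ->
  differentiable (h \o psi') q' -> (forall v, 'D_v (h \o psi') q' = 0) ->
  forall v, 'D_v (h \o psi) q = 0.
Proof.
move=> H H' Uq Uq' E dh Dh.
have [oU _ _ _ [sx _]] := H; have [oU' _ _ opsi' [sx' rf']] := H'.
have dx := smooth_differentiable sx Uq.
have dx' := smooth_differentiable sx' Uq'.
have [C C0 /nbhs_normP[d1 /= d10 H1]] := immersion_lower_bound dx' (rf' _ Uq').
have [K K0 HK] := diff_lipschitz_near dx.
have : differentiable (h \o psi) q /\ 'd (h \o psi) q = \0 :> ('rV[R]_3 -> R).
  apply: diff_eps; first exact: cst_continuous.
  move=> e e0.
  have e'0 : 0 < e / (C * K) by rewrite divr_gt0// mulr_gt0.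
  have /nbhs_normP[d2 /= d20 H2] := eps_diff dh e'0.
  pose d := Num.min d1 d2.
  pose B := [set z | `|z - q'| < d] `&` U'.
  (* The image of B under psi' is open in M, so by continuity psi (k + q) falls in it for all small
     k. *)
  have oB : open B by apply: openI => //; exact: open_norm_lt.
  have : \forall z \near q, (psi' @` B) (psi z).
    apply: (local_param_continuous H Uq); apply: open_nbhs_nbhs; split.
      by apply: opsi' oB => z [].
    by exists q' => //; split=> //=; rewrite subrr normr0 lt_min d10.
  rewrite (near_shift 0) subr0 => nB.
  near=> k.
  have [z' [/= z'd Uz'] Ez'] : (psi' @` B) (psi (k + q)).
    by near: k; exact: nB.
  rewrite /= subr0.
  move: z'd; rewrite lt_min => /andP[z'd1 z'd2].
  have L1 := H1 (z' - q'); have L2 := H2 (z' - q').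
  rewrite /ball_ /= sub0r normrN subrK in L1 L2.
  have {L1} := L1 z'd1; rewrite Ez' -E => L1.
  have {L2} := L2 z'd2; rewrite -(deriveE _ dh) Dh subr0 => L2.
  rewrite Ez' -E in L2; apply: le_trans L2 _.
  have L3 : `|x (psi (k + q)) - x (psi q)| <= K * `|k| by near: k; exact: HK.
  apply: (@le_trans _ _ (e / (C * K) * (C * (K * `|k|)))).
    rewrite ler_pM2l//; apply: le_trans L1 _; rewrite ler_pM2l//.
  by rewrite le_eqVlt; apply/orP; left; apply/eqP; field; rewrite !gt_eqF.
by move=> [dhp Ed] v; rewrite (deriveE v dhp) Ed.
Unshelve. all: by end_near. Qed.

End charts.

Lemma derive_mulmx (R : realType) (V : normedModType R) n m (f : V -> 'rV[R]_n)
    (Q : 'M[R]_(n, m)) p v : differentiable f p ->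
  differentiable (fun q => f q *m Q) p /\ 'D_v (fun q => f q *m Q) p = 'D_v f p *m Q.
Proof.
move=> df; have dQ : is_diff (f p) (mulmxr Q) (mulmxr Q : 'rV[R]_n -> 'rV[R]_m).
  split; first exact/linear_differentiable/mulmxr_continuous.
  by rewrite diff_lin//; exact: mulmxr_continuous.
have [dQd dQv] := dQ.
have dc : differentiable (mulmxr Q \o f) p by exact: differentiable_comp.
split=> //; apply: (etrans (diff_comp_derive v df dQd)).
by rewrite deriveE// dQv.
Qed.

(** * Three-minimality and the GCR condition read in a chart *)

Section hypersurfaces.
Context {R : realType} {M : topologicalType} {x N : M -> 'rV[R]_4}.
Hypothesis hN : unit_normal_field x N.

Lemma chart_patch (U : set 'rV[R]_3) psi : local_param x U psi ->
  hypersurface_patch U (x \o psi) (N \o psi).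
Proof.
move=> H; have [oU _ _ _ [sx rf]] := H; have [N1 /(_ _ _ H)[sN ort]] := hN.
split=> // [q _|q v Uq]; first exact: N1.
by rewrite (deriveE v (smooth_differentiable sx Uq)) ort.
Qed.

Definition support_locally_cst := forall U psi, local_param x U psi ->
  forall q u, U q -> 'D_u (fun q => dot (x (psi q)) (N (psi q))) q = 0.

Section chart.
Variables (U : set 'rV[R]_3) (psi : 'rV[R]_3 -> M).
Hypothesis H : local_param x U psi.

Let oU : open U. Proof. by case: H. Qed.
Let P := chart_patch H.
Let df q : U q -> differentiable (x \o psi) q.
Proof. by case: P => _ [sx _] _ _ _; exact: smooth_differentiable. Qed.
Let dn q : U q -> differentiable (N \o psi) q.
Proof. by case: P => _ [_ sN] _ _ _; exact: smooth_differentiable. Qed.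

(** The null vector X of S may come from another chart psi'. With X frozen, h = <N, X> is critical
    there by symmetry of the second fundamental form; this transfers to psi and, by symmetry again,
    the vector v with D_v x = X is null for dN. *)
Lemma principal_null_kernel q X : U q -> principal_direction x N (psi q) X 0 ->
  exists2 v, v != 0 & 'D_v (N \o psi) q = 0.
Proof.
move=> Uq [X0 [U' [psi' [q' [v' [H' Uq' E XE YE]]]]]].
have P' := chart_patch H'.
have df' : differentiable (x \o psi') q'.
  by case: P' => _ [sx _] _ _ _; exact: smooth_differentiable sx Uq'.
have dn' : differentiable (N \o psi') q'.
  by case: P' => _ [_ sN] _ _ _; exact: smooth_differentiable sN Uq'.
have XD : 'D_v' (x \o psi') q' = X by rewrite (deriveE _ df') -XE.
have ND : 'D_v' (N \o psi') q' = 0.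
  by apply/eqP; rewrite -oppr_eq0 (deriveE _ dn') -YE scale0r.
have XN : dot X (N (psi q)) = 0.
  by rewrite dotC -E -XD; exact: (patch_ortho P' _ Uq').
pose h m := dot (N m) X.
have dh' : differentiable (h \o psi') q'.
  exact: (differentiable_dot dn' (differentiable_cst X q')).
have dX0 (psi1 : 'rV[R]_3 -> M) q1 u : differentiable (N \o psi1) q1 ->
    'D_u (h \o psi1) q1 = dot ('D_u (N \o psi1) q1) X.
  move=> d1; rewrite (derive_dot u d1 (differentiable_cst X q1)) derive_cst.
  by rewrite dot0r addr0.
have Dh' u : 'D_u (h \o psi') q' = 0.
  by rewrite dX0// -XD (patch_sym P' _ _ Uq') ND dot0l.
have Dh := zero_derive_transfer H H' Uq Uq' (esym E) dh' Dh'.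
have [v vX] := patch_tangent P Uq XN.
exists v; first by apply: contraNneq X0 => v0; rewrite -vX v0 derive0.
apply: (patch_eq0 P Uq) => [|u]; first exact: (patch_orthon P).
by rewrite (patch_sym P _ _ Uq) vX -dX0; [exact: Dh|exact: dn].
Qed.

Lemma three_minimal_kernel q : three_minimal x N -> U q ->
  exists2 v, v != 0 & 'D_v (N \o psi) q = 0.
Proof.
move=> /(_ (psi q)) [k [e [_ He]] /eqP]; rewrite eq_sym => /prodf_eq0[i _ /eqP ki] Uq.
by apply: (principal_null_kernel (X := e i) Uq); rewrite -ki.
Qed.

Lemma gcr_parallel q : gcr x N -> U q -> exists k, forall u,
  dot (x (psi q)) ('D_u (N \o psi) q) = k * dot (x (psi q)) ('D_u (x \o psi) q).
Proof.
move=> hgcr Uq.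
have [T0|T0] := eqVneq (tangential_part x N (psi q)) 0.
  exists 0 => u; rewrite mul0r.
  transitivity (dot (tangential_part x N (psi q)) ('D_u (N \o psi) q)); last by rewrite T0 dot0l.
  exact/esym/(dot_tangential (f := x \o psi) (patch_orthon P u Uq)).
have [k [_ [U' [psi' [q' [v' [H' Uq' E XE YE]]]]]]] := hgcr _ T0.
have P' := chart_patch H'.
have df' : differentiable (x \o psi') q'.
  by case: P' => _ [sx _] _ _ _; exact: smooth_differentiable sx Uq'.
have dn' : differentiable (N \o psi') q'.
  by case: P' => _ [_ sN] _ _ _; exact: smooth_differentiable sN Uq'.
pose T := tangential_part x N (psi' q').
have XD : 'D_v' (x \o psi') q' = T by rewrite (deriveE _ df') -XE /T E.
have ND : 'D_v' (N \o psi') q' = - k *: T.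
  have kT : k *: T = - 'd (N \o psi') q' v' by rewrite /T E.
  apply: (etrans (deriveE v' dn')); apply: oppr_inj.
  by rewrite -kT; apply/rowP => i; rewrite !mxE mulNr opprK.
have Tf u : dot T ('D_u (x \o psi') q') = dot (x (psi' q')) ('D_u (x \o psi') q').
  have o : dot ('D_u (x \o psi') q') ((N \o psi') q') = 0.
    by rewrite dotC; exact: (patch_ortho P' _ Uq').
  exact: (dot_tangential (f := x \o psi') o).
have Tn u : dot T ('D_u (N \o psi') q') = dot (x (psi' q')) ('D_u (N \o psi') q').
  exact: (dot_tangential (f := x \o psi') (patch_orthon P' u Uq')).
have rel u : dot (x (psi' q')) ('D_u (N \o psi') q') =
    - k * dot (x (psi' q')) ('D_u (x \o psi') q').
  by rewrite -Tn -XD dotC (patch_sym P' _ _ Uq') ND dotZl Tf.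
(* The derivative of h is <x, dN> + k <x, dx>, so the relation to be transferred between charts says
   exactly that h is critical. The factor 1/2 comes from differentiating <x, x>. *)
pose h m := dot (x m) (N m + (k / 2) *: x m).
have dsum (psi1 : 'rV[R]_3 -> M) q1 : differentiable (x \o psi1) q1 ->
    differentiable (N \o psi1) q1 -> differentiable (fun q => N (psi1 q) + (k / 2) *: x (psi1 q)) q1.
  by move=> d1 d2; apply: differentiableD => //; exact: differentiableZ.
have Dh1 (psi1 : 'rV[R]_3 -> M) q1 u : differentiable (x \o psi1) q1 ->
    differentiable (N \o psi1) q1 -> dot ('D_u (x \o psi1) q1) (N (psi1 q1)) = 0 ->
    'D_u (h \o psi1) q1 = dot (x (psi1 q1)) ('D_u (N \o psi1) q1) +
      k * dot (x (psi1 q1)) ('D_u (x \o psi1) q1).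
  move=> d1 d2 o1; apply: (etrans (derive_dot u d1 (dsum _ _ d1 d2))).
  have -> : 'D_u (fun q => N (psi1 q) + (k / 2) *: x (psi1 q)) q1 =
     'D_u (N \o psi1) q1 + (k / 2) *: 'D_u (x \o psi1) q1.
    apply: (etrans (deriveD (diff_derivable d2) _)).
      by apply: derivableZ; exact: diff_derivable.
    by congr (_ + _); exact: (deriveZ _ (diff_derivable d1)).
  rewrite !dotDr !dotZr o1 add0r [dot ('D_u _ _) _]dotC.
  by rewrite addrCA -mulrDl -splitr.
have dh' : differentiable (h \o psi') q'.
  exact: (differentiable_dot df' (dsum _ _ df' dn')).
have Dh' u : 'D_u (h \o psi') q' = 0.
  have o : dot ('D_u (x \o psi') q') (N (psi' q')) = 0.
    by rewrite dotC; exact: (patch_ortho P' _ Uq').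
  by apply: (etrans (Dh1 psi' q' u df' dn' o)); rewrite (rel u) mulNr addNr.
have Dh := zero_derive_transfer H H' Uq Uq' (esym E) dh' Dh'.
exists (- k) => u.
have o : dot ('D_u (x \o psi) q) (N (psi q)) = 0.
  by rewrite dotC; exact: (patch_ortho P _ Uq).
have /esym := etrans (esym (Dh u)) (Dh1 psi q u (df Uq) (dn Uq) o).
by move/eqP; rewrite addr_eq0 mulNr => /eqP.
Qed.

End chart.

Lemma gcr_support : three_minimal x N -> gcr x N -> support_locally_cst.
Proof.
move=> h3 hgcr U psi H q u Uq.
apply: (gcr_support_cst (chart_patch H) _ _ _ Uq) => {q u Uq} q Uq.
  exact: (gcr_parallel H hgcr Uq).
exact: (three_minimal_kernel H h3 Uq).
Qed.

Lemma support_gcr : hypersurface x -> support_locally_cst -> gcr x N.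
Proof.
move=> [_ _ _ hc] H p T0; have [U [psi [Hp [q Uq qp]]]] := hc p.
have P := chart_patch Hp; exists 0; split=> //.
have [v vT] := patch_tangent P Uq (tangential_ortho P Uq).
have nT := patch_kernel P Uq (fun u => H _ _ Hp q u Uq) vT.
have [_ [sx sN] _ _ _] := P.
exists U, psi, q, v; split=> //.
  by rewrite -(deriveE v (smooth_differentiable sx Uq)) vT -qp.
by rewrite scale0r -(deriveE v (smooth_differentiable sN Uq)) nT oppr0.
Qed.

(** If D_u g is nonzero on an open set, this set meets D at a point near which g^2 = c. Then 2 g D_u
    g = 0 there gives g = 0 at that point, so c = 0 and g vanishes nearby, contradicting D_u g <> 0.
    Squares suffice, so no choice of sign has to be continuous. *)
Lemma dense_support (D : set M) : open D -> dense D ->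
  (forall p, D p -> exists O c, [/\ open O, O p &
     forall m, O m -> dot (x m) (N m) ^+ 2 = c]) -> support_locally_cst.
Proof.
move=> oD dD HD U psi H q0 u Uq0; have P := chart_patch H.
have [oU _ _ opsi _] := H; have [_ [sx sN] _ _ _] := P.
pose g q := dot (x (psi q)) (N (psi q)).
have sg : smooth_on U g by exact: smooth_dot.
have sDg := smooth_derive u sg.
apply/eqP/negPn/negP => nz.
pose O := [set q | U q /\ 'D_u g q != 0].
have oO : open O.
  rewrite openE => z [Uz hz]; apply: filterI; first exact: open_nbhs_nbhs.
  exact: near_neq0 (differentiable_continuous (smooth_differentiable sDg Uz)) hz.
have OU : O `<=` U by move=> z [].
have [_ [[q1 Oq1 <-] Dq1]] : (psi @` O) `&` D !=set0.
  apply: dD; last exact: opsi.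
  by exists (psi q0), q0.
have [Uq1 nz1] := Oq1.
have [B [c [oB Bq1 HB]]] := HD _ Dq1.
have nB : \forall q \near q1, g q ^+ 2 = c.
  have : \forall q \near q1, B (psi q).
    by apply: (local_param_continuous H Uq1); exact: open_nbhs_nbhs.
  by apply: filterS => q; exact: HB.
have dg := smooth_differentiable sg Uq1.
have g0 : g q1 = 0.
  have : 'D_u (g * g) q1 = 0.
    rewrite -(derive_cst c q1 u); apply: near_eq_derive.
    by apply: filterS nB => q <-; rewrite expr2.
  rewrite (deriveM (diff_derivable dg) (diff_derivable dg)) => /eqP.
  by rewrite -mulr2n mulrn_eq0/= mulf_eq0 (negPf nz1) orbF => /eqP.
have c0 : c = 0 by rewrite -(nbhs_singleton nB) g0 expr0n.
case/eqP: nz1; rewrite -(derive_cst (0 : R) q1 u); apply: near_eq_derive.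
by apply: filterS nB => q; rewrite c0 => /eqP; rewrite sqrf_eq0 => /eqP.
Qed.

End hypersurfaces.

(** * The support function of the models *)

Lemma dot4 (R : realType) (a b : 'rV[R]_4) :
  dot a b = a 0 0 * b 0 0 + a 0 1 * b 0 1 + a 0 2 * b 0 2 + a 0 3 * b 0 3.
Proof.
rewrite dotE !big_ord_recl big_ord0 addr0 !addrA.
by congr (_ + _ * _ + _ * _ + _ * _); congr (_ 0 _); apply: val_inj.
Qed.

Lemma differentiable_scale (R : realType) (V : normedModType R) n (h : V -> R)
    (g : V -> 'rV[R]_n) p : differentiable h p -> differentiable g p ->
  differentiable (fun q => h q *: g q) p.
Proof.
move=> dh /differentiable_rV dg; apply/differentiable_rV => i.
rewrite (_ : (fun _ => _) = (fun q => h q * g q 0 i)); first exact: differentiableM.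
by apply/funext => q; rewrite mxE.
Qed.

Lemma dot_comb_eq0 (R : realType) n (a b c d : R) (y z p q : 'rV[R]_n) :
  dot y p = 0 -> dot y q = 0 -> dot z p = 0 -> dot z q = 0 ->
  dot (a *: y + b *: z) (c *: p + d *: q) = 0.
Proof.
by move=> yp yq zp zq; rewrite !dotDl !dotDr !dotZl !dotZr yp yq zp zq !(mulr0, addr0).
Qed.

Section models.
Context {R : realType} {M : topologicalType} {x N : M -> 'rV[R]_4}.
Hypothesis hN : unit_normal_field x N.

Section model_support.
Variables (U : set 'rV[R]_3) (psi : 'rV[R]_3 -> M) (Q : 'M[R]_4).
Hypotheses (H : local_param x U psi) (QQ : Q *m Q^T = 1%:M).
Variables (m : 'rV[R]_3 -> 'rV[R]_4) (mu beta : R).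
Hypotheses (mu0 : mu != 0) (dm : forall q, U q -> differentiable m q).
Hypothesis mm : forall q, U q -> dot (m q) (m q) = mu.
Hypothesis Fm : forall q, U q -> dot (x (psi q) *m Q) (m q) = beta.
Hypothesis Fdm : forall q u, U q -> dot (x (psi q) *m Q) ('D_u m q) = 0.

(** Differentiating <F, m> = beta and using <F, dm> = 0 leaves <dF, m> = 0, so m Q^T is normal and
    equals a N. Then a^2 = mu and beta = a g. *)
Lemma model_support q : U q -> dot (x (psi q)) (N (psi q)) ^+ 2 = beta ^+ 2 / mu.
Proof.
move=> Uq; have P := chart_patch hN H; have [oU [sx sN] _ _ _] := P.
have df := smooth_differentiable sx Uq.
pose m' := m q *m Q^T.
have fm' u : dot m' ('D_u (x \o psi) q) = 0.
  have [dFq DF] := derive_mulmx Q u df.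
  have D0 : 'D_u (fun q => dot ((x \o psi) q *m Q) (m q)) q = 0.
    exact: (eq_cst_derive0 u oU Uq Fm).
  have Fq : dot ((x \o psi) q *m Q) ('D_u m q) = 0 by exact: Fdm.
  have D1 := derive_dot u dFq (dm Uq).
  have D2 : dot ('D_u (x \o psi) q *m Q) (m q) = 0.
    by have := etrans (esym D1) D0; rewrite DF Fq addr0.
  by rewrite dotC -D2 dot_mulmx.
pose a := dot m' (N (psi q)).
have nn : dot (N (psi q)) (N (psi q)) = 1 by case: hN.
have m'E : m' = a *: N (psi q).
  apply/eqP; rewrite -subr_eq0; apply/eqP; apply: (patch_eq0 P Uq) => [|u].
    by rewrite dotBl dotZl nn mulr1 subrr.
  by rewrite dotBl dotZl fm' (patch_ortho P _ Uq) mulr0 subrr.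
have a2 : a ^+ 2 = mu.
  rewrite -(mm Uq) -[RHS](_ : dot m' m' = _); first by rewrite m'E dotZl dotZr nn mulr1.
  by rewrite {1}/m' dot_mulmx trmxK /m' -mulmxA (mulmx1C QQ) mulmx1.
have -> : beta = a * dot (x (psi q)) (N (psi q)).
  by rewrite -(Fm Uq) dot_mulmx -/m' m'E dotZr.
by rewrite exprMn a2 mulrAC divff// mul1r.
Qed.

End model_support.

Definition support2_locally_cst p := exists O c, [/\ open O, O p &
  forall m, O m -> dot (x m) (N m) ^+ 2 = c].

Lemma model_locally_cst p (U : set 'rV[R]_3) psi (Q : 'M[R]_4) m (mu beta : R) :
  local_param x U psi -> (psi @` U) p -> Q *m Q^T = 1%:M -> mu != 0 ->
  (forall q, U q -> differentiable m q) ->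
  (forall q, U q -> dot (m q) (m q) = mu) ->
  (forall q, U q -> dot (x (psi q) *m Q) (m q) = beta) ->
  (forall q u, U q -> dot (x (psi q) *m Q) ('D_u m q) = 0) ->
  support2_locally_cst p.
Proof.
move=> H Up QQ mu0 dm mm Fm Fdm; exists (psi @` U), (beta ^+ 2 / mu).
have [oU _ _ opsi _] := H; split=> //; first exact: opsi.
by move=> _ [q Uq <-]; exact: (model_support H QQ mu0 dm mm Fm Fdm Uq).
Qed.

Lemma hyperplane_support p : locally_congruent x p (@hyperplane R) ->
  support2_locally_cst p.
Proof.
move=> [Q [U [psi [QQ H Up [a [b [a0 Fa]]]]]]].
apply: (model_locally_cst (m := fun=> a) (mu := dot a a) H Up QQ _ _ _ Fa) => //.
- by rewrite dot_eq0.
- by move=> q u _; rewrite derive_cst dot0r.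
Qed.

(** Each d i is 0 or 1, so m is the orthogonal projection of the position onto a coordinate
    subspace, of constant length |r|. Subspaces of dimension 3 and 2 give the spherical and the
    circular hypercylinders. *)
Lemma projection_support p (d : 'I_4 -> R) (r : R) Q (U : set 'rV[R]_3) psi :
  (forall i, d i * d i = d i) -> r != 0 -> Q *m Q^T = 1%:M ->
  local_param x U psi -> (psi @` U) p ->
  (forall q, U q -> dot (x (psi q) *m Q) (\row_i (d i * (x (psi q) *m Q) 0 i)) = r ^+ 2) ->
  support2_locally_cst p.
Proof.
move=> dd r0 QQ H Up Fd; have [oU _ _ _ [sx _]] := H.
pose F q := x (psi q) *m Q; pose m q : 'rV[R]_4 := \row_i (d i * F q 0 i).
have dF q : U q -> differentiable F q.
  by move=> Uq; exact: (derive_mulmx Q 0 (smooth_differentiable sx Uq)).1.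
have mE q : m q = F q *m diag_mx (\row_i d i).
  by rewrite mul_mx_diag; apply/rowP => i; rewrite !mxE mulrC.
have dm q : U q -> differentiable m q.
  move=> Uq; have [+ _] := derive_mulmx (diag_mx (\row_i d i)) 0 (dF q Uq).
  by rewrite (_ : (fun q => _) = m)//; apply/funext => z; rewrite mE.
have sym a b : dot (a *m diag_mx (\row_i d i)) b = dot a (b *m diag_mx (\row_i d i)).
  by rewrite dot_mulmx tr_diag_mx.
have idem (a : 'rV[R]_4) : a *m diag_mx (\row_i d i) *m diag_mx (\row_i d i) = a *m diag_mx (\row_i d i).
  by rewrite !mul_mx_diag; apply/rowP => i; rewrite !mxE -mulrA dd.
apply: (model_locally_cst (m := m) (mu := r ^+ 2) (beta := r ^+ 2) H Up QQ) => //.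
- by rewrite expf_neq0.
- by move=> q Uq; rewrite mE sym idem -mE; exact: Fd.
move=> q u Uq; have D0 := eq_cst_derive0 u oU Uq Fd.
(* Since the projection is symmetric, the two terms in the derivative of <F, m> coincide, and each
   of them vanishes. *)
have := etrans (esym (derive_dot u (dF q Uq) (dm q Uq))) D0.
have -> : 'D_u m q = 'D_u F q *m diag_mx (\row_i d i).
  rewrite -(derive_mulmx (diag_mx (\row_i d i)) u (dF q Uq)).2.
  by congr ('D_u _ q); apply/funext => z; rewrite mE.
have -> : dot ('D_u F q) (m q) = dot (F q) ('D_u F q *m diag_mx (\row_i d i)).
  by rewrite mE -sym dotC.
by move=> /eqP; rewrite -mulr2n mulrn_eq0/= => /eqP.
Qed.

Lemma spherical_support p : locally_congruent x p (@spherical_hypercylinder R) ->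
  support2_locally_cst p.
Proof.
move=> [Q [U [psi [QQ H Up [r [r0 Fr]]]]]].
apply: (projection_support (d := fun i => (i != 3)%:R) (r := r) _ r0 QQ H Up).
  by move=> i; case: (i != 3); rewrite ?mulr1 ?mulr0.
move=> q Uq; rewrite -(Fr q Uq); move: (_ *m Q) => y.
by rewrite dot4 !mxE/= !mul1r mul0r mulr0 addr0.
Qed.

Lemma circular_support p : locally_congruent x p (@circular_hypercylinder R) ->
  support2_locally_cst p.
Proof.
move=> [Q [U [psi [QQ H Up [r [r0 Fr]]]]]].
apply: (projection_support (d := fun i => (i < 2)%N%:R) (r := r) _ r0 QQ H Up).
  by move=> i; case: (i < 2)%N; rewrite ?mulr1 ?mulr0.
move=> q Uq; rewrite -(Fr q Uq); move: (_ *m Q) => y.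
by rewrite dot4 !mxE/= !mul1r !mul0r !mulr0 !addr0.
Qed.

Lemma differentiable_row4 (f0 f1 f2 f3 : 'rV[R]_3 -> R) q :
  differentiable f0 q -> differentiable f1 q -> differentiable f2 q ->
  differentiable f3 q -> differentiable (fun q => vec4 (f0 q) (f1 q) (f2 q) (f3 q)) q.
Proof.
move=> d0 d1 d2 d3; apply/differentiable_rV => i.
rewrite (_ : (fun _ => _) = [:: f0; f1; f2; f3]`_i).
  by case: i => [[|[|[|[|//]]]] ?] /=.
by apply/funext => z; rewrite mxE; case: i => [[|[|[|[|//]]]] ?].
Qed.

Lemma derive_row4 (f0 f1 f2 f3 : 'rV[R]_3 -> R) q u :
  differentiable f0 q -> differentiable f1 q -> differentiable f2 q ->
  differentiable f3 q -> 'D_u (fun q => vec4 (f0 q) (f1 q) (f2 q) (f3 q)) q =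
  vec4 ('D_u f0 q) ('D_u f1 q) ('D_u f2 q) ('D_u f3 q).
Proof.
move=> d0 d1 d2 d3; have D := differentiable_row4 d0 d1 d2 d3.
apply/rowP => i; apply: (etrans (derive_rV u i D)).
have -> : (fun q => vec4 (f0 q) (f1 q) (f2 q) (f3 q) 0 i) = [:: f0; f1; f2; f3]`_i.
  by apply/funext => z; rewrite mxE; case: i => [[|[|[|[|//]]]] ?].
by rewrite /vec4 row_entry; case: i => [[|[|[|[|//]]]] ?].
Qed.

Lemma conical_support p : locally_congruent x p (@conical_hypercylinder R) ->
  support2_locally_cst p.
Proof.
move=> [Q [U [psi [QQ H Up [c1 [c2 [c10 c20 FE]]]]]]].
have dcoord (q : 'rV[R]_3) i : differentiable (fun z : 'rV[R]_3 => z 0 i) q.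
  exact: differentiable_coord.
have dcos t : differentiable (cos : R -> R) t by apply/derivable1_diffP; exact: derivable_cos.
have dsin t : differentiable (sin : R -> R) t by apply/derivable1_diffP; exact: derivable_sin.
pose C (q : 'rV[R]_3) := c2 * cos (q 0 1); pose S (q : 'rV[R]_3) := c2 * sin (q 0 1).
have dc q : differentiable (fun q : 'rV[R]_3 => cos (q 0 1)) q.
  by apply: (differentiable_comp (dcoord q 1)); exact: dcos.
have ds q : differentiable (fun q : 'rV[R]_3 => sin (q 0 1)) q.
  by apply: (differentiable_comp (dcoord q 1)); exact: dsin.
have Dcoord (q u : 'rV[R]_3) i : 'D_u (fun z : 'rV[R]_3 => z 0 i) q = u 0 i.
  by rewrite -(derive_rV (f := id)) ?derive_id.
have Dc (q u : 'rV[R]_3) : 'D_u (fun q : 'rV[R]_3 => cos (q 0 1)) q = u 0 1 * - sin (q 0 1).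
  apply: (etrans (diff_comp_derive u (dcoord q 1) (dcos _))).
  rewrite Dcoord -[u 0 1 in LHS]mulr1 -[_ * 1]/(_ *: (1 : R)) (deriveZv _ _ (dcos _)).
  by congr (_ * _); have [_ ->] := is_derive_cos (q 0 1).
have Ds (q u : 'rV[R]_3) : 'D_u (fun q : 'rV[R]_3 => sin (q 0 1)) q = u 0 1 * cos (q 0 1).
  apply: (etrans (diff_comp_derive u (dcoord q 1) (dsin _))).
  rewrite Dcoord -[u 0 1 in LHS]mulr1 -[_ * 1]/(_ *: (1 : R)) (deriveZv _ _ (dsin _)).
  by congr (_ * _); have [_ ->] := is_derive_sin (q 0 1).
have dC q : differentiable C q by apply: differentiableM => //; exact: differentiable_cst.
have dS q : differentiable S q by apply: differentiableM => //; exact: differentiable_cst.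
(* Normal vector of the cone: it is orthogonal to the ruling (c1 cos t, c1 sin t, c2, 0), to the
   circle and to the last axis. Its product with the position is c2 (c1 s + c2) - c1 c2 s = c2^2. *)
pose m (q : 'rV[R]_3) := vec4 (C q) (S q) (- c1) 0.
have dm q : differentiable m q.
  by apply: differentiable_row4 => //; exact: differentiable_cst.
apply: (model_locally_cst (m := m) (mu := c2 ^+ 2 + c1 ^+ 2) (beta := c2 ^+ 2) H Up QQ).
- by rewrite gt_eqF// ltr_wpDr ?sqr_ge0// exprn_even_gt0.
- by move=> q _; exact: dm.
- move=> q _; rewrite dot4 !mxE /= /C /S.
  rewrite -[RHS](_ : c2 ^+ 2 * (cos (q 0 1) ^+ 2 + sin (q 0 1) ^+ 2) + c1 ^+ 2 = _).
    by ring.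
  by rewrite cos2Dsin2 mulr1.
- move=> q Uq; rewrite FE// dot4 !mxE /= /C /S.
  rewrite -[RHS](_ : c2 * (c1 * q 0 0 + c2) * (cos (q 0 1) ^+ 2 + sin (q 0 1) ^+ 2) - c1 * c2 * q 0 0 = _).
    by ring.
  by rewrite cos2Dsin2; ring.
move=> q u Uq; rewrite FE// /m derive_row4//; try exact: differentiable_cst.
rewrite !derive_cst.
have -> : 'D_u C q = c2 * (u 0 1 * - sin (q 0 1)).
  by rewrite /C (deriveM (diff_derivable (differentiable_cst c2 q)) (diff_derivable (dc q))) derive_cst Dc scaler0 addr0.
have -> : 'D_u S q = c2 * (u 0 1 * cos (q 0 1)).
  by rewrite /S (deriveM (diff_derivable (differentiable_cst c2 q)) (diff_derivable (ds q))) derive_cst Ds scaler0 addr0.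
rewrite dot4 !mxE /=; ring.
Qed.

Lemma derive_pair_comp (W : normedModType R) (y : 'rV[R]_2 -> W) (q u : 'rV[R]_3) :
  let z (q : 'rV[R]_3) := vec2 (q 0 1) (q 0 2) in
  differentiable y (z q) -> differentiable (y \o z) q /\
  'D_u (y \o z) q = u 0 1 *: 'D_(vec2 1 0) y (z q) + u 0 2 *: 'D_(vec2 0 1) y (z q).
Proof.
move=> z dy.
have dz : differentiable z q.
  apply/differentiable_rV => i.
  rewrite (_ : (fun _ => _) = [:: (fun q : 'rV[R]_3 => q 0 1); fun q : 'rV[R]_3 => q 0 2]`_i).
    by case: i => [[|[|//]] ?] /=; exact: differentiable_coord.
  by apply/funext => w; rewrite mxE; case: i => [[|[|//]] ?].
split; first exact: differentiable_comp.
rewrite (diff_comp_derive u dz dy).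
have -> : 'D_u z q = u 0 1 *: vec2 1 0 + u 0 2 *: vec2 0 1.
  apply/rowP => i; apply: (etrans (derive_rV u i dz)).
  have -> : (fun w => z w 0 i) = [:: (fun q : 'rV[R]_3 => q 0 1); fun q : 'rV[R]_3 => q 0 2]`_i.
    by apply/funext => w; rewrite mxE; case: i => [[|[|//]] ?].
  rewrite !mxE; case: i => [[|[|//]] ?] /=; rewrite -(derive_rV (f := id)) ?derive_id//.
    by rewrite mulr1 mulr0 addr0.
  by rewrite mulr1 mulr0 add0r.
by rewrite (deriveDv _ _ dy) !(deriveZv _ _ dy).
Qed.

(** The spherical normal serves as m: <s y + c n, n> = c, and <y, dn> = - <dy, n> = 0. *)
Lemma surface_support p : locally_congruent x p (@surface_type R) ->
  support2_locally_cst p.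
Proof.
move=> [Q [U [psi [QQ H Up [Om [y [n [c [[oOm [sy _] y1 sn ny] FE]]]]]]]]].
pose z (q : 'rV[R]_3) := vec2 (q 0 1) (q 0 2).
have dn q : U q -> differentiable n (z q).
  by move=> /FE[Oz _]; exact: smooth_differentiable sn Oz.
apply: (model_locally_cst (m := n \o z) (mu := 1) (beta := c) H Up QQ).
- exact: oner_neq0.
- by move=> q Uq; have [] := derive_pair_comp 0 (dn q Uq).
- by move=> q /FE[Oz _]; have [] := ny _ Oz.
- move=> q /FE[Oz ->]; have [nn nyz _ _] := ny _ Oz.
  by rewrite dotDl !dotZl [X in _ * X + _]dotC nyz nn mulr0 mulr1 add0r.
move=> q u Uq; have [Oz ->] := FE q Uq; have [nn nyz nv nw] := ny _ Oz.
have [_ ->] := derive_pair_comp u (dn q Uq).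
have nn1 w : Om w -> dot (n w) (n w) = 1 by move=> /ny[].
have nn2 w : Om w -> dot (n w) (y w) = 0 by move=> /ny[].
have dy : differentiable y (z q) by exact: smooth_differentiable sy Oz.
have nnv v : dot (n (z q)) ('D_v n (z q)) = 0.
  have := eq_cst_derive0 v oOm Oz nn1.
  rewrite (derive_dot v (dn q Uq) (dn q Uq)) dotC -mulr2n => /eqP.
  by rewrite mulrn_eq0 => /eqP.
have ynv v : dot (n (z q)) ('D_v y (z q)) = 0 -> dot (y (z q)) ('D_v n (z q)) = 0.
  have := eq_cst_derive0 v oOm Oz nn2.
  by rewrite (derive_dot v (dn q Uq) dy) dotC => + E; rewrite E addr0.
exact: dot_comb_eq0 (ynv _ nv) (ynv _ nw) (nnv _) (nnv _).
Qed.

Lemma curve_support p : locally_congruent x p (@curve_type R) ->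
  support2_locally_cst p.
Proof.
move=> [Q [U [psi [QQ H Up [I [al [A [B [c [[[oI _] [sal sA sB] al1 AB AB'] c0 FE]]]]]]]]]].
have dcoord (q : 'rV[R]_3) i : differentiable (fun z : 'rV[R]_3 => z 0 i) q.
  exact: differentiable_coord.
have [oU _ _ _ _] := H.
have UI q : U q -> I (q 0 2) by case/FE.
have dcos t : differentiable (cos : R -> R) t by apply/derivable1_diffP; exact: derivable_cos.
have dsin t : differentiable (sin : R -> R) t by apply/derivable1_diffP; exact: derivable_sin.
pose al' (q : 'rV[R]_3) := al (q 0 2).
have comp2 (h : R -> 'rV[R]_4) q : smooth_on I h -> U q ->
    differentiable (fun q : 'rV[R]_3 => h (q 0 2)) q.
  by move=> sh /UI Iq; exact: (differentiable_comp (dcoord q 2) (smooth_differentiable sh Iq)).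
have dvc (h : R -> R) (q : 'rV[R]_3) : (forall t, differentiable h t) ->
    differentiable (fun q : 'rV[R]_3 => h (q 0 1 / c)) q.
  move=> dh; apply: (@differentiable_comp _ _ _ _ (fun q : 'rV[R]_3 => q 0 1 / c)) => //.
  by apply: differentiableM => //; exact: differentiable_cst.
(* The unit vector turning in the normal plane of alpha; <alpha, dm> = - <d alpha, m> = 0 because m
   is also orthogonal to the velocity of alpha. *)
pose m (q : 'rV[R]_3) := cos (q 0 1 / c) *: A (q 0 2) + sin (q 0 1 / c) *: B (q 0 2).
have dm q : U q -> differentiable m q.
  move=> Uq; apply: differentiableD.
    by apply: differentiable_scale; [exact: dvc|exact: comp2].
  by apply: differentiable_scale; [exact: dvc|exact: comp2].
have mm q : U q -> dot (m q) (m q) = 1.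
  move=> /UI Iq; have [AA BB AB0] := AB _ Iq.
  rewrite /m !dotDl !dotDr !dotZl !dotZr AA BB AB0 [dot (B _) _]dotC AB0.
  by rewrite !mulr0 !mulr1 addr0 add0r -!expr2 cos2Dsin2.
have ma q : U q -> dot (al' q) (m q) = 0.
  move=> /UI Iq; have [a1 _ a2 _] := AB' _ Iq.
  by rewrite /m dotDr !dotZr !(dotC (al' q)) a1 a2 !mulr0 addr0.
apply: (model_locally_cst (m := m) (mu := 1) (beta := c) H Up QQ) => //.
- move=> q Uq; have [_ ->] := FE q Uq.
  by rewrite -/(m q) dotDl !dotZl (ma q Uq) (mm q Uq) mulr0 mulr1 add0r.
move=> q u Uq; have [Iq ->] := FE q Uq; rewrite -/(m q) -/(al' q) dotDl !dotZl.
have -> : dot (m q) ('D_u m q) = 0.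
  have := eq_cst_derive0 u oU Uq mm.
  rewrite (derive_dot u (dm q Uq) (dm q Uq)) dotC -mulr2n => /eqP.
  by rewrite mulrn_eq0 => /eqP.
suff -> : dot (al' q) ('D_u m q) = 0 by rewrite !mulr0 addr0.
have dal := comp2 al q sal Uq.
have := eq_cst_derive0 u oU Uq ma.
rewrite (derive_dot u dal (dm q Uq)).
suff -> : dot ('D_u al' q) (m q) = 0 by rewrite add0r.
have dalw := smooth_differentiable sal Iq.
have -> : 'D_u al' q = u 0 2 *: derive1 al (q 0 2).
  apply: (etrans (diff_comp_derive u (dcoord q 2) dalw)).
  rewrite derive1E -(deriveZv _ _ dalw) [_ *: 1]mulr1.
  by congr ('D_ _ al _); rewrite -(derive_rV (f := id)) ?derive_id.
have [_ a1 _ a2] := AB' _ Iq.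
by rewrite /m dotZl dotDr !dotZr !(dotC (derive1 _ _)) a1 a2 !mulr0 addr0 mulr0.
Qed.

End models.

(** * Coordinates *)

Definition vec3 (R : realType) (a b c : R) : 'rV[R]_3 := \row_(i < 3) [:: a; b; c]`_i.

Section vec3.
Context {R : realType}.

Lemma vec3E (z : 'rV[R]_3) : z = vec3 (z 0 0) (z 0 1) (z 0 2).
Proof.
apply/rowP => i; rewrite mxE.
by case: (ord3P i) => ->.
Qed.

Lemma vec3_inj (a b c a' b' c' : R) : vec3 a b c = vec3 a' b' c' ->
  [/\ a = a', b = b' & c = c'].
Proof.
move=> E; have H i := congr1 (fun z : 'rV[R]_3 => z 0 i) E.
by have := (H 0, H 1, H 2); rewrite !mxE/= => -[[]].
Qed.

Lemma norm3_lt (z : 'rV[R]_3) (e : R) : 0 < e ->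
  (`|z| < e) = [&& `|z 0 0| < e, `|z 0 1| < e & `|z 0 2| < e].
Proof.
move=> e0; apply/idP/and3P => [ze|[z0 z1 z2]].
  by split; apply: le_lt_trans ze; exact: norm_coord_le.
have m0 : 0 <= Num.max `|z 0 0| (Num.max `|z 0 1| `|z 0 2|) by rewrite le_max normr_ge0.
apply: (@le_lt_trans _ _ (Num.max `|z 0 0| (Num.max `|z 0 1| `|z 0 2|))); last first.
  by rewrite !gt_max z0 z1 z2.
apply: norm_rV_le => // i.
by case: (ord3P i) => ->; rewrite !le_max lexx ?orbT.
Qed.

Lemma norm2_lt (z : 'rV[R]_2) (e : R) : 0 < e ->
  (`|z| < e) = (`|z 0 0| < e) && (`|z 0 1| < e).
Proof.
move=> e0; apply/idP/andP => [ze|[z0 z1]].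
  by split; apply: le_lt_trans ze; exact: norm_coord_le.
have m0 : 0 <= Num.max `|z 0 0| `|z 0 1| by rewrite le_max normr_ge0.
apply: (@le_lt_trans _ _ (Num.max `|z 0 0| `|z 0 1|)); last by rewrite gt_max z0 z1.
apply: norm_rV_le => // i.
have [->|->] : i = 0 \/ i = 1.
  by case: i => [[|[|//]] ?]; [left|right]; exact: val_inj.
all: by rewrite le_max lexx ?orbT.
Qed.

Lemma smooth_vec3 (V : normedModType R) (U : set V) (f0 f1 f2 : V -> R) : open U ->
  smooth_on U f0 -> smooth_on U f1 -> smooth_on U f2 ->
  smooth_on U (fun q => vec3 (f0 q) (f1 q) (f2 q)).
Proof.
move=> oU s0 s1 s2; apply/smooth_rV => // i.
apply: (eq_smooth (f := [:: f0; f1; f2]`_i)) => //.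
  by move=> q _; rewrite mxE; case: (ord3P i) => ->.
by case: (ord3P i) => ->.
Qed.

Lemma derive_vec3 (V : normedModType R) (f0 f1 f2 : V -> R) q u :
  differentiable f0 q -> differentiable f1 q -> differentiable f2 q ->
  'D_u (fun q => vec3 (f0 q) (f1 q) (f2 q)) q = vec3 ('D_u f0 q) ('D_u f1 q) ('D_u f2 q).
Proof.
move=> d0 d1 d2.
have E i : (fun q => vec3 (f0 q) (f1 q) (f2 q) 0 i) = [:: f0; f1; f2]`_i.
  by apply/funext => z; rewrite mxE; case: (ord3P i) => ->.
have D : differentiable (fun q => vec3 (f0 q) (f1 q) (f2 q)) q.
  apply/differentiable_rV => i; rewrite E.
  by case: (ord3P i) => ->.
apply/rowP => i; apply: (etrans (derive_rV u i D)); rewrite E row_entry.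
by case: (ord3P i) => ->.
Qed.

Lemma basis3 (v1 v2 v3 : 'rV[R]_3) :
  (forall a b c, a *: v1 + b *: v2 + c *: v3 = 0 -> [/\ a = 0, b = 0 & c = 0]) ->
  forall w, exists a b c, w = a *: v1 + b *: v2 + c *: v3.
Proof.
move=> indep w.
pose B : 'M[R]_3 := \matrix_(i < 3) [:: v1; v2; v3]`_i.
have BE (z : 'rV[R]_3) : z *m B = z 0 0 *: v1 + z 0 1 *: v2 + z 0 2 *: v3.
  rewrite mulmx_sum_row !big_ord_recl big_ord0 addr0 addrA !rowK/=.
  by congr (_ *: _ + _ *: _ + _ *: _); congr (_ 0 _); apply: val_inj.
have Bu : B \in unitmx.
  rewrite -row_free_unit -kermx_eq0; apply/rowV0P => z /sub_kermxP.
  rewrite BE => /indep[z0 z1 z2]; apply/rowP => i; rewrite [RHS]mxE.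
  by case: (ord3P i) => ->.
by exists ((w *m invmx B) 0 0), ((w *m invmx B) 0 1), ((w *m invmx B) 0 2); rewrite -BE mulmxKV.
Qed.

Lemma kernel32 (l1 l2 : 'rV[R]_3) : exists2 v : 'rV[R]_3, v != 0 & dot l1 v = 0 /\ dot l2 v = 0.
Proof.
pose M : 'M[R]_(3, 2) := \matrix_(i < 3, j < 2) [:: l1 0 i; l2 0 i]`_j.
have : kermx M != 0.
  rewrite kermx_eq0 /row_free; apply: contraTN isT => /eqP r3.
  by have := rank_leq_col M; rewrite r3.
move=> /rowV0Pn[v /sub_kermxP vM v0]; exists v => //.
have H j : (v *m M) 0 j = 0 by rewrite vM mxE.
split; rewrite dotE.
  by rewrite -[RHS](H 0) mxE; apply: eq_bigr => i _; rewrite mxE mulrC.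
by rewrite -[RHS](H 1) mxE; apply: eq_bigr => i _; rewrite mxE mulrC.
Qed.

Lemma orthonormal4_eq0 (e1 e2 e3 e4 d : 'rV[R]_4) :
  [/\ dot e1 e1 = 1, dot e2 e2 = 1, dot e3 e3 = 1 & dot e4 e4 = 1] ->
  [/\ dot e1 e2 = 0, dot e1 e3 = 0 & dot e1 e4 = 0] ->
  [/\ dot e2 e3 = 0, dot e2 e4 = 0 & dot e3 e4 = 0] ->
  [/\ dot e1 d = 0, dot e2 d = 0, dot e3 d = 0 & dot e4 d = 0] -> d = 0.
Proof.
move=> [h11 h22 h33 h44] [h12 h13 h14] [h23 h24 h34] [d1 d2 d3 d4].
pose s := [:: e1; e2; e3; e4].
pose E : 'M[R]_4 := \matrix_(i < 4) s`_i.
have ord4 (i : 'I_4) : [\/ i = 0, i = 1, i = 2 | i = 3].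
  by case: i => [[|[|[|[|//]]]] ?]; [apply: Or41|apply: Or42|apply: Or43|apply: Or44]; exact: val_inj.
have dots (i j : 'I_4) : dot s`_i s`_j = (i == j)%:R.
  by case: (ord4 i) => ->; case: (ord4 j) => ->; rewrite /= ?h11 ?h22 ?h33 ?h44 // dotC.
have EE : E *m E^T = 1%:M.
  apply/matrixP => i j; rewrite !mxE -dots dotE; apply: eq_bigr => k _.
  by rewrite !mxE.
have dE : d *m E^T = 0.
  apply/rowP => i; rewrite !mxE.
  transitivity (dot s`_i d).
    by rewrite dotE; apply: eq_bigr => k _; rewrite !mxE mulrC.
  by case: (ord4 i) => ->.
by rewrite -(mulmx1 d) -(mulmx1C EE) mulmxA dE mul0mx.
Qed.

End vec3.

(** V is a ball in the coordinate space, so that coordinate slices through its centre and segments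
    stay inside it. The last clause is dphi o dPhi = id: it turns a direction v with dPhi v = e_i
    into the i-th partial derivative of h o phi. *)
Lemma local_coordinates (R : realType) n (U : set 'rV[R]_n)
    (Phi : 'rV[R]_n -> 'rV[R]_n) q0 :
  open U -> U q0 -> smooth_on U Phi -> (forall v, 'D_v Phi q0 = 0 -> v = 0) ->
  exists (d : R) (phi : 'rV[R]_n -> 'rV[R]_n),
  let V := [set z | `|z - Phi q0| < d] in
  [/\ 0 < d /\ phi (Phi q0) = q0, chart_change U V phi,
      forall z, V z -> U (phi z) /\ Phi (phi z) = z &
      forall z, V z -> forall v, 'D_('D_v Phi (phi z)) phi z = v].
Proof.
move=> oU Uq0 sPhi inj.
have [V' [phi [[oV' Vq0] phi0 Vphi sphi ophi]]] := inverse_function oU Uq0 sPhi inj.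
have [d d0 Hd] := open_ballP oV' Vq0.
have VV' z : `|z - Phi q0| < d -> V' z by move=> /Hd; rewrite subrK.
exists d, phi => V; have oV : open V by exact: open_norm_lt.
split=> //.
- split=> //.
  + exists Phi => z /VV' /Vphi[Uz Ez]; split=> //.
    exact: smooth_differentiable sPhi Uz.
  + by apply: smoothS sphi => z /VV'.
  + by move=> W WV oW; apply: ophi => // z /WV /VV'.
- by move=> z /VV' /Vphi.
move=> z Vz v; have [Uz Ez] := Vphi _ (VV' _ Vz).
have dP := smooth_differentiable sPhi Uz.
have dp := smooth_differentiable sphi (VV' _ Vz).
have dp' : differentiable phi (Phi (phi z)) by rewrite Ez.
have D := diff_comp_derive v dP dp'.
have D' : 'D_v (phi \o Phi) (phi z) = 'D_('D_v Phi (phi z)) phi z by rewrite D Ez.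
apply: (etrans (esym D')); apply: (etrans _ (derive_id (phi z) v)).
have oI : open (phi @` V) by apply: ophi => // w /VV'.
apply: near_eq_derive; near=> q.
have [w Vw <-] : (phi @` V) q.
  by near: q; apply: open_nbhs_nbhs; split=> //; exists z.
by rewrite /= (Vphi _ (VV' _ Vw)).2.
Unshelve. all: by end_near. Qed.

Lemma coord_indep (R : realType) n m (h : 'rV[R]_n -> 'rV[R]_m) (z0 : 'rV[R]_n)
    (d : R) i :
  let V := [set z | `|z - z0| < d] in
  (forall z, V z -> differentiable h z) ->
  (forall z, V z -> 'D_(delta_mx 0 i) h z = 0) ->
  forall z (r : R), V z -> V (r *: delta_mx 0 i + z) -> h (r *: delta_mx 0 i + z) = h z.
Proof.
move=> V dh Dh z r Vz Vz'; apply/rowP => j.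
have seg (s : R) : 0 <= s <= 1 -> V (s *: (r *: delta_mx 0 i) + z).
  move=> /andP[s0 s1]; rewrite /V/=.
  have -> : s *: (r *: delta_mx 0 i) + z - z0 = s *: (r *: delta_mx 0 i + z - z0) + (1 - s) *: (z - z0).
    by apply/rowP => k; rewrite !mxE; ring.
  apply: le_lt_trans (ler_normD _ _) _; rewrite !normrZ (ger0_norm s0) ger0_norm ?subr_ge0//.
  have [s00|s00] := eqVneq s 0; first by rewrite s00 mul0r add0r subr0 mul1r.
  have -> : d = s * d + (1 - s) * d by ring.
  apply: ltr_leD; first by rewrite ltr_pM2l// lt_neqAle eq_sym s00.
  by rewrite ler_wpM2l ?subr_ge0// ltW.
have [s s01|s /andP[s0 s1]] := @MVT_line R 'rV[R]_n (fun z => h z 0 j) (r *: delta_mx 0 i) z.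
  by apply: ((differentiable_rV h _).1 (dh _ (seg s s01))).
have Vs := seg s _; rewrite !ltW// in Vs; have {}Vs := Vs isT.
rewrite -(derive_rV _ j (dh _ Vs)) (deriveZv _ _ (dh _ Vs)) Dh// scaler0 mxE.
by move=> /eqP; rewrite subr_eq0 => /eqP.
Qed.

(** * Polar decomposition *)

Lemma dot_linr3 (R : realType) n (w y z m : 'rV[R]_n) a b d :
  dot w (a *: y + b *: z + d *: m) = a * dot w y + b * dot w z + d * dot w m.
Proof. by rewrite !dotDr !dotZr. Qed.

Lemma derive_scale (R : realType) (V : normedModType R) n (h : V -> R)
    (g : V -> 'rV[R]_n) p u : differentiable h p -> differentiable g p ->
  'D_u (fun q => h q *: g q) p = 'D_u h p *: g p + h p *: 'D_u g p.
Proof.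
move=> dh dg; have dhg := differentiable_scale dh dg.
apply/rowP => i; apply: (etrans (derive_rV u i dhg)).
have dgi := (differentiable_rV g p).1 dg i.
have -> : (fun q => (h q *: g q) 0 i) = h * (fun q => g q 0 i).
  by apply/funext => q; rewrite mxE.
apply: (etrans (deriveM (diff_derivable dh) (diff_derivable dgi))).
rewrite -(derive_rV u i dg) !mxE addrC; congr (_ + _).
by rewrite -[LHS]/(_ * _) mulrC.
Qed.

Section flat.
Context {R : realType} {U : set 'rV[R]_3} {f n : 'rV[R]_3 -> 'rV[R]_4} {c : R}.
Hypothesis P : hypersurface_patch U f n.
Hypothesis fn : forall q, U q -> dot (f q) (n q) = c.
Hypothesis pos : forall q, U q -> 0 < dot (f q) (f q) - c ^+ 2.

(** Equals |x^T|, because |f|^2 = |x^T|^2 + c^2 when <f, n> = c. *)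
Definition radius q := Num.sqrt (dot (f q) (f q) - c ^+ 2).
Definition direction q := (radius q)^-1 *: (f q - c *: n q).
Local Notation t := radius.
Local Notation y := direction.

Let oU : open U. Proof. by case: P. Qed.
Let sf : smooth_on U f. Proof. by case: P => _ []. Qed.
Let sn : smooth_on U n. Proof. by case: P => _ []. Qed.
Let df q : U q -> differentiable f q. Proof. exact: smooth_differentiable. Qed.
Let dn q : U q -> differentiable n q. Proof. exact: smooth_differentiable. Qed.
Let nn q : U q -> dot (n q) (n q) = 1. Proof. by case: P => _ _ _ + _; apply. Qed.

Lemma radius_gt0 q : U q -> 0 < t q. Proof. by move=> /pos; rewrite sqrtr_gt0. Qed.

Lemma radius_sqr q : U q -> t q ^+ 2 = dot (f q) (f q) - c ^+ 2.
Proof. by move=> /pos /ltW; exact: sqr_sqrtr. Qed.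

Lemma smooth_radius : smooth_on U t.
Proof.
apply: smooth_sqrt => //; apply: smoothD => //; first exact: smooth_dot.
exact: smooth_cst.
Qed.

Lemma smooth_direction : smooth_on U y.
Proof.
apply: smooth_scale => //.
  by apply: smoothV => // [q /radius_gt0/gt_eqF->//|]; exact: smooth_radius.
by apply: smoothB => //; apply: smooth_scale => //; exact: smooth_cst.
Qed.

Let dt q : U q -> differentiable t q.
Proof. exact: smooth_differentiable smooth_radius. Qed.
Let dy q : U q -> differentiable y q.
Proof. exact: smooth_differentiable smooth_direction. Qed.

Lemma patch_decomp q : U q -> f q = t q *: y q + c *: n q.
Proof.
move=> Uq; rewrite scalerA divff ?scale1r ?subrK//.
by rewrite gt_eqF// radius_gt0.
Qed.

Lemma direction_unit q : U q -> dot (y q) (y q) = 1.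
Proof.
move=> Uq; have t0 := radius_gt0 Uq.
rewrite dotZl dotZr dotBl !dotBr !dotZl !dotZr (dotC (n q) (f q)) fn// nn//.
have -> : dot (f q) (f q) - c * c - (c * c - c * (c * 1)) = t q ^+ 2.
  by rewrite radius_sqr//; ring.
by field; rewrite gt_eqF.
Qed.

Lemma direction_normal q : U q -> dot (y q) (n q) = 0.
Proof. by move=> Uq; rewrite dotZl dotBl dotZl fn// nn// mulr1 subrr mulr0. Qed.

Lemma derive_patch_decomp q u : U q ->
  'D_u f q = 'D_u t q *: y q + t q *: 'D_u y q + c *: 'D_u n q.
Proof.
move=> Uq.
have dty : differentiable (fun q => t q *: y q) q.
  by apply: differentiable_scale; [exact: dt|exact: dy].
have dcn : differentiable (fun q => c *: n q) q.
  by apply: differentiableZ; exact: dn.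
have -> : 'D_u f q = 'D_u (fun q => t q *: y q + c *: n q) q.
  apply: near_eq_derive; near=> z; apply: patch_decomp.
  by near: z; exact: open_nbhs_nbhs.
apply: (etrans (deriveD (diff_derivable dty) (diff_derivable dcn))).
congr (_ + _); last exact: (deriveZ _ (diff_derivable (dn Uq))).
exact: (derive_scale u (dt Uq) (dy Uq)).
Unshelve. all: by end_near. Qed.

Lemma derive_direction_unit q u : U q -> dot ('D_u y q) (y q) = 0.
Proof.
move=> Uq; have := eq_cst_derive0 u oU Uq direction_unit.
by rewrite (derive_dot u (dy Uq) (dy Uq)) (dotC (y q)) => /eqP; rewrite -mulr2n mulrn_eq0 => /eqP.
Qed.

(** Take v with D_v f = y. Then t v represents x^T, a null direction of dn, so D_v n = 0 and y =
    (D_v t) y + t D_v y. The last term is orthogonal to y, which separates D_v t = 1 from D_v y =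
    0. *)
Lemma radial_field q : U q -> exists v, [/\ 'D_v f q = y q, 'D_v n q = 0,
  'D_v t q = 1 & 'D_v y q = 0].
Proof.
move=> Uq; have t0 : t q != 0 by rewrite gt_eqF// radius_gt0.
have [v vy] := patch_tangent P Uq (direction_normal Uq).
have nv : 'D_v n q = 0.
  have : 'D_(t q *: v) n q = 0.
    apply: (patch_kernel P Uq) => [u|].
      exact: (eq_cst_derive0 u oU Uq fn).
    by rewrite (deriveZv _ _ (df Uq)) vy scalerA divff// scale1r fn.
  rewrite (deriveZv _ _ (dn Uq)) => /eqP.
  by rewrite scaler_eq0 (negPf t0) => /eqP.
have E := derive_patch_decomp v Uq.
rewrite vy nv in E.
have tv : 'D_v t q = 1.
  have := congr1 (dot (y q)) E; rewrite (direction_unit Uq).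
  rewrite (dot_linr3 (y q) (y q) ('D_v y q) 0) dot0r mulr0 addr0 (direction_unit Uq).
  by rewrite (dotC (y q)) (derive_direction_unit v Uq) mulr0 addr0 mulr1.
exists v; split=> //; rewrite tv scale1r scaler0 addr0 in E.
have : t q *: 'D_v y q = 0 by apply: (addrI (y q)); rewrite -E addr0.
by move/eqP; rewrite scaler_eq0 (negPf t0) => /eqP.
Qed.

Lemma derive_normal_direction q u : U q -> dot ('D_u n q) (y q) = 0.
Proof.
move=> Uq; have [v [vy nv _ _]] := radial_field Uq.
by rewrite -vy (patch_sym P _ _ Uq) nv dot0l.
Qed.

Lemma derive_direction_normal q u : U q -> dot (n q) ('D_u y q) = 0.
Proof.
move=> Uq; have := eq_cst_derive0 u oU Uq direction_normal.
rewrite (derive_dot u (dy Uq) (dn Uq)) (dotC (y q)) derive_normal_direction// addr0.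
by rewrite dotC.
Qed.

(** Insert D_w f = (D_w t) y + t D_w y + c D_w n in the symmetry of the second fundamental form: the
    first term is killed by dn being orthogonal to y, the last is symmetric, and t divides out. *)
Lemma derive_normal_direction_sym q u w : U q ->
  dot ('D_u n q) ('D_w y q) = dot ('D_w n q) ('D_u y q).
Proof.
move=> Uq; have t0 : t q != 0 by rewrite gt_eqF// radius_gt0.
have E a b : dot ('D_a n q) ('D_b f q) = t q * dot ('D_a n q) ('D_b y q) + c * dot ('D_a n q) ('D_b n q).
  rewrite (derive_patch_decomp b Uq); apply: etrans (dot_linr3 _ _ _ _ _ _ _) _.
  by rewrite (derive_normal_direction a Uq) mulr0 add0r.
have S := etrans (esym (E u w)) (etrans (patch_sym P u w Uq) (E w u)).
apply: (mulfI t0); apply: (addIr (c * dot ('D_u n q) ('D_w n q))).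
exact: (etrans S (congr1 (fun z => t q * dot ('D_w n q) ('D_u y q) + c * z) (dotC _ _))).
Qed.

End flat.
Arguments radius {R} f c q.
Arguments direction {R} f n c q.

(** * Rank two *)

Lemma derive_coord (R : realType) n (q u : 'rV[R]_n) i :
  'D_u (fun z : 'rV[R]_n => z 0 i) q = u 0 i.
Proof. by rewrite -(derive_rV (f := id)) ?derive_id. Qed.

Lemma derive_dotl (R : realType) (V : normedModType R) n (g : V -> 'rV[R]_n) q u a :
  differentiable g q -> 'D_u (fun q => dot (g q) a) q = dot ('D_u g q) a.
Proof.
move=> dg; apply: (etrans (derive_dot u dg (differentiable_cst a q))).
by rewrite derive_cst dot0r addr0.
Qed.

Lemma vec3_100 (R : realType) : vec3 1 0 0 = delta_mx 0 0 :> 'rV[R]_3.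
Proof. by apply/rowP => i; rewrite !mxE; case: (ord3P i) => ->. Qed.

Lemma vec3_line0 (R : realType) (a a' b c : R) :
  vec3 a b c = (a - a') *: delta_mx 0 0 + vec3 a' b c.
Proof.
apply/rowP => i; rewrite !mxE.
by case: (ord3P i) => -> /=; rewrite ?mulr1 ?mulr0 ?subrK ?add0r.
Qed.

Lemma vec3_line1 (R : realType) (a b b' c : R) :
  vec3 a b c = (b - b') *: delta_mx 0 1 + vec3 a b' c.
Proof.
apply/rowP => i; rewrite !mxE.
by case: (ord3P i) => -> /=; rewrite ?mulr1 ?mulr0 ?subrK ?add0r.
Qed.

(* The data of a parametrized piece f = t y + c n, y being the direction of its
   tangential part; the last clause says that f is an immersion. *)
Definition polar_patch (R : realType) (U : set 'rV[R]_3) (t : 'rV[R]_3 -> R)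
    (y n : 'rV[R]_3 -> 'rV[R]_4) (c : R) : Prop :=
  [/\ open U /\ [/\ smooth_on U t, smooth_on U y & smooth_on U n],
      forall q, U q -> exists v, [/\ 'D_v t q = 1, 'D_v y q = 0 & 'D_v n q = 0],
      forall q, U q -> [/\ dot (y q) (y q) = 1, dot (n q) (n q) = 1 & dot (n q) (y q) = 0],
      forall q, U q -> forall u, dot (n q) ('D_u y q) = 0 /\
        forall w, dot ('D_u n q) ('D_w y q) = dot ('D_w n q) ('D_u y q) &
      forall q, U q -> forall u, 'D_u t q = 0 -> 'D_u y q = 0 -> c *: 'D_u n q = 0 -> u = 0].

Section polar.
Context {R : realType} {U : set 'rV[R]_3} {t : 'rV[R]_3 -> R}
  {y n : 'rV[R]_3 -> 'rV[R]_4} {c : R}.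
Hypothesis P : polar_patch U t y n c.

Let oU : open U. Proof. by case: P => -[]. Qed.
Let st : smooth_on U t. Proof. by case: P => -[_ []]. Qed.
Let sy : smooth_on U y. Proof. by case: P => -[_ []]. Qed.
Let sn : smooth_on U n. Proof. by case: P => -[_ []]. Qed.
Let dt q : U q -> differentiable t q. Proof. exact: smooth_differentiable. Qed.
Let dy q : U q -> differentiable y q. Proof. exact: smooth_differentiable. Qed.
Let dn q : U q -> differentiable n q. Proof. exact: smooth_differentiable. Qed.
Let radial q : U q -> exists v, [/\ 'D_v t q = 1, 'D_v y q = 0 & 'D_v n q = 0].
Proof. by case: P => _ + _ _ _; apply. Qed.
Let unit q : U q -> [/\ dot (y q) (y q) = 1, dot (n q) (n q) = 1 & dot (n q) (y q) = 0].
Proof. by case: P => _ _ + _ _; apply. Qed.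
Let nDy q u : U q -> dot (n q) ('D_u y q) = 0.
Proof. by move=> Uq; case: P => _ _ _ + _ => /(_ _ Uq u)[]. Qed.
Let sym q u w : U q -> dot ('D_u n q) ('D_w y q) = dot ('D_w n q) ('D_u y q).
Proof. by move=> Uq; case: P => _ _ _ + _ => /(_ _ Uq u)[_]; apply. Qed.
Let immersed q u : U q -> 'D_u t q = 0 -> 'D_u y q = 0 -> c *: 'D_u n q = 0 -> u = 0.
Proof. by case: P => _ _ _ _ + Uq; apply. Qed.

Let smooth_comp_dot (h : 'rV[R]_3 -> 'rV[R]_4) (a : 'rV[R]_4) :
  smooth_on U h -> smooth_on U (fun q => dot (h q) a).
Proof. by move=> sh; apply: smooth_dot => //; exact: smooth_cst. Qed.

Section coordinates.
Variables (h1 h2 : 'rV[R]_3 -> 'rV[R]_4) (a1 a2 : 'rV[R]_4).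
Hypotheses (sh1 : smooth_on U h1) (sh2 : smooth_on U h2).

(** Linear functionals of y or n, against vectors frozen at one point, complete t to a coordinate
    system: y is used twice in rank two, n and y once each in rank one. *)
Definition polar_coord q := vec3 (t q) (dot (h1 q) a1) (dot (h2 q) a2).

Lemma smooth_polar_coord : smooth_on U polar_coord.
Proof. by apply: smooth_vec3 => //; exact: smooth_comp_dot. Qed.

Lemma derive_polar_coord q w : U q ->
  'D_w polar_coord q = vec3 ('D_w t q) (dot ('D_w h1 q) a1) (dot ('D_w h2 q) a2).
Proof.
move=> Uq; have d1 := smooth_differentiable sh1 Uq.
have d2 := smooth_differentiable sh2 Uq.
rewrite -(derive_dotl w a1 d1) -(derive_dotl w a2 d2).
by apply: derive_vec3; [exact: dt|exact: differentiable_dot..].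
Qed.

Lemma polar_coord_eq0 q w : U q -> 'D_w polar_coord q = 0 ->
  [/\ 'D_w t q = 0, dot ('D_w h1 q) a1 = 0 & dot ('D_w h2 q) a2 = 0].
Proof.
move=> Uq; rewrite (derive_polar_coord w Uq) (_ : 0 = vec3 0 0 0); first exact: vec3_inj.
by rewrite (vec3E 0) !mxE.
Qed.

End coordinates.

Section radial_coord.
Variables (Phi phi : 'rV[R]_3 -> 'rV[R]_3) (z0 : 'rV[R]_3) (d : R).
Let V := [set z | `|z - z0| < d].
Hypotheses (d0 : 0 < d) (Vphi : forall z, V z -> U (phi z) /\ Phi (phi z) = z).
Hypotheses (sphi : smooth_on V phi).
Hypothesis Dphi : forall z, V z -> forall v, 'D_('D_v Phi (phi z)) phi z = v.

Let dphi z : V z -> differentiable phi z. Proof. exact: smooth_differentiable. Qed.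

Lemma coord_derive_eq0 (h : 'rV[R]_3 -> 'rV[R]_4) z v i :
  smooth_on U h -> V z -> 'D_v Phi (phi z) = delta_mx 0 i -> 'D_v h (phi z) = 0 ->
  'D_(delta_mx 0 i) (h \o phi) z = 0.
Proof.
move=> sh Vz Phiv hv; have [Uz _] := Vphi Vz.
apply: (etrans (diff_comp_derive _ (dphi Vz) (smooth_differentiable sh Uz))).
by rewrite -Phiv (Dphi Vz v).
Qed.

Let z00 := z0 0 0.

Lemma ball_slice z : V z -> V (vec3 z00 (z 0 1) (z 0 2)).
Proof.
by rewrite /V /= norm3_lt// norm3_lt// !mxE/= => /and3P[_ -> ->]; rewrite subrr normr0 d0.
Qed.

Lemma radial_indep (h : 'rV[R]_3 -> 'rV[R]_4) z : smooth_on U h ->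
  (forall z, V z -> exists2 v, 'D_v Phi (phi z) = delta_mx 0 0 & 'D_v h (phi z) = 0) ->
  V z -> h (phi z) = h (phi (vec3 z00 (z 0 1) (z 0 2))).
Proof.
move=> sh Hv Vz; have Vj := ball_slice Vz.
have zE : z = (z 0 0 - z00) *: delta_mx 0 0 + vec3 z00 (z 0 1) (z 0 2).
  by rewrite {1}(vec3E z) (vec3_line0 _ z00).
have dh w : V w -> differentiable (h \o phi) w.
  move=> Vw; apply: differentiable_comp; first exact: dphi.
  by apply: (smooth_differentiable sh); have [] := Vphi Vw.
have Dh w : V w -> 'D_(delta_mx 0 0) (h \o phi) w = 0.
  by move=> Vw; have [v v1 v2] := Hv w Vw; exact: (coord_derive_eq0 sh Vw v1 v2).
have := @coord_indep R 3 4 (h \o phi) z0 d 0 dh Dh _ (z 0 0 - z00) Vj.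
by rewrite -zE => /(_ Vz).
Qed.

End radial_coord.

(** With a and b two independent derivatives of y at q2, the functions t, <y, a>, <y, b> are
    coordinates near q2. The radial field is the first coordinate field, so y and n depend on the
    other two coordinates only and are read off on a slice. *)
Lemma surface_case q2 u1 u2 : U q2 ->
  (forall a b, a *: 'D_u1 y q2 + b *: 'D_u2 y q2 = 0 -> a = 0 /\ b = 0) ->
  exists V phi, [/\ chart_change U V phi, (phi @` V) q2 &
    surface_type V (fun z => t (phi z) *: y (phi z) + c *: n (phi z))].
Proof.
move=> Uq2; have [a aE] : exists a, a = 'D_u1 y q2 by exists ('D_u1 y q2).
have [b bE] : exists b, b = 'D_u2 y q2 by exists ('D_u2 y q2).
rewrite -aE -bE => indep.
pose Phi := polar_coord y y a b.
have sPhi : smooth_on U Phi by exact: smooth_polar_coord.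
have inj w : 'D_w Phi q2 = 0 -> w = 0.
  move=> /(polar_coord_eq0 sy sy Uq2)[w0 wa wb].
  have [v [vt vy _]] := radial Uq2.
  have Dy k l m : 'D_(k *: v + l *: u1 + m *: u2) y q2 = l *: a + m *: b.
    have d2 := dy Uq2.
    rewrite (deriveDv _ _ d2) (deriveDv _ _ d2) (deriveZv k v d2) (deriveZv l u1 d2) (deriveZv m u2 d2).
    by rewrite vy scaler0 add0r aE bE.
  have [k [l [m wE]]] : exists k l m, w = k *: v + l *: u1 + m *: u2.
    apply: basis3 => k l m E.
    have [l0 m0] : l = 0 /\ m = 0 by apply: indep; rewrite -(Dy k) E derive0.
    split=> //; apply/eqP; move: E; rewrite l0 m0 !scale0r !addr0 => /eqP.
    rewrite scaler_eq0 => /orP[//|/eqP v0].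
    by move: vt; rewrite v0 derive0 => /eqP; rewrite eq_sym oner_eq0.
  have wy : 'D_w y q2 = l *: a + m *: b by rewrite wE Dy.
  (* D_w y lies in the span of a and b and is orthogonal to both, hence vanishes. *)
  have [l0 m0] : l = 0 /\ m = 0.
    apply: indep; rewrite -wy; apply/eqP; rewrite -dot_eq0 {2}wy dotDr !dotZr wa wb.
    by rewrite !mulr0 addr0.
  move: w0; rewrite wE l0 m0 !scale0r !addr0 (deriveZv k v (dt Uq2)) vt.
  by move=> /(etrans (esym (mulr1 k))) ->; rewrite scale0r.
have [d [phi [[d0 phi0] cphi Vphi Dphi]]] := local_coordinates oU Uq2 sPhi inj.
move: phi0 cphi Vphi Dphi; move: (Phi q2) => z0 phi0 cphi Vphi Dphi.
have [oV _ sphi _] := cphi.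
set V := [set z | `|z - z0| < d] in cphi Vphi Dphi oV sphi.
have rad z : V z -> exists v, [/\ 'D_v Phi (phi z) = delta_mx 0 0, 'D_v y (phi z) = 0 & 'D_v n (phi z) = 0].
  move=> /Vphi[Uz _]; have [v [vt vy vn]] := radial Uz; exists v; split=> //.
  by rewrite derive_polar_coord// vt vy !dot0l vec3_100.
have indy z : V z -> y (phi z) = y (phi (vec3 (z0 0 0) (z 0 1) (z 0 2))).
  apply: (radial_indep d0 Vphi sphi Dphi sy) => w /rad[v [v1 v2 v3]].
  by exists v.
have indn z : V z -> n (phi z) = n (phi (vec3 (z0 0 0) (z 0 1) (z 0 2))).
  apply: (radial_indep d0 Vphi sphi Dphi sn) => w /rad[v [v1 v2 v3]].
  by exists v.
pose j (w : 'rV[R]_2) := vec3 (z0 0 0) (w 0 0) (w 0 1).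
pose w0 := vec2 (z0 0 1) (z0 0 2).
pose Om := [set w : 'rV[R]_2 | `|w - w0| < d].
have oOm : open Om by exact: open_norm_lt.
have jV w : Om w -> V (j w).
  rewrite /Om /V /= norm2_lt// norm3_lt// !mxE/= => /andP[-> ->].
  by rewrite subrr normr0 d0.
have sj : smooth_on Om j.
  by apply: smooth_vec3 => //; [exact: smooth_cst|exact: smooth_coord..].
have spj : smooth_on Om (fun w => phi (j w)) by exact: smooth_comp oOm oV jV sj sphi.
have Uj w : Om w -> U (phi (j w)) by move=> /jV /Vphi[].
pose Y w := y (phi (j w)); pose Nn w := n (phi (j w)).
have sY : smooth_on Om Y by exact: smooth_comp oOm oU Uj spj sy.
have sNn : smooth_on Om Nn by exact: smooth_comp oOm oU Uj spj sn.
(* The parameters of Y are its products with a and b; differentiating these identities makes Y an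
   immersion. *)
have YE w : Om w -> [/\ dot (Y w) a = w 0 0 & dot (Y w) b = w 0 1].
  by move=> Ow; have [_ /vec3_inj[]] := Vphi _ (jV w Ow).
have NY w u : Om w -> dot (Nn w) ('D_u Y w) = 0.
  move=> Ow; have Uw := Uj w Ow.
  have E := diff_comp_derive u (smooth_differentiable spj Ow) (dy Uw).
  exact: (etrans (congr1 (dot _) E) (nDy _ Uw)).
exists V, phi; split=> //.
  by exists z0 => //; rewrite /V/= subrr normr0.
exists Om, Y, Nn, c; split; last first.
  move=> q Vq /=; split.
    by move: Vq; rewrite /Om /V /= norm2_lt// norm3_lt// !mxE/= => /and3P[_ -> ->].
  have [Uq] := Vphi q Vq; rewrite {2}(vec3E q) => /vec3_inj[-> _ _].
  rewrite (indy q Vq) (indn q Vq).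
  by rewrite /Y /Nn /j !mxE.
split=> //.
- split=> // w Ow; have dYw := smooth_differentiable sY Ow.
  rewrite -kermx_eq0; apply/rowV0P => u /sub_kermxP; rewrite -(deriveEjacobian _ dYw) => u0.
  have E e i : (forall w, Om w -> dot (Y w) e = w 0 i) -> u 0 i = 0.
    move=> He; rewrite -(derive_coord w u i) -(dot0l e) -u0 -(derive_dotl u e dYw).
    apply: near_eq_derive; near=> w'; apply/esym/He.
    by near: w'; exact: open_nbhs_nbhs.
  apply/rowP => i; rewrite [RHS]mxE.
  have [->|->] : i = 0 \/ i = 1.
    by case: i => [[|[|//]] ?]; [left|right]; exact: val_inj.
  + by apply: (E a) => w' /YE[].
  + by apply: (E b) => w' /YE[].
- by move=> w Ow; have [] := unit (Uj w Ow).
move=> w Ow; have [_ nn ny] := unit (Uj w Ow); split=> //; exact: NY.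
Unshelve. all: by end_near. Qed.

End polar.

(** * Rank one *)

(** The radius is halved so that the closed interval of integration lies where h is continuous. *)
Lemma antiderivative (R : realType) (h : R -> R) (r0 d : R) : 0 < d ->
  (forall r, `|r - r0| < d -> {for r, continuous h}) ->
  exists L : R -> R, forall r, `|r - r0| < d / 2 -> is_derive r 1 L (h r).
Proof.
move=> d0 ch; have d20 : 0 < d / 2 by rewrite divr_gt0.
pose a := r0 - d / 2; pose b := r0 + d / 2.
have ih : (@lebesgue_measure R).-integrable `[a, b] (EFin \o h).
  apply: continuous_compact_integrable; first exact: segment_compact.
  apply: continuous_in_subspaceT => r; rewrite inE/= in_itv/= => /andP[ar rb].
  by apply: ch; rewrite ltr_norml; rewrite /a in ar; rewrite /b in rb; apply/andP; split; lra.
exists (fun x => \int[lebesgue_measure]_(t in [set` `[a, x]]) (h t))%R.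
move=> r; rewrite ltr_norml => /andP[r1 r2].
have rb : r < b by rewrite /b; lra.
have ar : a < r by rewrite /a; lra.
have cr : {for r, continuous h} by apply: ch; rewrite ltr_norml; apply/andP; split; lra.
have [dL EL] := continuous_FTC1_closed rb ih ar cr.
split; [exact: dL|exact: etrans (esym (derive1E _ _)) EL].
Qed.

(** The angle of a point on the open right half of the unit circle; a > 0 selects the branch on
    which the arctangent is correct. *)
Lemma cos_sin_atan (R : realType) (a b : R) : 0 < a -> a ^+ 2 + b ^+ 2 = 1 ->
  cos (atan (b / a)) = a /\ sin (atan (b / a)) = b.
Proof.
move=> a0 ab; have an : a != 0 by rewrite gt_eqF.
have ca : cos (atan (b / a)) = a.
  rewrite cos_atan (_ : 1 + (b / a) ^+ 2 = a^-1 ^+ 2).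
    by rewrite sqrtr_sqr ger0_norm ?invrK// invr_ge0 ltW.
  rewrite exprVn; have -> : (a ^+ 2)^-1 = (a ^+ 2 + b ^+ 2) / a ^+ 2.
      by rewrite ab mul1r.
    by field.
split=> //; have := atanK (b / a); rewrite /tan ca.
by move=> /(congr1 ( *%R^~ a)); rewrite !divfK.
Qed.

Lemma derive_compR (R : realType) (V : normedModType R) (h : R -> R) (g : V -> R) l q u :
  differentiable g q -> is_derive (g q) 1 h l ->
  differentiable (h \o g) q /\ 'D_u (h \o g) q = 'D_u g q * l.
Proof.
move=> dg [dh El]; have dh' : differentiable h (g q) by exact/derivable1_diffP.
split; first exact: differentiable_comp.
apply: (etrans (diff_comp_derive u dg dh')).
have E : 'D_u g q = 'D_u g q *: (1 : R^o) by rewrite -[LHS]mulr1.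
rewrite {1}E -El; exact: (deriveZv ('D_u g q) (1 : R^o) dh').
Qed.

Lemma derive_gt0_inj (R : realType) (L l : R -> R) (r0 e : R) :
  (forall r, `|r - r0| < e -> is_derive r 1 L (l r) /\ 0 < l r) ->
  forall r s, `|r - r0| < e -> `|s - r0| < e -> L r = L s -> r = s.
Proof.
move=> LP; suff H r s : `|r - r0| < e -> `|s - r0| < e -> r < s -> L r != L s.
  move=> r s re se Lrs; have [rs|sr|//] := ltgtP r s.
    by have := H _ _ re se rs; rewrite Lrs eqxx.
  by have := H _ _ se re sr; rewrite Lrs eqxx.
rewrite !ltr_norml => /andP[r1 r2] /andP[s1 s2] rs.
have P t : r <= t <= s -> is_derive t 1 L (l t) /\ 0 < l t.
  by move=> /andP[rt ts]; apply: LP; rewrite ltr_norml; apply/andP; split; lra.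
have [||t] := @MVT R L l r s rs.
- by move=> t; rewrite in_itv/= => /andP[rt ts]; apply: (P t _).1; rewrite !ltW.
- apply: derivable_within_continuous => t; rewrite in_itv/= => /P[[dt _] _].
  exact: dt.
rewrite in_itv/= => /andP[rt ts] E.
have [_ lt0] : is_derive t 1 L (l t) /\ 0 < l t by apply: P; rewrite !ltW.
by rewrite eq_sym -subr_eq0 E mulf_neq0// ?gt_eqF// subr_gt0.
Qed.

Lemma open_gt0 (R : realType) (V : normedModType R) (U : set V) (h : V -> R) :
  open U -> (forall q, U q -> differentiable h q) -> open [set q | U q /\ 0 < h q].
Proof.
move=> oU dh; rewrite openE => q [Uq hq].
near=> w; split; near: w; first exact: open_nbhs_nbhs.
exact: (cvgr_gt _ (differentiable_continuous (dh q Uq))).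
Unshelve. all: by end_near. Qed.

(** Once h is normalized, g, h, m, b form an orthonormal basis of the 4-space, and v has no
    component on the first two. *)
Lemma normal_plane (R : realType) (g h m b v : 'rV[R]_4) :
  [/\ dot g g = 1, dot m m = 1, dot b b = 1 & dot v v = 1] -> h != 0 ->
  [/\ dot g h = 0, dot g m = 0 & dot g b = 0] ->
  [/\ dot h m = 0, dot h b = 0 & dot m b = 0] ->
  dot g v = 0 -> dot h v = 0 ->
  v = dot v m *: m + dot v b *: b /\ dot v m ^+ 2 + dot v b ^+ 2 = 1.
Proof.
move=> [gg mm bb vv] h0 [gh gm gb] [hm hb mb] gv hv.
have bm : dot b m = 0 by rewrite dotC.
have [l l0 l2] : exists2 l : R, l != 0 & l ^+ 2 = dot h h.
  have hh : 0 < dot h h by rewrite dot_gt0.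
  by exists (Num.sqrt (dot h h)); rewrite ?gt_eqF ?sqrtr_gt0// sqr_sqrtr// ltW.
have vE : v = dot v m *: m + dot v b *: b.
  apply/eqP; rewrite -subr_eq0; apply/eqP.
  apply: (@orthonormal4_eq0 R g (l^-1 *: h) m b).
  - split=> //; rewrite (dotZl l^-1) (dotZr l^-1) -l2; by field.
  - by split=> //; rewrite (dotZr l^-1) gh mulr0.
  - by split=> //; rewrite (dotZl l^-1) ?hm ?hb mulr0.
  by split; rewrite ?(dotZl l^-1) !(dotBr, dotDr, dotZr) ?gv ?gm ?gb ?hv ?hm ?hb
    ?mm ?mb ?bm ?bb ?(dotC m v) ?(dotC b v); ring.
split=> //; rewrite -[RHS]vv; apply/esym/(etrans (congr1 (dot v) vE)).
by rewrite dotDr !dotZr; ring.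
Qed.

Lemma smooth_compR (R : realType) (V : normedModType R) n (U : set V) (f : V -> 'rV[R]_n)
    (U' : set 'rV[R]_n) (g : 'rV[R]_n -> R) :
  open U -> (forall p, U p -> U' (f p)) -> smooth_on U f ->
  smooth_on U' g -> smooth_on U (fun q => g (f q)).
Proof.
move=> oU UU' /smooth_onP sf /smooth_onP sg; apply/smooth_onP => k.
exact: (Ck_comp oU UU' (sf k) (sg k)).
Qed.

(** * Type (iii) in coordinates where the spherical curve G depends on the last variable only *)

Section curve.
Context {R : realType}.
Variables (z1 : 'rV[R]_3) (d : R) (G nu : 'rV[R]_3 -> 'rV[R]_4) (a : 'rV[R]_4) (c : R).
Let V := [set z | `|z - z1| < d].
Let s1 := z1 0 0.
Let b1 := z1 0 1.
Let r1 := z1 0 2.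
Hypotheses (d0 : 0 < d) (c0 : c != 0) (sG : smooth_on V G) (snu : smooth_on V nu).
Hypothesis G_indep : forall z, V z -> G z = G (vec3 s1 b1 (z 0 2)).
Hypothesis frame : forall z, V z -> [/\ dot (G z) (G z) = 1, dot (nu z) (nu z) = 1 &
  dot (nu z) (G z) = 0].
Hypothesis nuDG : forall z u, V z -> dot (nu z) ('D_u G z) = 0.
Hypothesis Dnu : forall z, V z -> [/\ 'D_(delta_mx 0 1) nu z != 0,
  dot ('D_(delta_mx 0 1) nu z) (G z) = 0 &
  forall u, dot ('D_(delta_mx 0 1) nu z) ('D_u G z) = 0].
Hypothesis Ga : forall z, V z -> dot (G z) a = z 0 2.

Let oV : open V. Proof. exact: open_norm_lt. Qed.
Let Vz1 : V z1. Proof. by rewrite /V/= subrr normr0. Qed.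
Let dG z : V z -> differentiable G z. Proof. exact: smooth_differentiable. Qed.
Let dnu z : V z -> differentiable nu z. Proof. exact: smooth_differentiable. Qed.

Let e2G_neq0 z : V z -> 'D_(delta_mx 0 2) G z != 0.
Proof.
move=> Vz; have : dot ('D_(delta_mx 0 2) G z) a = 1.
  rewrite -(derive_dotl (delta_mx 0 2) a (dG Vz)).
  transitivity ('D_(delta_mx 0 2) (fun z : 'rV[R]_3 => z 0 2) z); last first.
    by rewrite derive_coord mxE !eqxx.
  apply: near_eq_derive; near=> w; apply: Ga.
  by near: w; exact: open_nbhs_nbhs.
by apply: contra_eq_neq => ->; rewrite dot0l eq_sym oner_neq0.
Unshelve. all: by end_near. Qed.

Let unit_derive (h : 'rV[R]_3 -> 'rV[R]_4) z u : smooth_on V h -> V z ->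
  (forall w, V w -> dot (h w) (h w) = 1) -> dot (h z) ('D_u h z) = 0.
Proof.
move=> sh Vz hh; have dh := smooth_differentiable sh Vz.
have := eq_cst_derive0 u oV Vz hh.
rewrite (derive_dot u dh dh) dotC -mulr2n => /eqP.
by rewrite mulrn_eq0 => /eqP.
Qed.

(** Bn is D_1 nu normalized. By [Dnu] and |nu| = 1 it is orthogonal to nu, to G and to the velocity
    of G, so nu and Bn frame the normal plane of the curve in the 3-sphere. *)
Let binormal : exists2 Bn : 'rV[R]_3 -> 'rV[R]_4, smooth_on V Bn & forall z, V z ->
  [/\ dot (Bn z) (Bn z) = 1, dot (nu z) (Bn z) = 0, dot (Bn z) (G z) = 0,
      dot (Bn z) ('D_(delta_mx 0 2) G z) = 0 &
      0 < dot ('D_(delta_mx 0 1) nu z) (Bn z)].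
Proof.
have [h hE] : exists h, h = fun z => 'D_(delta_mx 0 1) nu z by eexists.
have sh : smooth_on V h by rewrite hE; exact: smooth_derive.
have hP z : V z -> [/\ 0 < dot (h z) (h z), dot (nu z) (h z) = 0, dot (h z) (G z) = 0 &
    dot (h z) ('D_(delta_mx 0 2) G z) = 0].
  move=> Vz; have [n1 n2 n3] := Dnu Vz; rewrite hE; split=> //; first by rewrite dot_gt0.
  by apply: unit_derive => // w /frame[].
have [b bE] : exists b, b = fun z => (Num.sqrt (dot (h z) (h z)))^-1 by eexists.
have sb : smooth_on V b.
  rewrite bE; apply: smoothV => // [z /hP[h0 _ _ _]|].
    by rewrite gt_eqF ?sqrtr_gt0.
  by apply: smooth_sqrt => // [z /hP[]|] //; exact: smooth_dot.
have bP z : V z -> 0 < b z /\ b z ^+ 2 * dot (h z) (h z) = 1.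
  move=> /hP[h0 _ _ _]; rewrite bE; split; first by rewrite invr_gt0 sqrtr_gt0.
  by rewrite exprVn sqr_sqrtr ?ltW// mulVf// gt_eqF.
have E z : 'D_(delta_mx 0 1) nu z = h z by rewrite hE.
exists (fun z => b z *: h z); first exact: smooth_scale.
move=> z Vz; have [h0 h1 h2 h3] := hP z Vz; have [b0 b2] := bP z Vz.
rewrite E !(dotZr (b z)) !(dotZl (b z)) h1 h2 h3 !mulr0; split=> //.
  by rewrite mulrA -expr2.
exact: mulr_gt0.
Qed.

Let speed : exists2 ell : 'rV[R]_3 -> R, smooth_on V ell & forall z, V z ->
  0 < ell z /\ ell z ^+ 2 = dot ('D_(delta_mx 0 2) G z) ('D_(delta_mx 0 2) G z).
Proof.
have [h hE] : exists h, h = fun z => 'D_(delta_mx 0 2) G z by eexists.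
have sh : smooth_on V h by rewrite hE; exact: smooth_derive.
have h0 z : V z -> 0 < dot (h z) (h z) by move=> Vz; rewrite hE dot_gt0 e2G_neq0.
have E z : 'D_(delta_mx 0 2) G z = h z by rewrite hE.
exists (fun z => Num.sqrt (dot (h z) (h z))).
  by apply: smooth_sqrt => //; exact: smooth_dot.
by move=> z /h0 hz; rewrite E sqrtr_gt0 sqr_sqrtr// ltW.
Qed.

(** The coordinate line through z1 along which the curve and its frame are read. *)
Let K (r : R) := vec3 s1 b1 r.
Let VK r : `|r - r1| < d -> V (K r).
Proof. by move=> rd; rewrite /V /= norm3_lt// !mxE/= !subrr !normr0 d0. Qed.
Let V2 z : V z -> `|z 0 2 - r1| < d.
Proof. by rewrite /V /= norm3_lt// !mxE/= => /and3P[]. Qed.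
Let VKc z : V z -> V (K (z 0 2)). Proof. by move=> /V2/VK. Qed.

Let sK (W : normedModType R) (U : set W) (r : W -> R) : open U -> smooth_on U r ->
  smooth_on U (fun z => K (r z)).
Proof. by move=> oU sr; apply: smooth_vec3 => //; exact: smooth_cst. Qed.

Let derive_K (W : normedModType R) (h : 'rV[R]_3 -> 'rV[R]_4) (r : W -> R) z u :
  smooth_on V h -> differentiable r z -> `|r z - r1| < d ->
  'D_u (fun z => h (K (r z))) z = 'D_u r z *: 'D_(delta_mx 0 2) h (K (r z)).
Proof.
move=> sh dr rd.
have dK : differentiable (fun z => K (r z)) z.
  apply/differentiable_rV => i; rewrite (_ : (fun q => _) = [:: cst s1; cst b1; r]`_i).
    by case: (ord3P i) => -> //=; exact: differentiable_cst.
  by apply/funext => w; rewrite !mxE; case: (ord3P i) => ->.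
have dh := smooth_differentiable sh (VK rd).
apply: (etrans (diff_comp_derive u dK dh)).
rewrite -(deriveZv ('D_u r z) (delta_mx 0 2) dh); apply: (congr1 (fun w => 'D_w h _)).
apply: (etrans (derive_vec3 u _ _ _)) => //.
rewrite !derive_cst.
by apply/rowP => i; rewrite !mxE; case: (ord3P i) => -> /=; rewrite ?mulr0 ?mulr1.
Qed.

Let DGK z : V z -> 'D_(delta_mx 0 2) G (K (z 0 2)) = 'D_(delta_mx 0 2) G z.
Proof.
move=> Vz; rewrite -[LHS]scale1r.
have <- : 'D_(delta_mx 0 2) (fun w : 'rV[R]_3 => w 0 2) z = 1.
  by rewrite derive_coord mxE !eqxx.
rewrite -(derive_K _ sG); [|exact: differentiable_coord|exact: V2].
apply: near_eq_derive; near=> w; apply/esym/G_indep.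
by near: w; exact: open_nbhs_nbhs.
Unshelve. all: by end_near. Qed.

Section frame.
Variables (Bn : 'rV[R]_3 -> 'rV[R]_4) (ell : 'rV[R]_3 -> R).
Hypotheses (sBn : smooth_on V Bn) (sell : smooth_on V ell).
Hypothesis BnP : forall z, V z ->
  [/\ dot (Bn z) (Bn z) = 1, dot (nu z) (Bn z) = 0, dot (Bn z) (G z) = 0,
      dot (Bn z) ('D_(delta_mx 0 2) G z) = 0 &
      0 < dot ('D_(delta_mx 0 1) nu z) (Bn z)].
Hypothesis ellP : forall z, V z ->
  0 < ell z /\ ell z ^+ 2 = dot ('D_(delta_mx 0 2) G z) ('D_(delta_mx 0 2) G z).

Let p z := dot (nu z) (nu (K (z 0 2))).
Let q z := dot (nu z) (Bn (K (z 0 2))).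

(** As G depends on the last coordinate only, nu at z is also normal to G and its velocity at
    [K (z 0 2)]. It lies on the unit circle of the plane framed there, with coordinates p and q. *)
Let expansion z : V z ->
  nu z = p z *: nu (K (z 0 2)) + q z *: Bn (K (z 0 2)) /\ p z ^+ 2 + q z ^+ 2 = 1.
Proof.
move=> Vz; have Vk := VKc Vz; have [gg nn ng] := frame Vk.
have [bb nb bg bDg _] := BnP Vk; have [_ nn' ng'] := frame Vz.
apply: (normal_plane (g := G (K (z 0 2))) (h := 'D_(delta_mx 0 2) G (K (z 0 2)))).
- by split.
- exact: e2G_neq0.
- split; [|by rewrite dotC..].
  by apply: unit_derive => // w /frame[].
- by split=> //; rewrite dotC// nuDG.
- by rewrite dotC -(G_indep Vz).
- by rewrite dotC (DGK Vz) nuDG.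
Qed.

Let snuK : smooth_on V (fun z => nu (K (z 0 2))).
Proof. exact: smooth_comp oV oV VKc (sK oV (@smooth_coord R 3 V 2)) snu. Qed.
Let sBnK : smooth_on V (fun z => Bn (K (z 0 2))).
Proof. exact: smooth_comp oV oV VKc (sK oV (@smooth_coord R 3 V 2)) sBn. Qed.
Let sp : smooth_on V p. Proof. exact: smooth_dot. Qed.
Let sq : smooth_on V q. Proof. exact: smooth_dot. Qed.

(** The slice does not move with the middle coordinate, so this derivative is <D_1 nu, Bn> at z1. It
    makes the rotation angle of nu a valid coordinate. *)
Let Dq : 0 < 'D_(delta_mx 0 1) q z1.
Proof.
have K1 : K (z1 0 2) = z1 by rewrite [RHS]vec3E.
have -> : 'D_(delta_mx 0 1) q z1 = dot ('D_(delta_mx 0 1) nu z1) (Bn z1).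
  apply: (etrans (derive_dot _ (dnu Vz1) (smooth_differentiable sBnK Vz1))).
  rewrite (derive_K _ sBn) ?derive_coord; [|exact: differentiable_coord|exact: V2].
  by rewrite mxE/= scale0r dot0r addr0 K1.
by have [] := BnP Vz1.
Qed.

Let qp1 : q z1 = 0 /\ p z1 = 1.
Proof.
have K1 : K (z1 0 2) = z1 by rewrite [RHS]vec3E.
by rewrite /p /q K1; have [_ ? _ _ _] := BnP Vz1; have [_ ? _] := frame Vz1.
Qed.

(* The new coordinates are z_0, |c| times the angle by which nu is rotated from
   its value on the slice {z_1 = b1}, and the arc length of the curve G. *)
Lemma curve_frame_case : exists V2 phi, [/\ chart_change V V2 phi, (phi @` V2) z1 &
  curve_type V2 (fun z => phi z 0 0 *: G (phi z) + c *: nu (phi z))].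
Proof.
have Kr1 : z1 = K r1 by rewrite [LHS]vec3E.
pose I0 := [set r : R | `|r - r1| < d].
have oI0 : open I0 by exact: open_norm_lt.
pose el r := ell (K r).
have sel : smooth_on I0 el.
  apply: (smooth_compR oI0 VK) => //; apply: sK => //; exact: smooth_idR.
have [L LP] : exists L : R -> R, forall r, `|r - r1| < d / 2 -> is_derive r 1 L (el r).
  apply: antiderivative => // r rd.
  exact/differentiable_continuous/(smooth_differentiable sel).
have d20 : 0 < d / 2 by rewrite divr_gt0.
have dd r : `|r - r1| < d / 2 -> `|r - r1| < d by move=> /lt_trans; apply; rewrite ltr_pdivrMr// ltr_pMr// ltr1n.
have el0 r : `|r - r1| < d / 2 -> 0 < el r by move=> /dd/VK/ellP[].
have Linj := derive_gt0_inj (fun r rd => conj (LP r rd) (el0 r rd)).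
pose Vh := [set z | `|z - z1| < d / 2].
have oVh : open Vh by exact: open_norm_lt.
have VhV z : Vh z -> V z.
  by rewrite /V /Vh /= => /lt_trans; apply; rewrite ltr_pdivrMr// ltr_pMr// ltr1n.
have Vh2 z : Vh z -> `|z 0 2 - r1| < d / 2.
  by rewrite /Vh /= norm3_lt// !mxE/= => /and3P[].
(* Where p > 0 the angle of the point (p, q) is the smooth function atan (q / p); z1 qualifies since
   p = 1 there. *)
pose V1 := [set z | Vh z /\ 0 < p z].
have oV1 : open V1.
  by apply: open_gt0 => // z /VhV Vz; exact: smooth_differentiable sp Vz.
have V1V z : V1 z -> V z by move=> [/VhV].
have [q1 p1] := qp1.
have V1z1 : V1 z1 by split; rewrite ?p1// /Vh/= subrr normr0.
have [th thE] : exists th, th = fun z => atan (q z / p z) by eexists.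
have thP z : V1 z -> cos (th z) = p z /\ sin (th z) = q z.
  by move=> [/VhV Vz pz]; rewrite thE; apply: cos_sin_atan => //; have [] := expansion Vz.
have sth : smooth_on V1 th.
  rewrite thE; apply: smooth_atan => //; apply: smoothM => //; first exact: smoothS V1V sq.
  apply: smoothV => // [z [_ pz]|]; first by rewrite gt_eqF.
  exact: smoothS V1V sp.
have sL : smooth_on V1 (fun z : 'rV[R]_3 => L (z 0 2)).
  apply: (smooth_comp1 (h' := el)) => //; first exact: smooth_coord.
    by move=> z [/Vh2 zd _]; exact: LP.
  apply: (smooth_compR oV1 _ (sK oV1 (@smooth_coord R 3 V1 2)) sell) => z /V1V.
  exact: VKc.
(* The factor |c| makes the angle equal to v / |c| in terms of the new middle coordinate v, as in
   the model. *)
pose Psi (z : 'rV[R]_3) := vec3 (z 0 0) (`|c| * th z) (L (z 0 2)).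
have sPsi : smooth_on V1 Psi.
  apply: smooth_vec3 => //; first exact: smooth_coord.
  by apply: smoothM => //; exact: smooth_cst.
have dth := smooth_differentiable sth V1z1.
have dL1 := smooth_differentiable sL V1z1.
have inj w : 'D_w Psi z1 = 0 -> w = 0.
  have dth' : differentiable (fun z => `|c| * th z) z1.
    by apply: differentiableM => //; exact: differentiable_cst.
  rewrite (derive_vec3 w (@differentiable_coord R 1 3 z1 0 0) dth' dL1) derive_coord.
  have z3 : 0 = vec3 0 0 0 :> 'rV[R]_3 by rewrite (vec3E 0) !mxE.
  move=> E; have {E} [w0 w1 w2] := vec3_inj (etrans E z3).
  have {}w1 : 'D_w th z1 = 0.
    have := etrans (esym (deriveZ `|c| (diff_derivable (v := w) dth))) w1.
    by move=> /eqP; rewrite scaler_eq0 normr_eq0 (negPf c0) => /eqP.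
  have {}w2 : w 0 2 = 0.
    have [_ E] := derive_compR w (@differentiable_coord R 1 3 z1 0 2) (LP r1 (Vh2 _ V1z1.1)).
    have := etrans (esym E) w2.
    have el1 : el r1 != 0 by rewrite gt_eqF// el0// (Vh2 _ V1z1.1).
    by rewrite derive_coord => /eqP; rewrite mulf_eq0 (negPf el1) orbF => /eqP.
  (* Only the middle direction is left. Since q = sin th near z1, a zero derivative of th gives one
     of q, against [Dq]. *)
  have wE : w = w 0 1 *: delta_mx 0 1.
    by apply/rowP => i; rewrite !mxE; case: (ord3P i) => -> /=; rewrite ?mulr1 ?mulr0.
  have [_ E] := derive_compR w dth (is_derive_sin (th z1)).
  have : 'D_w q z1 = 0.
    apply: etrans (etrans E _); last by rewrite w1 mul0r.
    apply: near_eq_derive; near=> z; apply/esym.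
    by apply: (thP z _).2; near: z; exact: open_nbhs_nbhs.
  rewrite {1}wE (deriveZv _ _ (smooth_differentiable sq Vz1)) => /eqP.
  by rewrite scaler_eq0 (gt_eqF Dq) orbF => /eqP w10; rewrite wE w10 scale0r.
have [e [phi [[e0 phi0] cphi Vphi _]]] := local_coordinates oV1 V1z1 sPsi inj.
move: phi0 cphi Vphi; move: (Psi z1) => z2 phi0 cphi Vphi.
have [oV2 _ sphi _] := cphi.
set V2' := [set z | `|z - z2| < e] in cphi Vphi oV2 sphi.
have phiP z : V2' z -> [/\ phi z 0 0 = z 0 0, z 0 1 = `|c| * th (phi z),
    L (phi z 0 2) = z 0 2, V1 (phi z) & `|phi z 0 2 - r1| < d / 2].
  move=> /Vphi[V1z]; rewrite {2}(vec3E z) => /vec3_inj[-> <- ->]; split=> //.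
  by case: V1z => /Vh2.
have cn0 : 0 < `|c| by rewrite normr_gt0.
pose j (w : R) := vec3 (z2 0 0) (z2 0 1) w.
pose I := [set w : R | `|w - z2 0 2| < e].
have oI : open I by exact: open_norm_lt.
have jV w : I w -> V2' (j w).
  by move=> Iw; rewrite /V2' /= norm3_lt// !mxE/= !subrr !normr0 e0.
have V2I z : V2' z -> I (z 0 2).
  by rewrite /V2' /I /= norm3_lt// !mxE/= => /and3P[].
have sj : smooth_on I j.
  by apply: smooth_vec3 => //; [exact: smooth_cst..|exact: smooth_idR].
(* The inverse of the arc length L, obtained from the new chart on a slice. *)
pose rho w := phi (j w) 0 2.
have srho : smooth_on I rho.
  have /(smooth_rV _ oI) := smooth_comp oI oV2 jV sj sphi; exact.
have rhoP w : I w -> `|rho w - r1| < d / 2 /\ L (rho w) = w.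
  by move=> /jV /phiP[_ _ Lw _ wd]; rewrite /rho wd Lw mxE.
(* Injectivity of L makes the old last coordinate a function of the new one alone. *)
have rhoE z : V2' z -> phi z 0 2 = rho (z 0 2).
  move=> Vz; have [r2 Lr] := rhoP _ (V2I z Vz); have [_ _ Lz _ zd] := phiP z Vz.
  by apply: Linj => //; rewrite Lr.
have drho w : I w -> differentiable rho w by exact: smooth_differentiable.
have Drho w : I w -> 'D_1 rho w * el (rho w) = 1.
  move=> Iw; have [rd _] := rhoP w Iw.
  have [_ <-] := derive_compR (1 : R^o) (drho w Iw) (LP _ rd).
  apply: etrans (derive_id (w : R^o) (1 : R^o)); apply: near_eq_derive; near=> w'.
  by apply: (rhoP w' _).2; near: w'; exact: open_nbhs_nbhs.
have VKr w : I w -> V (K (rho w)) by move=> /rhoP[/dd/VK].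
have sKr : smooth_on I (fun w => K (rho w)) by exact: sK.
(* The model constant must be positive: it is |c|, and the sign k of c is absorbed into the frame,
   which stays orthonormal as k^2 = 1. *)
pose k := c / `|c|.
have k2 : k * k = 1.
  by rewrite /k -expr2 expr_div_n -normrX ger0_norm ?sqr_ge0// divff// expf_neq0.
exists V2', phi; split.
- by apply: chart_changeS cphi => z /V1V.
- by exists z2 => //; rewrite /V2'/= subrr normr0.
exists I, (fun w => G (K (rho w))), (fun w => k *: nu (K (rho w))),
  (fun w => k *: Bn (K (rho w))), `|c|; split=> //.
  have Dalpha w : I w -> derive1 (fun w => G (K (rho w))) w =
      'D_1 rho w *: 'D_(delta_mx 0 2) G (K (rho w)).
    move=> Iw; rewrite derive1E; apply: derive_K => //; first exact: drho.
    by have [/dd] := rhoP w Iw.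
  split.
  - split=> // s t; rewrite /I/= !ltr_norml => /andP[u1 u2] /andP[v1 v2] r /andP[sr rt].
    by rewrite ltr_norml; apply/andP; split; lra.
  - split; first exact: smooth_comp oI oV VKr sKr sG.
      by apply: smooth_scale => //; [exact: smooth_cst|exact: smooth_comp oI oV VKr sKr snu].
    by apply: smooth_scale => //; [exact: smooth_cst|exact: smooth_comp oI oV VKr sKr sBn].
  - move=> w Iw; have [gg _ _] := frame (VKr w Iw); split=> //.
    rewrite (Dalpha w Iw) (dotZl ('D_1 rho w)) (dotZr ('D_1 rho w)).
    have [_ l2] := ellP (VKr w Iw); have l3 := congr1 (fun t => 'D_1 rho w * ('D_1 rho w * t)) l2.
    apply: (etrans (esym l3)); rewrite -/(el _) {l2 l3}.
    have := Drho w Iw; move: ('D_1 rho w) (el (rho w)) => s t st.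
    by transitivity ((s * t) ^+ 2); [ring|rewrite st expr1n].
  - move=> w Iw; have [_ nn _] := frame (VKr w Iw).
    have [bb nb _ _ _] := BnP (VKr w Iw).
    by split; rewrite (dotZl k) (dotZr k) ?nn ?bb ?nb ?mulr1 ?mulr0.
  move=> w Iw; have [_ _ ng] := frame (VKr w Iw).
  have [_ _ bg bDg _] := BnP (VKr w Iw); rewrite (Dalpha w Iw) !(dotZl k) !(dotZr ('D_1 rho w)).
  by rewrite ng bg bDg (nuDG _ (VKr w Iw)) !mulr0.
move=> z Vz /=; split; first exact: V2I.
have [-> z1E _ V1z _] := phiP z Vz.
have [cp sq'] := thP _ V1z; have Vphz := V1V _ V1z.
have -> : z 0 1 / `|c| = th (phi z) by rewrite z1E mulrC mulrA mulVf ?mul1r// gt_eqF.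
rewrite cp sq' (G_indep Vphz) -/(K _) {1}(rhoE z Vz); congr (_ + _).
have [{1}-> _] := expansion Vphz; rewrite (rhoE z Vz).
rewrite !scalerDr !scalerA; congr (_ *: _ + _ *: _); rewrite /k; field; rewrite gt_eqF.
Unshelve. all: by end_near. Qed.

End frame.

Lemma curve_case_coord : exists V2 phi, [/\ chart_change V V2 phi, (phi @` V2) z1 &
  curve_type V2 (fun z => phi z 0 0 *: G (phi z) + c *: nu (phi z))].
Proof.
have [Bn sBn BnP] := binormal; have [ell sell ellP] := speed.
exact: curve_frame_case sBn sell BnP ellP.
Qed.

End curve.

Lemma eq_curve_type (R : realType) (U : set 'rV[R]_3) (f g : 'rV[R]_3 -> 'rV[R]_4) :
  (forall z, U z -> f z = g z) -> curve_type U f -> curve_type U g.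
Proof.
move=> fg [I [alpha [A [B [c [H c0 fE]]]]]]; exists I, alpha, A, B, c; split=> // q Uq.
by rewrite -fg//; exact: fE.
Qed.

Lemma derive_dot_gradient (R : realType) n (g : 'rV[R]_n -> R) p w : differentiable g p ->
  'D_w g p = dot (\row_i 'D_(delta_mx 0 i) g p) w.
Proof.
move=> dg; rewrite (derive_sum_basis w dg) dotE; apply: eq_bigr => i _.
by rewrite mxE mulrC.
Qed.

(** * Adapted coordinates on a patch of rank one *)

Section polar_curve.
Context {R : realType} {U : set 'rV[R]_3} {t : 'rV[R]_3 -> R}
  {y n : 'rV[R]_3 -> 'rV[R]_4} {c : R}.
Hypothesis P : polar_patch U t y n c.

Let oU : open U. Proof. by case: P => -[]. Qed.
Let st : smooth_on U t. Proof. by case: P => -[_ []]. Qed.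
Let sy : smooth_on U y. Proof. by case: P => -[_ []]. Qed.
Let sn : smooth_on U n. Proof. by case: P => -[_ []]. Qed.
Let dt q : U q -> differentiable t q. Proof. exact: smooth_differentiable. Qed.
Let dy q : U q -> differentiable y q. Proof. exact: smooth_differentiable. Qed.
Let dn q : U q -> differentiable n q. Proof. exact: smooth_differentiable. Qed.
Let radial q : U q -> exists v, [/\ 'D_v t q = 1, 'D_v y q = 0 & 'D_v n q = 0].
Proof. by case: P => _ + _ _ _; apply. Qed.
Let unit q : U q -> [/\ dot (y q) (y q) = 1, dot (n q) (n q) = 1 & dot (n q) (y q) = 0].
Proof. by case: P => _ _ + _ _; apply. Qed.
Let nDy q u : U q -> dot (n q) ('D_u y q) = 0.
Proof. by move=> Uq; case: P => _ _ _ + _ => /(_ _ Uq u)[]. Qed.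
Let sym q u w : U q -> dot ('D_u n q) ('D_w y q) = dot ('D_w n q) ('D_u y q).
Proof. by move=> Uq; case: P => _ _ _ + _ => /(_ _ Uq u)[_]; apply. Qed.
Let immersed q u : U q -> 'D_u t q = 0 -> 'D_u y q = 0 -> c *: 'D_u n q = 0 -> u = 0.
Proof. by case: P => _ _ _ _ + Uq; apply. Qed.

Variables (q2 u1 : 'rV[R]_3).
Hypotheses (Uq2 : U q2) (Dy1 : 'D_u1 y q2 != 0).
Hypothesis rank1 : forall q u1 u2, U q ->
  ~ (forall a b, a *: 'D_u1 y q + b *: 'D_u2 y q = 0 -> a = 0 /\ b = 0).

Let a := 'D_u1 y q2.
Let U' := [set q | U q /\ 0 < dot ('D_u1 y q) a].

Let oU' : open U'.
Proof.
apply: open_gt0 => // q Uq; apply: differentiable_dot; last exact: differentiable_cst.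
exact: (smooth_differentiable (smooth_derive u1 sy) Uq).
Qed.

Let U'U q : U' q -> U q. Proof. by case. Qed.

Let U'q2 : U' q2. Proof. by split=> //; rewrite dot_gt0. Qed.

(** Rank one: D_w y is proportional to D_u1 y, whose product with a is positive on U', so a single
    linear functional detects whether D_w y vanishes. *)
Let Dy_eq0 q w : U' q -> dot ('D_w y q) a = 0 -> 'D_w y q = 0.
Proof.
move=> [Uq ua] wa; apply/eqP; apply/negPn/negP => wn0; apply: (rank1 Uq (u1 := u1) (u2 := w)) => l m E.
have l0 : l = 0.
  have := congr1 (fun z => dot z a) E; rewrite dotDl (dotZl l) (dotZl m) wa mulr0 addr0 dot0l.
  by move=> /eqP; rewrite mulf_eq0 (gt_eqF ua) orbF => /eqP.
split=> //; move: E; rewrite l0 scale0r add0r => /eqP.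
by rewrite scaler_eq0 (negPf wn0) orbF => /eqP.
Qed.

(** The two linear forms dt and <dy, a> have a common zero in dimension three, and [Dy_eq0] upgrades
    the second condition to dy = 0. *)
Let null_direction : exists2 v, v != 0 & 'D_v t q2 = 0 /\ 'D_v y q2 = 0.
Proof.
have dya : differentiable (fun q => dot (y q) a) q2.
  by apply: differentiable_dot; [exact: dy|exact: differentiable_cst].
have [v v0 [vt vy]] := kernel32 (\row_i 'D_(delta_mx 0 i) t q2)
  (\row_i 'D_(delta_mx 0 i) (fun q => dot (y q) a) q2).
exists v => //; split; first by rewrite (derive_dot_gradient v (dt Uq2)).
apply: Dy_eq0 => //; rewrite -(derive_dotl v a (dy Uq2)).
by rewrite (derive_dot_gradient v dya).
Qed.

(** A vector v' killed by dt and dy cannot be killed by c dn, since f is an immersion; in particular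
    c <> 0. With b = D_v' n and a = D_u1 y at q2, the functions t, <n, b>, <y, a> are coordinates in
    which y depends on the last one only. *)
Lemma curve_case : exists V phi, [/\ chart_change U V phi, (phi @` V) q2 &
  curve_type V (fun z => t (phi z) *: y (phi z) + c *: n (phi z))].
Proof.
have [v' v'0 [v't v'y]] := null_direction.
have [b bE] : exists b, b = 'D_v' n q2 by eexists.
have cb : c *: b != 0.
  by apply: contra_neq v'0; rewrite bE => /(immersed Uq2 v't v'y).
have c0 : c != 0 by apply: contra_neq cb => ->; rewrite scale0r.
have b0 : b != 0 by apply: contra_neq cb => ->; rewrite scaler0.
pose Phi := polar_coord (t := t) n y b a.
have sPhi : smooth_on U' Phi by exact: (smoothS U'U (smooth_polar_coord P b a sn sy)).
have inj w : 'D_w Phi q2 = 0 -> w = 0.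
  move=> /(polar_coord_eq0 P sn sy Uq2)[wt wb wa].
  have wy := Dy_eq0 U'q2 wa; have [v [vt vy vn]] := radial Uq2.
  have D k l m (W : normedModType R) (h : 'rV[R]_3 -> W) : differentiable h q2 ->
      'D_(k *: v + l *: u1 + m *: v') h q2 = k *: 'D_v h q2 + l *: 'D_u1 h q2 + m *: 'D_v' h q2.
    move=> dh; rewrite (deriveDv _ _ dh) (deriveDv _ _ dh).
    by rewrite (deriveZv k v dh) (deriveZv l u1 dh) (deriveZv m v' dh).
  have Dy k l m : 'D_(k *: v + l *: u1 + m *: v') y q2 = l *: a.
    by rewrite (D _ _ _ _ _ (dy Uq2)) vy v'y !scaler0 add0r addr0.
  have Dt k m : 'D_(k *: v + 0 *: u1 + m *: v') t q2 = k.
    rewrite (D _ _ _ _ _ (dt Uq2)) vt v't scale0r scaler0 !addr0.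
    exact: mulr1.
  have l_eq0 k l m : 'D_(k *: v + l *: u1 + m *: v') y q2 = 0 -> l = 0.
    by rewrite Dy => /eqP; rewrite scaler_eq0 (negPf Dy1) orbF => /eqP.
  have [k [l [m wE]]] : exists k l m, w = k *: v + l *: u1 + m *: v'.
    apply: basis3 => k l m E.
    have l0 : l = 0 by apply: (l_eq0 k l m); rewrite E derive0.
    have k0 : k = 0 by rewrite -(Dt k m) -l0 E derive0.
    split=> //; move: E; rewrite k0 l0 !scale0r !add0r => /eqP.
    by rewrite scaler_eq0 (negPf v'0) orbF => /eqP.
  have l0 : l = 0 by apply: (l_eq0 k l m); rewrite -wE.
  have k0 : k = 0 by rewrite -[LHS](Dt k m) -[X in _ + X *: u1 + _]l0 -wE.
  move: wb; rewrite wE l0 k0 !scale0r !add0r (deriveZv m v' (dn Uq2)) -bE (dotZl m).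
  by move=> /eqP; rewrite mulf_eq0 dot_eq0 (negPf b0) orbF => /eqP ->; rewrite scale0r.
have [d [phi [[d0 phi0] cphi Vphi Dphi]]] := local_coordinates oU' U'q2 sPhi inj.
move: phi0 cphi Vphi Dphi; move: (Phi q2) => z1 phi0 cphi Vphi Dphi.
have [oV _ sphi _] := cphi.
set V := [set z | `|z - z1| < d] in cphi Vphi Dphi oV sphi.
have VU z : V z -> U (phi z) by move=> /Vphi[/U'U].
have dphi z : V z -> differentiable phi z by exact: smooth_differentiable.
have Dcomp (h : 'rV[R]_3 -> 'rV[R]_4) z u : smooth_on U h -> V z ->
    'D_u (h \o phi) z = 'D_('D_u phi z) h (phi z).
  move=> sh Vz; apply: diff_comp_derive; first exact: dphi.
  exact: (smooth_differentiable sh (VU _ Vz)).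
have DPhi z u : V z -> [/\ 'D_('D_u phi z) t (phi z) = u 0 0,
    dot ('D_('D_u phi z) n (phi z)) b = u 0 1 & dot ('D_('D_u phi z) y (phi z)) a = u 0 2].
  move=> Vz; apply/vec3_inj.
  apply: (etrans (esym (derive_polar_coord P b a sn sy ('D_u phi z) (VU _ Vz)))).
  rewrite -vec3E.
  have dPhi := smooth_differentiable sPhi (Vphi _ Vz).1.
  apply: (etrans (esym (diff_comp_derive u (dphi _ Vz) dPhi))).
  apply: (etrans _ (derive_id z u)); apply: near_eq_derive; near=> w.
  by apply: (Vphi w _).2; near: w; exact: open_nbhs_nbhs.
have DG0 z (u : 'rV[R]_3) : V z -> u 0 2 = 0 -> 'D_('D_u phi z) y (phi z) = 0.
  move=> Vz u2; apply: Dy_eq0; first by case: (Vphi z Vz).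
  by have [_ _ ->] := DPhi z u Vz.
have sG : smooth_on V (y \o phi) by exact: smooth_comp oV oU VU sphi sy.
have snu : smooth_on V (n \o phi) by exact: smooth_comp oV oU VU sphi sn.
have dG z : V z -> differentiable (y \o phi) z by exact: smooth_differentiable.
have zV (z : 'rV[R]_3) : V z -> V (vec3 (z1 0 0) (z 0 1) (z 0 2)) /\ V (vec3 (z1 0 0) (z1 0 1) (z 0 2)).
  by rewrite /V /= !norm3_lt// !mxE/= => /and3P[_ -> ->]; rewrite !subrr !normr0 d0.
have [V2 [phi2 [cphi2 im2 ct2]]] : exists V2 phi2, [/\ chart_change V V2 phi2, (phi2 @` V2) z1 &
    curve_type V2 (fun z => phi2 z 0 0 *: (y \o phi) (phi2 z) + c *: (n \o phi) (phi2 z))].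
  apply: (curve_case_coord (a := a)) => //.
  - move=> z Vz; have [Vz0 Vz1] := zV z Vz.
    have E := @coord_indep R 3 4 (y \o phi) z1 d 0 dG.
    have E' := @coord_indep R 3 4 (y \o phi) z1 d 1 dG.
    have zE : z = (z 0 0 - z1 0 0) *: delta_mx 0 0 + vec3 (z1 0 0) (z 0 1) (z 0 2).
      by rewrite {1}(vec3E z) (vec3_line0 _ (z1 0 0)).
    have zE' := vec3_line1 (z1 0 0) (z 0 1) (z1 0 1) (z 0 2).
    transitivity ((y \o phi) (vec3 (z1 0 0) (z 0 1) (z 0 2))).
      rewrite {1}zE; apply: E => //; last by rewrite -zE.
      by move=> w Vw; rewrite (Dcomp y w _ sy Vw) DG0// mxE.
    rewrite {1}zE'; apply: E' => //; last by rewrite -zE'.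
    by move=> w Vw; rewrite (Dcomp y w _ sy Vw) DG0// mxE.
  - by move=> z Vz; exact: unit (VU _ Vz).
  - by move=> z u Vz; rewrite (Dcomp y z u sy Vz); exact: nDy (VU _ Vz).
  - move=> z Vz; have Uz := VU _ Vz; rewrite (Dcomp n z _ sn Vz).
    have [_ e1b _] := DPhi z (delta_mx 0 1) Vz.
    split.
    + apply: contra_eq_neq e1b => ->; rewrite dot0l mxE/= eq_sym; exact: oner_neq0.
    + have ny w : U w -> dot (n w) (y w) = 0 by move=> /unit[].
      have := eq_cst_derive0 ('D_(delta_mx 0 1) phi z) oU Uz ny.
      rewrite (derive_dot _ (dn Uz) (dy Uz)) (nDy _ Uz) addr0; exact.
    (* By the symmetry clause <D_1 n, D_u y> = <D_u n, D_1 y>, and y does not vary with the middle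
       coordinate. *)
    + move=> u; rewrite (Dcomp y z u sy Vz) (sym _ _ Uz) DG0 ?mxE//.
      exact: dot0r.
  - by move=> z Vz; have [_] := Vphi z Vz; rewrite {2}(vec3E z) => /vec3_inj[].
exists V2, (phi \o phi2); split.
- by apply: chart_change_comp cphi2; apply: chart_changeS cphi => z /U'U.
- by have [w Vw wE] := im2; exists w => //=; rewrite wE.
apply: eq_curve_type ct2 => z V2z /=; congr (_ *: _ + _).
have [_ [Phi2 /(_ z V2z)[Vz _ _]] _ _] := cphi2.
by have [_] := Vphi _ Vz; rewrite {2}(vec3E (phi2 z)) => /vec3_inj[].
Unshelve. all: by end_near. Qed.

End polar_curve.

(** * Rank zero and classification *)

Lemma polar_patch_radial (R : realType) (U : set 'rV[R]_3) (f n : 'rV[R]_3 -> 'rV[R]_4) (c : R) :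
  hypersurface_patch U f n -> (forall q, U q -> dot (f q) (n q) = c) ->
  (forall q, U q -> 0 < dot (f q) (f q) - c ^+ 2) ->
  polar_patch U (@radius R f c) (@direction R f n c) n c.
Proof.
move=> P fn pos; have [oU [sf sn] _ nn _] := P.
split.
- split=> //; split=> //; first exact: smooth_radius P pos.
  exact: smooth_direction P pos.
- by move=> q Uq; have [v [_ ? ? ?]] := radial_field P fn pos Uq; exists v.
- move=> q Uq; split; [exact: (direction_unit P fn pos Uq)|exact: nn|].
  by rewrite dotC (direction_normal P fn Uq).
- move=> q Uq u; split; first exact: (derive_direction_normal P fn pos u Uq).
  by move=> w; exact: (derive_normal_direction_sym P fn pos u w Uq).
move=> q Uq u ut uy un; apply: (patch_inj P Uq).
by rewrite (derive_patch_decomp P pos u Uq) ut uy un scale0r scaler0 !addr0.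
Qed.

(** Householder reflection in the hyperplane orthogonal to w = y - e: as y and e are unit vectors, 2
    <y, w> = <w, w>, so y - k <y, w> w = e. *)
Lemma reflection_to_e3 (R : realType) (y : 'rV[R]_4) : dot y y = 1 ->
  exists2 Q : 'M[R]_4, Q *m Q^T = 1%:M & y *m Q = delta_mx 0 3.
Proof.
move=> yy; have [->|ye] := eqVneq y (delta_mx 0 3).
  by exists 1%:M; rewrite ?trmx1 mulmx1.
pose e : 'rV[R]_4 := delta_mx 0 3.
have ee : dot e e = 1 by rewrite dot_delta mxE !eqxx.
have [w wE] : exists w, w = y - e by eexists.
have w0 : dot w w != 0 by rewrite dot_eq0 wE subr_eq0.
pose k := 2 / dot w w.
have yw : k * dot y w = 1.
  have ww : dot w w = 2 * dot y w.
    by rewrite wE dotBl !dotBr (dotC e y) yy ee; ring.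
  by rewrite /k ww; field; apply: contra_neq w0 => yw0; rewrite ww yw0 mulr0.
have rank1 (v : 'rV[R]_4) : v *m (w^T *m w) = dot v w *: w.
  by rewrite mulmxA [v *m w^T]mx11_scalar mul_scalar_mx.
exists (1%:M - k *: (w^T *m w)); last first.
  by rewrite mulmxBr mulmx1 -scalemxAr rank1 scalerA yw scale1r wE opprB addrCA subrr addr0.
have S : (w^T *m w)^T = w^T *m w by rewrite trmx_mul trmxK.
have WW : (w^T *m w) *m (w^T *m w) = dot w w *: (w^T *m w).
  by rewrite -mulmxA rank1 -scalemxAr.
have -> : (1%:M - k *: (w^T *m w))^T = 1%:M - k *: (w^T *m w).
  by apply/matrixP => i j; move/matrixP/(_ i j): S; rewrite !mxE eq_sym => ->.
rewrite mulmxBl mul1mx mulmxBr mulmx1 -scalemxAl -scalemxAr WW !scalerA.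
rewrite -addrA -[RHS]addr0; congr (_ + _).
have -> : k * k * dot w w = k + k by rewrite /k; field.
by rewrite scalerDl opprB addrK addNr.
Qed.

(** * Rank zero: constant direction *)

Section spherical.
Context {R : realType} {U : set 'rV[R]_3} {t : 'rV[R]_3 -> R}
  {y n : 'rV[R]_3 -> 'rV[R]_4} {c : R}.
Hypothesis P : polar_patch U t y n c.

(** Rotate the constant vector y to the last axis. The last coordinate of the rotated f is then t,
    while |f|^2 = t^2 + c^2, so the other three coordinates lie on the sphere of radius |c|. *)
Lemma sphere_case (q0 : 'rV[R]_3) (d : R) : 0 < d -> U = [set q | `|q - q0| < d] ->
  (forall q u, U q -> 'D_u y q = 0) ->
  exists2 Q : 'M[R]_4, Q *m Q^T = 1%:M &
    spherical_hypercylinder U (fun q => (t q *: y q + c *: n q) *m Q).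
Proof.
move=> d0 UE Dy; have [[oU [st sy sn]] _ unit _ immersed] := P.
have Uq0 : U q0 by rewrite UE /= subrr normr0.
have dy q : U q -> differentiable y q by exact: smooth_differentiable.
have yE q : U q -> y q = y q0.
  move=> Uq; apply/rowP => i.
  apply: (derive_eq0_cst (f := fun q => y q 0 i) (p := q0) (e := d)).
  - by move=> z zd; apply: (differentiable_rV y z).1; apply: dy; rewrite UE.
  - move=> z v zd; have Uz : U z by rewrite UE.
    by rewrite -(derive_rV v i (dy _ Uz)) Dy// mxE.
  by move: Uq; rewrite UE.
(* With c = 0 and y constant, any vector killing dt would be killed by df. Such a nonzero vector
   exists; the second form given to [kernel32] is just 0. *)
have c0 : c != 0.
  apply/negP => /eqP c0.
  have [v v0 [vt _]] := kernel32 (\row_i 'D_(delta_mx 0 i) t q0) 0.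
  move/eqP: v0; apply; apply: (immersed _ Uq0); last by rewrite c0 scale0r.
    by rewrite (derive_dot_gradient v (smooth_differentiable st Uq0)).
  exact: Dy.
have [yy _ _] := unit _ Uq0; have [Q QQ yQ] := reflection_to_e3 yy.
exists Q => //; exists c; split=> // q Uq.
have [_ nn ny] := unit _ Uq; rewrite (yE q Uq) in ny *.
have [f fE] : exists f, f = t q *: y q0 + c *: n q by eexists.
rewrite -fE; have ff : dot f f = t q ^+ 2 + c ^+ 2.
  rewrite fE !dotDl !dotDr !(dotZl (t q)) !(dotZr (t q)) !(dotZl c) !(dotZr c) yy nn ny.
  by rewrite (dotC (y q0)) ny; ring.
have fQ : dot (f *m Q) (f *m Q) = dot f f by rewrite dot_mulmx -mulmxA QQ mulmx1.
have f3 : (f *m Q) 0 3 = t q.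
  rewrite -[LHS](dot_delta) -yQ dot_mulmx -mulmxA QQ mulmx1 fE.
  rewrite dotDr (dotZr (t q)) (dotZr c) yy (dotC (y q0)) ny.
  by rewrite mulr1 mulr0 addr0.
have := etrans fQ ff; rewrite dot4 f3 => E.
apply: (addIr (t q * t q)); rewrite !expr2 E; ring.
Qed.

End spherical.

Lemma eq_surface_type (R : realType) (U : set 'rV[R]_3) (f g : 'rV[R]_3 -> 'rV[R]_4) :
  (forall z, U z -> f z = g z) -> surface_type U f -> surface_type U g.
Proof.
move=> fg [Om [y [n [c [H fE]]]]]; exists Om, y, n, c; split=> // q Uq.
by rewrite -fg//; exact: fE.
Qed.

(** * Classification on a dense open set *)

Section classification.
Context {R : realType} {M : topologicalType} {x N : M -> 'rV[R]_4}.
Hypotheses (hN : unit_normal_field x N) (h3 : three_minimal x N).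

Definition classified p := [\/ locally_congruent x p (@hypercylinder R),
  locally_congruent x p (@surface_type R) | locally_congruent x p (@curve_type R)].

(** If x^T vanished throughout the chart, x would be c N there, and a null vector of dN, which
    3-minimality provides, would be a null vector of the immersion x. *)
Lemma nonzero_tangential_point U psi c q0 : local_param x U psi -> U q0 ->
  (forall q, U q -> dot (x (psi q)) (N (psi q)) = c) ->
  exists2 q, U q & 0 < dot (x (psi q)) (x (psi q)) - c ^+ 2.
Proof.
move=> H Uq0 gc; have P := chart_patch hN H; have [oU [sx sN] _ nn _] := P.
apply: contrapT => H0.
have fE q : U q -> x (psi q) = c *: N (psi q).
  move=> Uq; apply/eqP; rewrite -subr_eq0 -dot_eq0; apply/eqP.
  have TT : dot (x (psi q) - c *: N (psi q)) (x (psi q) - c *: N (psi q)) =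
      dot (x (psi q)) (x (psi q)) - c ^+ 2.
    rewrite dotBl !dotBr !(dotZl c) !(dotZr c) (dotC (N _) (x _)) gc// (nn q Uq).
    ring.
  apply/eqP; rewrite eq_le dot_ge0 andbT leNgt TT; apply/negP => pos.
  by apply: H0; exists q.
have [v /eqP v0 vn] := three_minimal_kernel hN H h3 Uq0; apply: v0.
apply: (patch_inj P Uq0); apply: etrans (_ : 'D_v (fun q => c *: (N \o psi) q) q0 = 0).
  apply: near_eq_derive; near=> q; apply: fE; near: q; exact: open_nbhs_nbhs.
apply: (etrans (deriveZ c (diff_derivable (smooth_differentiable sN Uq0)))).
by rewrite vn scaler0.
Unshelve. all: by end_near. Qed.

Lemma congruent_chart U V psi phi q (model : set 'rV[R]_3 -> ('rV[R]_3 -> 'rV[R]_4) -> Prop) :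
  local_param x U psi -> chart_change U V phi -> (phi @` V) q ->
  model V (fun z => x (psi (phi z)) *m 1%:M) -> locally_congruent x (psi q) model.
Proof.
move=> H cphi [z Vz zq] mV; exists 1%:M, V, (psi \o phi); split=> //.
- by rewrite trmx1 mulmx1.
- exact: local_param_comp H cphi.
- by exists z => //=; rewrite zq.
Qed.

(** The chart is shrunk to a ball where g is constant, then to one where x^T does not vanish. There
    the rank of y is two at some point, or else one at some point, or else zero everywhere. In the
    first two cases the point cannot be prescribed, so the conclusion is only that some point of the
    chart is classified. *)
Lemma chart_classified U psi q0 : @support_locally_cst R M x N -> local_param x U psi -> U q0 ->
  exists2 q, U q & classified (psi q).
Proof.
move=> hs H Uq0; have [oU _ _ _ _] := H; have [_ [sx sN] _ _ _] := chart_patch hN H.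
have [d d0 Hd] := open_ballP oU Uq0.
pose B := [set q | `|q - q0| < d].
have oB : open B by exact: open_norm_lt.
have BU : B `<=` U by move=> q /Hd; rewrite subrK.
have HB := local_paramS H oB BU.
have dg q : U q -> differentiable (fun q => dot (x (psi q)) (N (psi q))) q.
  by move=> Uq; apply: differentiable_dot; [exact: smooth_differentiable sx Uq|exact: smooth_differentiable sN Uq].
have [c gc] : exists c, forall q, B q -> dot (x (psi q)) (N (psi q)) = c.
  exists (dot (x (psi q0)) (N (psi q0))) => q Bq.
  apply: (derive_eq0_cst (f := fun q => dot (x (psi q)) (N (psi q))) (p := q0) (e := d)) => //.
    by move=> z /BU; exact: dg.
  by move=> z v /BU Uz; exact: hs H _ _ Uz.
have Bq0 : B q0 by rewrite /B/= subrr normr0.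
have [q1 Bq1 pos1] := nonzero_tangential_point HB Bq0 gc.
pose O := [set q | B q /\ 0 < dot (x (psi q)) (x (psi q)) - c ^+ 2].
have oO : open O.
  apply: open_gt0 => // q /BU Uq; apply: differentiableB => //.
  by apply: differentiable_dot; exact: smooth_differentiable sx Uq.
have [e e0 He] := open_ballP oO (conj Bq1 pos1 : O q1).
have [W WE] : exists W, W = [set q | `|q - q1| < e] by eexists.
have oW : open W by rewrite WE; exact: open_norm_lt.
have WO q : W q -> O q by rewrite WE => /He; rewrite subrK.
have Wq1 : W q1 by rewrite WE/= subrr normr0.
have WU : W `<=` U by move=> q /WO[/BU].
have HW := local_paramS H oW WU.
have PW := chart_patch hN HW.
have fn q : W q -> dot ((x \o psi) q) ((N \o psi) q) = c by move=> /WO[/gc].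
have pos q : W q -> 0 < dot ((x \o psi) q) ((x \o psi) q) - c ^+ 2 by move=> /WO[].
have P := polar_patch_radial PW fn pos.
have fE q : W q -> x (psi q) = radius (x \o psi) c q *: direction (x \o psi) (N \o psi) c q +
    c *: (N \o psi) q by exact: (patch_decomp pos).
move: P fE; set t := radius _ _; set y := direction _ _ _ => P fE.
have chartE V phi z : chart_change W V phi -> V z ->
    t (phi z) *: y (phi z) + c *: (N \o psi) (phi z) = x (psi (phi z)) *m 1%:M.
  by move=> [_ [Phi HPhi] _ _] /HPhi[Wz _ _]; rewrite mulmx1 [RHS]fE.
have [[q2 [u1 [u2 [Wq2 indep]]]]|nindep] := pselect (exists q u1 u2, W q /\
  forall a b, a *: 'D_u1 y q + b *: 'D_u2 y q = 0 -> a = 0 /\ b = 0).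
  have [V [phi [cphi im ty]]] := surface_case P Wq2 indep.
  exists q2; [exact: WU|apply: Or32; apply: (congruent_chart HW cphi im)].
  by apply: eq_surface_type ty => z; exact: chartE cphi.
have [[q2 [u1 [Wq2 Dy]]]|Dy0] := pselect (exists q u, W q /\ 'D_u y q != 0).
  have rank1 q v1 v2 : W q ->
      ~ (forall a b, a *: 'D_v1 y q + b *: 'D_v2 y q = 0 -> a = 0 /\ b = 0).
    by move=> Wq indep; apply: nindep; exists q, v1, v2.
  have [V [phi [cphi im ty]]] := curve_case P Wq2 Dy rank1.
  exists q2; [exact: WU|apply: Or33; apply: (congruent_chart HW cphi im)].
  by apply: eq_curve_type ty => z; exact: chartE cphi.
have Dy q u : W q -> 'D_u y q = 0.
  by move=> Wq; apply: contrapT => /eqP Dy; apply: Dy0; exists q, u.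
have [Q QQ [r [r0 sph]]] := sphere_case P e0 WE Dy.
exists q1; first exact: WU.
apply: Or31; exists Q, W, psi; split=> //.
by apply: Or42; exists r; split=> // q Wq; rewrite fE//; exact: sph.
Qed.

Lemma open_classified : open [set p | classified p].
Proof.
rewrite openE => p cp.
have ball (model : set 'rV[R]_3 -> ('rV[R]_3 -> 'rV[R]_4) -> Prop) : locally_congruent x p model ->
    nbhs p [set p' | locally_congruent x p' model].
  move=> [Q [U [psi [QQ H Up mU]]]]; have [oU _ _ opsi _] := H.
  have : nbhs p (psi @` U) by apply: open_nbhs_nbhs; split=> //; exact: opsi.
  by apply: filterS => p' Up'; exists Q, U, psi.
by case: cp => /ball; apply: filterS => p' cp'; [apply: Or31|apply: Or32|apply: Or33].
Qed.

Lemma dense_classified : hypersurface x -> @support_locally_cst R M x N ->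
  dense [set p | classified p].
Proof.
move=> [_ _ _ hc] hs O [p Op] oO; have [U [psi [H [q Uq qp]]]] := hc p.
have [oU _ _ _ _] := H.
have : nbhs q (psi @^-1` O).
  apply: (local_param_continuous H Uq); rewrite qp; exact: open_nbhs_nbhs.
rewrite nbhsE => -[W [oW Wq] WO].
have oUW : open (U `&` W) by exact: openI.
have HW := local_paramS H oUW (@subIsetl _ U W).
have [z [Uz /WO Oz] cz] := chart_classified hs HW (conj Uq Wq).
by exists (psi z).
Qed.

Lemma classified_support p : classified p -> exists O c, [/\ open O, O p &
  forall m, O m -> dot (x m) (N m) ^+ 2 = c].
Proof.
case=> [[Q [U [psi [QQ H Up [m|m|m|m]]]]]||].
- by apply: (hyperplane_support hN); exists Q, U, psi.
- by apply: (spherical_support hN); exists Q, U, psi.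
- by apply: (circular_support hN); exists Q, U, psi.
- by apply: (conical_support hN); exists Q, U, psi.
- by move=> H; exact: (surface_support hN H).
by move=> H; exact: (curve_support hN H).
Qed.

End classification.

Theorem theorem4p12 (R : realType) (M : topologicalType)
    (x N : M -> 'rV[R]_4)
    (hM : oriented_hypersurface x N) (h3 : three_minimal x N) :
  gcr x N <->
  exists D : set M,
    [/\ open D, dense D
      & forall p, D p ->
          [\/ locally_congruent x p (@hypercylinder R),
              locally_congruent x p (@surface_type R)
            | locally_congruent x p (@curve_type R)]].
Proof.
have [hx hN] := hM; split=> [hgcr|[D [oD dD HD]]].
  exists [set p | classified (x := x) p]; split=> //; first exact: open_classified.
  exact: dense_classified hN h3 hx (gcr_support hN h3 hgcr).
apply: (support_gcr hN hx); apply: (dense_support hN oD dD) => p /HD.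
exact: classified_support.
Qed.
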